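(* Let $T$ be any $m$-linear Calderón–Zygmund operator on $\mathbb R^n$ with the modulus of continuity $\rho$ of the kernel satisfying $$\int_0^1\rho(t)\log\frac1t\,\frac{dt}{t}<+\infty .$$ Then, for every $f_1,\dots,f_m\in L^\infty_0$, there exist $3^n$ dyadic lattices $\mathscr D^{(j)}$ ($j=1,\dots,3^n$) and $14\cdot3^n$-Carleson families $\mathcal S_j\subset\mathscr D^{(j)}$ such that $$|T[f_1,\dots,f_m]|\le C(T)\sum_{j=1}^{3^n}\mathcal A_{\mathcal S_j,m}[|f_1|,\dots,|f_m|]$$ almost everywhere. The constant $C(T)$ depends only on $n$, $m$, $\rho$, the constant in the kernel estimates of $T$, and the constant in the weak type bound for $T$.
   Context: A cube in $\mathbb R^n$ is a half-open cube $[x_1,x_1+\ell)\times\dots\times[x_n,x_n+\ell)$, $\ell>0$; $\ell_Q$ denotes the sidelength of $Q$, $c(Q)$ its center, and $Q_{[t]}=c(Q)+t(Q-c(Q))$ for $t>0$. The children of a cube $Q$ are the $2^n$ half-open cubes obtained by halving each edge of $Q$; $\mathcal D(Q)$ denotes the family consisting of $Q$, its children, the children of its children, etc. A dyadic lattice $\mathscr D$ in $\mathbb R^n$ is any collection of cubes such that: (1) if $Q\in\mathscr D$, then each child of $Q$ is in $\mathscr D$; (2) for every $Q',Q''\in\mathscr D$ there exists $Q\in\mathscr D$ with $Q',Q''\in\mathcal D(Q)$; (3) for every compact set $K\subset\mathbb R^n$ there exists a cube $Q\in\mathscr D$ containing $K$. For $\Lambda>1$, a family $\mathcal S\subset\mathscr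 D$ is $\Lambda$-Carleson if $\sum_{P\in\mathcal S,\,P\subset Q}|P|\le\Lambda|Q|$ for every cube $Q\in\mathscr D$. Sparse operators: $f_Q=(f)_Q=\frac1{|Q|}\int_Qf$, and for a Carleson family $\mathcal S\subset\mathscr D$, $$\mathcal A_{\mathcal S,m}[f_1,\dots,f_m]=\sum_{Q\in\mathcal S}\Big(\prod_{i=1}^m(f_i)_Q\Big)\chi_Q .$$ $L^\infty_0$ denotes the space of bounded measurable functions on $\mathbb R^n$ with compact support. An $m$-linear Calderón–Zygmund operator ($m\ge1$) is an $m$-linear operator $T$ taking $m$ functions $f_1,\dots,f_m\in L^1(\mathbb R^n)$ to an almost everywhere finite measurable function, associated with a measurable kernel $K(x,y_1,\dots,y_m)$, $x,y_i\in\mathbb R^n$, which may be singular only when $y_1=\dots=y_m=x$, in the sense that $$T[f_1,\dots,f_m](x)=\int_{(\mathbb R^n)^m}K(x,y_1,\dots,y_m)f_1(y_1)\cdots f_m(y_m)\,dy_1\cdots dy_m$$ whenever the integral makes sense (in particular, for almost every $x$ outside the intersection of the closed supports of the $f_i$). The following are required, for some constant $C$ and some modulus of continuity $\rho:[0,+\infty)\to[0,+\infty)$ (a continuous, increasing and subadditive function with $\rho(0)=0$): (i) $|K(x,y_1,\dots,y_m)|\le\dfrac{C}{(\max_i|x-y_i|)^{nm}}$; (ii) $|K(x',y_1,\dots,y_m)-K(x'',y_1,\dots,y_m)|\le\dfrac{C}{(t\ell_Q)^{mn}}\rho(t^{-1})$ whenever $Q$ is a cube, $x',x''\in Q$, $t\ge2$,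 and there exists $i$ such that $y_i\notin Q_{[t]}$; (iii) the weak type bound: for some constant $C$ and all $\alpha>0$, $f_i\in L^1(\mathbb R^n)$, $$|\{x\in\mathbb R^n:|T[f_1,\dots,f_m](x)|>\alpha\}|\le C\Big(\frac1\alpha\prod_{i=1}^m\|f_i\|_{L^1}\Big)^{1/m}.$$ *)

(* Defs.v *)
From HB Require Import structures.
From mathcomp Require Import all_boot all_order all_algebra.
From mathcomp Require Import all_classical all_reals all_analysis.
From mathcomp Require Import measurable_realfun.
Import Order.TTheory GRing.Theory Num.Theory.
Import numFieldNormedType.Exports.

Set Implicit Arguments.
Unset Strict Implicit.
Unset Printing Implicit Defensive.

Local Open Scope classical_set_scope.
Local Open Scope ring_scope.

(* [R^n] is ['rV[R]_n] and [(R^n)^m] is ['M[R]_(m, n)], the [i]-th point being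
   the [i]-th row.  Lebesgue measure on matrices is the completion of the
   product of [m * n] copies of the one-dimensional Lebesgue measure, so
   measurability below is Lebesgue (not only Borel) measurability. *)

Section sigma_finite_lemmas.
Local Open Scope ereal_scope.
Context d1 d2 (T1 : measurableType d1) (T2 : measurableType d2) (R : realType).

Lemma sigma_finite_pushforward (mu : {measure set T1 -> \bar R})
    (f : T1 -> T2) (g : T2 -> T1) :
  measurable_fun [set: T2] g -> cancel f g ->
  sigma_finite setT mu -> sigma_finite setT (pushforward mu f).
Proof.
move=> mg fK [F FT Foo]; exists (fun k => g @^-1` F k).
  by rewrite -preimage_bigcup -FT preimage_setT.
move=> k; have [mF Fk] := Foo k; split.
  by rewrite -[X in measurable X]setTI; exact: mg.
rewrite /pushforward (_ : f @^-1` _ = F k)//.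
by apply/seteqP; split=> x /=; rewrite fK.
Qed.

Lemma sigma_finite_product (m1 : {sigma_finite_measure set T1 -> \bar R})
    (m2 : {sigma_finite_measure set T2 -> \bar R}) :
  sigma_finite setT (m1 \x m2).
Proof.
have /sigma_finiteP[F [TF ndF Foo]] := sigma_finiteT m1.
have /sigma_finiteP[G [TG ndG Goo]] := sigma_finiteT m2.
exists (fun n => F n `*` G n).
  rewrite -setXTT TF TG predeqE => -[x y]; split.
    move=> [/= [n _ Fnx] [k _ Gky]]; exists (maxn n k) => //; split.
    - by move: x Fnx; exact/subsetPset/ndF/leq_maxl.
    - by move: y Gky; exact/subsetPset/ndG/leq_maxr.
  by move=> [n _ []/= ? ?]; split; exists n.
move=> k; have [? ?] := Foo k; have [? ?] := Goo k.
split; first exact: measurableX.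
by rewrite product_measure1E// lte_mul_pinfty// ge0_fin_numE.
Qed.

End sigma_finite_lemmas.

Section cons_measure.
Local Open Scope ereal_scope.
Context {R : realType} (n : nat).
Local Notation mR := (measurableTypeR R).

Definition cons_tuple_pair (p : mR * n.-tuple mR) : n.+1.-tuple mR :=
  [tuple of p.1 :: p.2].

Lemma measurable_cons_tuple_pair : measurable_fun setT cons_tuple_pair.
Proof. exact: measurable_cons. Qed.
Local Hint Resolve measurable_cons_tuple_pair : core.

Definition uncons_tuple (t : n.+1.-tuple mR) : mR * n.-tuple mR :=
  (thead t, [tuple of behead t]).

Lemma measurable_uncons_tuple : measurable_fun setT uncons_tuple.
Proof.
apply: measurable_fun_pair; last exact: measurable_behead.
exact: measurable_tnth.
Qed.

Lemma cons_tuple_pairK : cancel cons_tuple_pair uncons_tuple.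
Proof.
by case=> x t; rewrite /uncons_tuple theadE; congr pair; exact: val_inj.
Qed.

Variable mu : {sigma_finite_measure set (n.-tuple mR) -> \bar R}.

Definition cons_measure : set (n.+1.-tuple mR) -> \bar R :=
  pushforward (@lebesgue_measure R \x mu) cons_tuple_pair.

Let cons_measure0 : cons_measure set0 = 0.
Proof. exact: measure0. Qed.

Let cons_measure_ge0 A : 0 <= cons_measure A.
Proof. exact: measure_ge0. Qed.

Let cons_measure_sigma_additive : semi_sigma_additive cons_measure.
Proof. exact: measure_semi_sigma_additive. Qed.

HB.instance Definition _ := isMeasure.Build _ _ _ cons_measure
  cons_measure0 cons_measure_ge0 cons_measure_sigma_additive.

Let cons_measure_sigma_finite : sigma_finite setT cons_measure.
Proof.
apply: sigma_finite_pushforward; last exact: sigma_finite_product.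
- exact: measurable_uncons_tuple.
- exact: cons_tuple_pairK.
Qed.

HB.instance Definition _ := Measure_isSigmaFinite.Build _ _ _ cons_measure
  cons_measure_sigma_finite.

End cons_measure.

Fixpoint lebesgue_tuple {R : realType} (n : nat) :
    {sigma_finite_measure set (n.-tuple (measurableTypeR R)) -> \bar R} :=
  match n with
  | 0 => [the sigma_finite_measure _ _ of @dirac _ _ [tuple] R]
  | n'.+1 => [the sigma_finite_measure _ _ of cons_measure (lebesgue_tuple n')]
  end.

Section measurable_mx.
Variables (R : realType) (m n : nat).
Local Notation mR := (measurableTypeR R).

Let coords (k : 'I_(m * n)) (A : 'M[R]_(m, n)) : mR := mxvec A ord0 k.

Let mx_set0 : g_sigma_preimage coords set0.
Proof. exact: sigma_algebra0. Qed.

Let mx_setC A : g_sigma_preimage coords A -> g_sigma_preimage coords (~` A).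
Proof. exact: sigma_algebraC. Qed.

Let mx_bigcup (F : (set 'M[R]_(m, n))^nat) :
  (forall i, g_sigma_preimage coords (F i)) ->
  g_sigma_preimage coords (\bigcup_i (F i)).
Proof. exact: sigma_algebra_bigcup. Qed.

HB.instance Definition _ := @isMeasurable.Build default_measure_display 'M[R]_(m, n)
  (g_sigma_preimage coords) mx_set0 mx_setC mx_bigcup.

Definition mx_of_tuple (t : (m * n).-tuple mR) : 'M[R]_(m, n) :=
  \matrix_(i, j) tnth t (mxvec_index i j).

Lemma measurable_mx_of_tuple : measurable_fun setT mx_of_tuple.
Proof.
apply: (@measurability _ _ _ _ setT mx_of_tuple _ erefl).
move=> _ [B + <-]; elim/big_ind: _ => [[]|X Y IHX IHY [/IHX|/IHY]//|k _].
move=> [A mA <-]; rewrite !setTI (_ : _ @^-1` _ = (fun t => tnth t k) @^-1` A).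
  by rewrite -[X in measurable X]setTI; exact: measurable_tnth.
by apply/seteqP; split=> t /=; rewrite /coords;
  case/mxvec_indexP: k => i j; rewrite mxvecE mxE.
Qed.

Definition borel_lebesgue_mx : set 'M[R]_(m, n) -> \bar R :=
  pushforward (lebesgue_tuple (m * n)) mx_of_tuple.

Local Hint Resolve measurable_mx_of_tuple : core.

Let borel_lebesgue_mx0 : borel_lebesgue_mx set0 = 0%E.
Proof. exact: measure0. Qed.

Let borel_lebesgue_mx_ge0 A : (0 <= borel_lebesgue_mx A)%E.
Proof. exact: measure_ge0. Qed.

Let borel_lebesgue_mx_sigma_additive : semi_sigma_additive borel_lebesgue_mx.
Proof. exact: measure_semi_sigma_additive. Qed.

HB.instance Definition _ := isMeasure.Build _ _ _ borel_lebesgue_mx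
  borel_lebesgue_mx0 borel_lebesgue_mx_ge0 borel_lebesgue_mx_sigma_additive.

End measurable_mx.

(* ['M[R]_(m, n)] with the sigma-algebra of Lebesgue-measurable sets *)
Notation leb_mxType R m n :=
  (caratheodory_type (mu_ext (@borel_lebesgue_mx R m n))).

Definition lebesgue_mx {R : realType} (m n : nat) :
    set (leb_mxType R m n) -> \bar R :=
  @completed_measure_extension _ _ _ (@borel_lebesgue_mx R m n).

Arguments lebesgue_mx {R} m n _.

HB.instance Definition _ (R : realType) (m n : nat) :=
  Measure.on (@lebesgue_mx R m n).

Section box_volume.
Variable R : realType.
Local Notation mR := (measurableTypeR R).

Lemma measurable_tuple_box n (a b : 'I_n -> R) :
  measurable [set t : n.-tuple mR | forall i, a i <= tnth t i < b i].
Proof.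
rewrite (_ : [set _ | _] =
    \bigcap_(i in [set: 'I_n]) ((fun t => tnth t i) @^-1` `[a i, b i[)).
  apply: fin_bigcap_measurable => // i _; rewrite -[X in measurable X]setTI.
  by apply: measurable_tnth => //; exact: measurable_itv.
by apply/seteqP; split=> t /= H i; [move=> _|]; have := H i; rewrite /= in_itv/=; auto.
Qed.

Lemma lebesgue_tuple_box n (a b : 'I_n -> R) : (forall i, a i <= b i) ->
  lebesgue_tuple n [set t : n.-tuple mR | forall i, a i <= tnth t i < b i] =
  (\prod_(i < n) (b i - a i))%:E.
Proof.
elim: n a b => [|n IH] a b ab.
  rewrite big_ord0 /= diracE; congr (_%:E); rewrite mem_set//= => -[]//.
rewrite big_ord_recl EFinM -(IH (a \o lift ord0) (b \o lift ord0))//; last first.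
  by move=> i; exact: ab.
have -> : (b ord0 - a ord0)%:E = @lebesgue_measure R `[a ord0, b ord0[.
  rewrite lebesgue_measure_itv /= lte_fin; case: ltP => // ba.
  by rewrite (le_anti (_ : a ord0 <= b ord0 <= a ord0)) ?subrr// ab ba.
rewrite -product_measure1E; [|exact: measurable_itv|exact: measurable_tuple_box].
rewrite /= /cons_measure /pushforward; congr (_ _).
apply/seteqP; split=> [[x t]|[x t]] /=.
  move=> H; split; first by have := H ord0; rewrite /= in_itv.
  by move=> i; have := H (lift ord0 i); rewrite tnthS.
rewrite in_itv /= => -[H0 H] i.
by case: (unliftP ord0 i) => [j ->|->]; [rewrite tnthS; exact: H|].
Qed.

Lemma lebesgue_mx_box m n (a b : 'M[R]_(m, n)) :
  (forall i j, a i j <= b i j) ->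
  lebesgue_mx m n [set x : leb_mxType R m n | forall i j,
    a i j <= (x : 'M[R]_(m, n)) i j < b i j] =
  (\prod_(i < m) \prod_(j < n) (b i j - a i j))%:E.
Proof.
move=> ab.
have mbox : measurable [set x : 'M[R]_(m, n) | forall i j, a i j <= x i j < b i j].
  rewrite (_ : [set _ | _] = \bigcap_(k in [set: 'I_(m * n)])
      ((fun x => mxvec x ord0 k) @^-1` `[mxvec a ord0 k, mxvec b ord0 k[)).
    apply: fin_bigcap_measurable => // k _; apply: sub_sigma_algebra.
    rewrite -bigcup_seq/=; exists k; first by rewrite /= mem_index_enum.
    exists `[mxvec a ord0 k, mxvec b ord0 k[%classic; last by rewrite setTI.
    exact: measurable_itv.
  apply/seteqP; split=> x /= H.
    by move=> k _; case/mxvec_indexP: k => i j /=; rewrite in_itv /= !mxvecE.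
  by move=> i j; have := H (mxvec_index i j) I; rewrite /= in_itv /= !mxvecE.
rewrite /lebesgue_mx /completed_measure_extension measurable_mu_extE//.
rewrite /= /borel_lebesgue_mx /pushforward.
rewrite (_ : _ @^-1` _ = [set t | forall k,
    mxvec a ord0 k <= tnth t k < mxvec b ord0 k]); last first.
  apply/seteqP; split=> t /= H.
    by move=> k; case/mxvec_indexP: k => i j; have := H i j; rewrite mxE !mxvecE.
  by move=> i j; have := H (mxvec_index i j); rewrite mxE !mxvecE.
rewrite lebesgue_tuple_box; last first.
  by move=> k; case/mxvec_indexP: k => i j; rewrite !mxvecE.
rewrite pair_bigA (reindex _ (curry_mxvec_bij m n)) /=.
by congr (_%:E); apply: eq_bigr => -[i j] _ /=; rewrite !mxvecE.
Qed.

End box_volume.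

Section cubes.
Context {R : realType} {n : nat}.

Record cube := Cube {
  corner : 'rV[R]_n;
  side : R;
  side_gt0 : 0 < side }.

HB.instance Definition _ := gen_eqMixin cube.
HB.instance Definition _ := gen_choiceMixin cube.

Definition cube_set (Q : cube) : set 'rV[R]_n :=
  [set x | forall j, corner Q 0 j <= x 0 j < corner Q 0 j + side Q].

Definition center (Q : cube) : 'rV[R]_n := corner Q + const_mx (side Q / 2).

Definition dilate (Q : cube) (t : R) : set 'rV[R]_n :=
  [set center Q + t *: (x - center Q) | x in cube_set Q].

Lemma half_side_gt0 (Q : cube) : 0 < side Q / 2.
Proof. by rewrite divr_gt0// side_gt0. Qed.

(* [J] is the set of coordinates in which the upper half of the edge is kept. *)
Definition child (Q : cube) (J : {set 'I_n}) : cube :=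
  Cube (corner Q + \row_j (if j \in J then side Q / 2 else 0))
       (half_side_gt0 Q).

Inductive dyadic_subcubes (Q : cube) : set cube :=
| dyadic_self : dyadic_subcubes Q Q
| dyadic_child P J : dyadic_subcubes Q P -> dyadic_subcubes Q (child P J).

Definition dyadic_lattice (D : set cube) : Prop :=
  [/\ forall Q J, D Q -> D (child Q J),
      forall Q1 Q2, D Q1 -> D Q2 ->
        exists Q, [/\ D Q, dyadic_subcubes Q Q1 & dyadic_subcubes Q Q2]
    & forall K : set 'rV[R]_n, compact K ->
        exists Q, D Q /\ K `<=` cube_set Q].

Definition volume (Q : cube) : \bar R := lebesgue_mx 1 n (cube_set Q).

Definition carleson (D : set cube) (Lambda : R) (S : set cube) : Prop :=
  [/\ 1 < Lambda, S `<=` D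
    & forall Q, D Q ->
        (\esum_(P in [set P | S P /\ cube_set P `<=` cube_set Q]) volume P
         <= Lambda%:E * volume Q)%E].

Definition average (f : 'rV[R]_n -> R) (Q : cube) : R :=
  (fine (volume Q))^-1 * \int[lebesgue_mx 1 n]_(x in cube_set Q) f x.

(* [esum] is the (possibly infinite) sum of a family of nonnegative terms, so
   this is the sparse operator on functions with nonnegative averages. *)
Definition sparse_op {m : nat} (S : set cube) (f : 'I_m -> 'rV[R]_n -> R)
    (x : 'rV[R]_n) : \bar R :=
  \esum_(Q in S) ((\prod_(i < m) average (f i) Q) * \1_(cube_set Q) x)%:E.

End cubes.
Arguments cube : clear implicits.

Section calderon_zygmund.
Context {R : realType}.

Definition lebesgue_measurable {m n} (f : 'M[R]_(m, n) -> R) : Prop :=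
  measurable_fun [set: leb_mxType R m n] f.

Definition in_L1 {m n} (f : 'M[R]_(m, n) -> R) : Prop :=
  (@lebesgue_mx R m n).-integrable setT (EFin \o f).

Definition L1_norm {m n} (f : 'M[R]_(m, n) -> R) : R :=
  \int[lebesgue_mx m n]_x `|f x|.

Definition in_Linfty0 {n} (f : 'rV[R]_n -> R) : Prop :=
  [/\ lebesgue_measurable f, exists M, forall x, `|f x| <= M
    & compact (closure [set x | f x != 0])].

Definition euclidean_norm {n} (x : 'rV[R]_n) : R :=
  Num.sqrt (\sum_j x 0 j ^+ 2).

Definition modulus_of_continuity (rho : R -> R) : Prop :=
  [/\ {within `[0, +oo[, continuous rho},
      forall t, 0 <= t -> 0 <= rho t,
      forall s t, 0 <= s -> s <= t -> rho s <= rho t,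
      forall s t, 0 <= s -> 0 <= t -> rho (s + t) <= rho s + rho t
    & rho 0 = 0].

Definition log_dini (rho : R -> R) : Prop :=
  (\int[lebesgue_measure]_(t in `]0%R, 1%R[)
     (rho t * ln (1 / t) / t)%R%:E < +oo)%E.

Section fixed_dimensions.
Variables (n m : nat).
Implicit Types (rho : R -> R) (C : R) (K : 'rV[R]_n -> 'M[R]_(m, n) -> R).
Implicit Types (T : ('I_m -> 'rV[R]_n -> R) -> 'rV[R]_n -> \bar R).

Definition max_dist (x : 'rV[R]_n) (y : 'M[R]_(m, n)) : R :=
  \big[Num.max/0]_(i < m) euclidean_norm (x - row i y).

(* The values of [K] on the diagonal [y_1 = ... = y_m = x] are irrelevant. *)
Definition kernel_size C K : Prop :=
  forall x y, (exists i, row i y != x) ->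
    `|K x y| <= C / max_dist x y ^+ (n * m).

Definition kernel_smoothness rho C K : Prop :=
  forall (Q : cube R n) x' x'' t y,
    cube_set Q x' -> cube_set Q x'' -> 2 <= t ->
    (exists i, ~ dilate Q t (row i y)) ->
    `|K x' y - K x'' y| <= C / (t * side Q) ^+ (m * n) * rho t^-1.

Definition kernel_measurable K : Prop :=
  lebesgue_measurable
    (fun z : 'M[R]_(1 + m, n) => K (usubmx z) (dsubmx z)).

Definition tensor (f : 'I_m -> 'rV[R]_n -> R) (y : 'M[R]_(m, n)) : R :=
  \prod_(i < m) f i (row i y).

(* The integral makes sense when it converges absolutely; as [T f] is only
   determined almost everywhere, so is the equality. *)
Definition associated_kernel K T : Prop :=
  forall f, (forall i, in_L1 (f i)) ->
    {ae (@lebesgue_mx R 1 n), forall x,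
      in_L1 (fun y : 'M[R]_(m, n) => K x y * tensor f y) ->
      T f x = (\int[lebesgue_mx m n]_y (K x y * tensor f y))%:E}.

Definition subst_arg (f : 'I_m -> 'rV[R]_n -> R) (i : 'I_m)
    (u : 'rV[R]_n -> R) : 'I_m -> 'rV[R]_n -> R :=
  fun j => if j == i then u else f j.

Definition multilinear T : Prop :=
  forall f i u v a, (forall j, in_L1 (f j)) -> in_L1 u -> in_L1 v ->
    {ae (@lebesgue_mx R 1 n), forall x,
      T (subst_arg f i (fun y => a * u y + v y)) x =
      (a%:E * T (subst_arg f i u) x + T (subst_arg f i v) x)%E}.

Definition weak_type C T : Prop :=
  forall f alpha, (forall i, in_L1 (f i)) -> 0 < alpha ->
    (lebesgue_mx 1 n [set x : leb_mxType R 1 n | alpha%:E < `|T f x|]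
     <= (C * (alpha^-1 * \prod_(i < m) L1_norm (f i)) `^ (m%:R^-1))%:E)%E.

(* No compatibility of [T] with almost everywhere equality is required: it
   follows from [multilinear] and [weak_type]. *)
Definition CZ_operator rho (CK CW : R) T : Prop :=
  [/\ forall f, (forall i, in_L1 (f i)) ->
        measurable_fun [set: leb_mxType R 1 n] (T f) /\
        {ae (@lebesgue_mx R 1 n), forall x, T f x \is a fin_num},
      multilinear T,
      weak_type CW T
    & exists K, [/\ kernel_measurable K, kernel_size CK K,
        kernel_smoothness rho CK K & associated_kernel K T]].

End fixed_dimensions.
End calderon_zygmund.

(* Main.v *)
(** The proof is a stopping time argument in one shifted dyadic grid.  For a grid
    cube [P], let [f^P] be the restriction of the functions to the triple of [P],
    and [w P] the product of the averages of their absolute values there.  The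
    weak type bound gives [|T f^P| <= lam * w P] off a small part of [P], which
    is covered by a slightly larger union [U P] of grid cubes.  Stop at the
    maximal cubes [Q] in [P] that are filled by [U P] to a large proportion, or
    on whose triple one of the functions has a large average: they occupy at
    most half of [P].  If no cube between [Q] and [P] is stopped, then [Q]
    contains a point where both [T f^P] and [T f^Q] are controlled, and the
    smoothness of the kernel, summed over the ancestors of [Q], carries the bound
    [|T f^P - T f^Q| <= C * w P] to almost every point of [Q]; as the averages on
    these ancestors are comparable to those of [P], only the Dini sum of [rho]
    enters.  The size of the kernel bridges the last generation, so
    [|T f^P| <= C * w P + \sum_Q 1_Q |T f^Q|] a.e. on [P], with [Q] running over
    the stopped cubes.  Iterating from root cubes that partition the space, and
    whose triples contain the supports, dominates [T f] by the sum of
    [C * w P * 1_P] over a sparse family of grid cubes; the triples of grid cubes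
    split into [3 ^ n] dyadic lattices. *)

(* The obstacle is that [T] is seen only through almost everywhere statements: its values, its
   linearity and its kernel formula each hold off a null set that depends on the functions.
   Restricting to the countably many grid cells confines all of these to one null set. The kernel
   formula also demands absolute convergence, so [T f^P - T f^Q] is expanded one argument at a time,
   the moving argument living outside the triple of [Q]. Since [U P] is a union of grid cells, each
   of its points lies in a cell filled by [U P]; a point of [P] in no stopped cell is therefore
   outside [U P], without any differentiation theorem. The proportions are linked. The weak type
   level makes the exceptional set at most 1/32 of [P] and its hull at most 1/16, so disjoint cells
   filled to more than 1/4 occupy at most 1/4 of [P]; [growth] leaves another 1/4 for the large
   averages. An unstopped cell loses at most 1/4 + 1/32 to the bad sets, and the stopping cells
   leave half of [P]: hence a packing constant 2, which tripling turns into [2 * 3 ^ n]. *)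
Require Import Defs.
From HB Require Import structures.
From mathcomp Require Import all_boot all_order all_algebra.
From mathcomp Require Import all_classical all_reals all_analysis.
From mathcomp Require Import measurable_realfun.
From mathcomp Require Import ring lra zify.
Import Order.TTheory GRing.Theory Num.Theory.
Import numFieldNormedType.Exports.

Set Implicit Arguments.
Unset Strict Implicit.
Unset Printing Implicit Defensive.

Local Open Scope classical_set_scope.
Local Open Scope ring_scope.

(** * Lebesgue measure on matrices *)

Section matrix_borel.
Context {R : realType} (m n : nat).
Local Notation mR := (measurableTypeR R).

Definition mx_box (a b : 'M[R]_(m, n)) : set 'M[R]_(m, n) :=
  [set x | forall i j, a i j <= x i j < b i j].

Lemma measurable_coord i j :
  measurable_fun setT (fun x : 'M[R]_(m, n) => x i j : mR).
Proof.
move=> _ B mB; rewrite setTI; apply: sub_sigma_algebra.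
rewrite -bigcup_seq/=; exists (mxvec_index i j); first exact: mem_index_enum.
by exists B => //; rewrite setTI; apply/seteqP; split=> x /=; rewrite mxvecE.
Qed.

Lemma measurable_fun_mx d (T : measurableType d) (f : T -> 'M[R]_(m, n)) :
  (forall i j, measurable_fun setT (fun x => f x i j : mR)) ->
  measurable_fun setT f.
Proof.
move=> mf; apply: (@measurability _ _ _ _ setT f _ erefl).
move=> _ [B + <-]; elim/big_ind: _ => [[]|X Y IHX IHY [/IHX|/IHY]//|k _].
move=> [A mA <-]; rewrite !setTI; case/mxvec_indexP: k => i j.
rewrite (_ : _ @^-1` _ = (fun x => f x i j) @^-1` A).
  by rewrite -[X in measurable X]setTI; exact: mf.
by apply/seteqP; split=> t /=; rewrite mxvecE.
Qed.

Lemma measurable_mx_box a b : measurable (mx_box a b).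
Proof.
rewrite (_ : mx_box a b = \bigcap_(i in [set: 'I_m]) \bigcap_(j in [set: 'I_n])
   ((fun x : 'M[R]_(m, n) => x i j : mR) @^-1` `[a i j, b i j[)).
  apply: fin_bigcap_measurable => // i _; apply: fin_bigcap_measurable => // j _.
  rewrite -[X in measurable X]setTI; exact: (measurable_coord i j).
apply/seteqP; split=> x /= H i; first by move=> _ j _ /=; rewrite in_itv /=.
by move=> j; have := H i I j I; rewrite /= in_itv.
Qed.

(** Half-spaces are the generators on which regularity can be checked by hand; the boxes below are
    stable under intersection and serve to compare measures. *)
Definition mx_rays : set (set 'M[R]_(m, n)) :=
  [set A | exists i j a, A = [set x : 'M[R]_(m, n) | a <= x i j]].

Lemma measurable_mx_rays : @measurable _ 'M[R]_(m, n) = <<s mx_rays >>.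
Proof.
apply/seteqP; split; last first.
  apply: smallest_sub; first exact: sigma_algebra_measurable.
  move=> _ [i [j [a ->]]].
  rewrite (_ : [set _ | _] = (fun x : 'M[R]_(m, n) => x i j : mR) @^-1` `[a, +oo[).
    rewrite -[X in measurable X]setTI; exact: (measurable_coord i j).
  by apply/seteqP; split=> x /=; rewrite in_itv/= andbT.
(* The identity from the sigma-algebra generated by the rays is measurable coordinate by coordinate,
   which gives the inclusion. *)
pose T := g_sigma_algebraType mx_rays.
suff mid : measurable_fun setT (id : T -> 'M[R]_(m, n)).
  by move=> A mA; have := mid measurableT A mA; rewrite setTI.
apply: measurable_fun_mx => i j.
apply: (measurability (RGenCInfty.G (R:=R))); first exact: RGenCInfty.measurableE.
move=> _ [_ [a ->] <-]; rewrite setTI; apply: sub_sigma_algebra.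
by exists i, j, a; apply/seteqP; split=> x /=; rewrite in_itv/= andbT.
Qed.

Definition mx_boxes : set (set 'M[R]_(m, n)) :=
  [set A | exists a b, A = mx_box a b].

Definition unit_box (N : nat) := mx_box (const_mx (- N%:R)) (const_mx N%:R).

Lemma bigcup_unit_box : \bigcup_N unit_box N = setT.
Proof.
apply/seteqP; split => // x _.
pose r := \sum_i \sum_j `|x i j|.
have [N rN] : exists N, r < N%:R.
  by exists (Num.truncn r).+1; rewrite (truncnS_gt r).
exists N => //= i j; rewrite !mxE.
have xr : `|x i j| <= r.
  rewrite /r (bigD1 i)//= (bigD1 j)//= -addrA lerDl.
  by rewrite addr_ge0// sumr_ge0// => ? _; rewrite sumr_ge0.
by move: (le_lt_trans xr rN); rewrite ltr_norml => /andP[/ltW -> ->].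
Qed.

Lemma measurable_mx_boxes : @measurable _ 'M[R]_(m, n) = <<s mx_boxes >>.
Proof.
apply/seteqP; split; last first.
  apply: smallest_sub; first exact: sigma_algebra_measurable.
  by move=> _ [a [b ->]]; exact: measurable_mx_box.
rewrite measurable_mx_rays; apply: smallest_sub; first exact: smallest_sigma_algebra.
move=> _ [i [j [a ->]]].
pose lo N : 'M[R]_(m, n) :=
  \matrix_(k, l) if (k == i) && (l == j) then a else - N%:R.
rewrite (_ : [set _ | _] = \bigcup_N mx_box (lo N) (const_mx N%:R)).
  apply: sigma_algebra_bigcup => N; apply: sub_sigma_algebra.
  by exists (lo N), (const_mx N%:R).
apply/seteqP; split=> x /=.
  move=> ax; have : (\bigcup_N unit_box N) x by rewrite bigcup_unit_box.
  move=> [N _ xN]; exists N => //= k l; have := xN k l; rewrite !mxE.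
  by case: ifP => // /andP[/eqP-> /eqP->] /andP[_ ->]; rewrite ax.
by move=> [N _ /(_ i j)]; rewrite !mxE !eqxx /= => /andP[].
Qed.

Lemma mx_boxes_setI : setI_closed mx_boxes.
Proof.
move=> _ _ [a [b ->]] [c [d ->]].
exists (\matrix_(i, j) Num.max (a i j) (c i j)),
  (\matrix_(i, j) Num.min (b i j) (d i j)).
apply/seteqP; split=> x /=.
  move=> [H1 H2] i j; rewrite !mxE ge_max lt_min.
  by move: (H1 i j) (H2 i j) => /andP[-> ->] /andP[-> ->].
move=> H; split => i j; have := H i j; rewrite !mxE ge_max lt_min;
  by move=> /andP[/andP[? ?] /andP[? ?]]; apply/andP.
Qed.

Lemma eq_measure_boxes (m1 m2 : {measure set 'M[R]_(m, n) -> \bar R}) :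
  (forall a b, m1 (mx_box a b) = m2 (mx_box a b)) ->
  (forall a b, (m1 (mx_box a b) < +oo)%E) ->
  forall A, measurable A -> m1 A = m2 A.
Proof.
move=> m12 m1oo A mA.
apply: (measure_unique mx_boxes unit_box) => //.
- exact: measurable_mx_boxes.
- exact: mx_boxes_setI.
- by move=> N; exists (const_mx (- N%:R)), (const_mx N%:R).
- exact: bigcup_unit_box.
- by move=> _ [a [b ->]].
- by move=> k; exact: m1oo.
Qed.

Lemma mx_box_empty (a b : 'M[R]_(m, n)) i j : b i j < a i j -> mx_box a b = set0.
Proof.
move=> ba; apply/seteqP; split => // x /(_ i j) /andP[ax xb].
by move: (le_lt_trans ax xb); rewrite ltNge (ltW ba).
Qed.

Lemma measurable_leb (A : set 'M[R]_(m, n)) : measurable A ->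
  measurable (A : set (leb_mxType R m n)).
Proof. exact: caratheodory_measurable_mu_ext. Qed.

Lemma lebesgue_mx_borel (A : set 'M[R]_(m, n)) : measurable A ->
  lebesgue_mx m n A = borel_lebesgue_mx A.
Proof. by move=> mA; rewrite /lebesgue_mx /completed_measure_extension measurable_mu_extE. Qed.

Lemma borel_box_lty (a b : 'M[R]_(m, n)) : (borel_lebesgue_mx (mx_box a b) < +oo)%E.
Proof.
have [[i [j ba]]|ab] := pselect (exists i j, b i j < a i j).
  by rewrite (mx_box_empty ba) measure0.
rewrite -lebesgue_mx_borel; last exact: measurable_mx_box.
rewrite lebesgue_mx_box ?ltry// => i j; rewrite leNgt; apply/negP => ba.
by apply: ab; exists i, j.
Qed.

Lemma borel_lebesgue_mx_sigma_finite :
  sigma_finite [set: 'M[R]_(m, n)] (@borel_lebesgue_mx R m n).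
Proof.
exists unit_box; first by rewrite bigcup_unit_box.
by move=> N; split; [exact: measurable_mx_box|exact: borel_box_lty].
Qed.

HB.instance Definition _ := Measure_isSigmaFinite.Build _ _ _
  (@borel_lebesgue_mx R m n) borel_lebesgue_mx_sigma_finite.

Lemma lebesgue_mx_sigma_finite :
  sigma_finite [set: leb_mxType R m n] (@lebesgue_mx R m n).
Proof.
exact: completed_measure_extension_sigma_finite borel_lebesgue_mx_sigma_finite.
Qed.

HB.instance Definition _ := Measure_isSigmaFinite.Build _ _ _
  (@lebesgue_mx R m n) lebesgue_mx_sigma_finite.

Lemma lebesgue_mx_complete : measure_is_complete (@lebesgue_mx R m n).
Proof. exact: measure_is_complete_caratheodory. Qed.

(** The completed measure is an outer measure, an infimum over countable Borel covers; hence [A] may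
    be an arbitrary set of finite outer measure. *)
Lemma outer_borel_approx (A : set 'M[R]_(m, n)) (e : R) : 0 < e ->
  (lebesgue_mx m n A < +oo)%E ->
  exists B : set 'M[R]_(m, n), [/\ measurable B, A `<=` B &
    (lebesgue_mx m n B <= lebesgue_mx m n A + e%:E)%E].
Proof.
move=> e0 Aoo.
have Afin : lebesgue_mx m n A \is a fin_num by rewrite ge0_fin_numE.
have [_ [F [mF AF] <-] Fe] := lb_ereal_inf_adherent e0 Afin.
exists (\bigcup_k F k); split => //; first exact: bigcupT_measurable.
rewrite lebesgue_mx_borel; last exact: bigcupT_measurable.
apply: le_trans (ltW Fe).
exact: measure_sigma_subadditive (mF) (bigcupT_measurable _ mF) _.
Qed.

Lemma negligible_borel (N : set 'M[R]_(m, n)) :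
  (lebesgue_mx m n).-negligible N ->
  exists B : set 'M[R]_(m, n),
    [/\ measurable B, N `<=` B & borel_lebesgue_mx B = 0%E].
Proof.
move=> [A [mA A0 NA]].
have Aoo : (lebesgue_mx m n A < +oo)%E by rewrite A0.
have /choice[B BP] : forall k : nat, exists B : set 'M[R]_(m, n),
    [/\ measurable B, A `<=` B &
      (lebesgue_mx m n B <= lebesgue_mx m n A + (k.+1%:R^-1)%:E)%E].
  by move=> k; apply: outer_borel_approx => //; rewrite invr_gt0.
have mB : measurable (\bigcap_k B k) by apply: bigcapT_measurable => k; case: (BP k).
exists (\bigcap_k B k); split => //.
  by apply: subset_trans NA _ => x Ax k _; have [_ + _] := BP k; apply.
apply/eqP; rewrite eq_le measure_ge0 andbT; apply/lee_addgt0Pr => e e0.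
rewrite add0e; pose k := Num.truncn e^-1.
have ke : k.+1%:R^-1 <= e.
  by rewrite invf_ple ?posrE ?ltr0n// ltW// truncnS_gt// ltW// invr_gt0.
have [mBk _ Bk] := BP k; rewrite A0 add0e in Bk.
rewrite -lebesgue_mx_borel//; apply: le_trans (_ : _ <= (k.+1%:R^-1)%:E)%E _; last by rewrite lee_fin.
apply: le_trans Bk; apply: le_measure; rewrite ?inE; [exact: measurable_leb..|].
exact: bigcap_inf.
Qed.

End matrix_borel.

(** * Splitting the rows of a matrix: Tonelli for Borel sets *)

Section row_split.
Local Open Scope ereal_scope.
Context {R : realType} (p q n : nat).
Local Notation mR := (measurableTypeR R).

Definition join_rows (z : 'M[R]_(p, n) * 'M[R]_(q, n)) : 'M[R]_(p + q, n) :=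
  col_mx z.1 z.2.

Lemma measurable_join_rows : measurable_fun setT join_rows.
Proof.
apply: measurable_fun_mx => i j.
case: (splitP i) => k ik.
  rewrite (_ : (fun _ => _) = (fun x : 'M[R]_(p, n) => x k j : mR) \o fst).
    by apply: measurableT_comp => //; exact: measurable_coord.
  apply/funext => x /=; rewrite /join_rows (_ : i = lshift q k) ?col_mxEu//.
  exact: val_inj.
rewrite (_ : (fun _ => _) = (fun x : 'M[R]_(q, n) => x k j : mR) \o snd).
  by apply: measurableT_comp => //; exact: measurable_coord.
apply/funext => x /=; rewrite /join_rows (_ : i = rshift p k) ?col_mxEd//.
exact: val_inj.
Qed.
Local Hint Resolve measurable_join_rows : core.

Definition joined_measure : set 'M[R]_(p + q, n) -> \bar R :=
  pushforward (@borel_lebesgue_mx R p n \x @borel_lebesgue_mx R q n) join_rows.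

Let joined_measure0 : joined_measure set0 = 0.
Proof. exact: measure0. Qed.

Let joined_measure_ge0 A : 0 <= joined_measure A.
Proof. exact: measure_ge0. Qed.

Let joined_measure_sigma_additive : semi_sigma_additive joined_measure.
Proof. exact: measure_semi_sigma_additive. Qed.

HB.instance Definition _ := isMeasure.Build _ _ _ joined_measure
  joined_measure0 joined_measure_ge0 joined_measure_sigma_additive.

Lemma borel_lebesgue_box m (a b : 'M[R]_(m, n)) :
  (forall i j, a i j <= b i j)%R ->
  borel_lebesgue_mx (mx_box a b) =
  (\prod_(i < m) \prod_(j < n) (b i j - a i j)%R)%:E.
Proof.
move=> ab; rewrite -lebesgue_mx_box// -lebesgue_mx_borel//.
exact: measurable_mx_box.
Qed.

(** [lebesgue_tuple] is built coordinate by coordinate and does not unfold to a splitting of the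
    rows; but both measures give a box the product of its edge lengths, and boxes determine them. *)
Lemma borel_joined (A : set 'M[R]_(p + q, n)) : measurable A ->
  borel_lebesgue_mx A = joined_measure A.
Proof.
apply: eq_measure_boxes => a b; last exact: borel_box_lty.
have [[i [j ba]]|ab] := pselect (exists i j, b i j < a i j)%R.
  by rewrite (mx_box_empty ba) !measure0.
have {}ab i j : (a i j <= b i j)%R.
  by rewrite leNgt; apply/negP => ba; apply: ab; exists i, j.
rewrite -[RHS]/((@borel_lebesgue_mx R p n \x @borel_lebesgue_mx R q n)
  (join_rows @^-1` mx_box a b)) (_ : _ @^-1` _ =
    mx_box (usubmx a) (usubmx b) `*` mx_box (dsubmx a) (dsubmx b)).
  have mU := measurable_mx_box (usubmx a) (usubmx b).
  have mD := measurable_mx_box (dsubmx a) (dsubmx b).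
  rewrite (product_measure1E _ _ mU mD) /= !borel_lebesgue_box//; last 2 first.
  - by move=> i j; rewrite !mxE.
  - by move=> i j; rewrite !mxE.
  rewrite big_split_ord/= EFinM; congr (_%:E * _%:E).
    by apply: eq_bigr => i _; apply: eq_bigr => j _; rewrite !mxE.
  by apply: eq_bigr => i _; apply: eq_bigr => j _; rewrite !mxE.
apply/seteqP; split=> -[x y] /=; rewrite /join_rows/=.
  move=> H; split => i j; rewrite !mxE.
    by have := H (lshift q i) j; rewrite col_mxEu.
  by have := H (rshift p i) j; rewrite col_mxEd.
move=> [H1 H2] i j; rewrite -[a]vsubmxK -[b]vsubmxK.
by case: (split_ordP i) => k ->; rewrite ?(col_mxEu, col_mxEd).
Qed.

Lemma ae_borel_leb m (P : 'M[R]_(m, n) -> Prop) :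
  {ae @borel_lebesgue_mx R m n, forall x, P x} ->
  {ae @lebesgue_mx R m n, forall x, P x}.
Proof.
move=> [B [mB B0 PB]]; exists B; split => //; first exact: measurable_leb.
by rewrite lebesgue_mx_borel.
Qed.

(** Tonelli applied to a Borel null hull: the measures of its sections have integral zero, so almost
    all of them vanish. *)
Lemma negligible_section (N : set 'M[R]_(p + q, n)) :
  (lebesgue_mx (p + q) n).-negligible N ->
  {ae @lebesgue_mx R p n, forall x,
    (lebesgue_mx q n).-negligible [set y | N (col_mx x y)]}.
Proof.
move=> /negligible_borel[B [mB NB B0]]; apply: ae_borel_leb.
have mB' : measurable (join_rows @^-1` B).
  by rewrite -[X in measurable X]setTI; exact: measurable_join_rows.
have sec x : measurable (xsection (join_rows @^-1` B) x) by exact: measurable_xsection.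
have : \int[@borel_lebesgue_mx R p n]_x
    `| borel_lebesgue_mx (xsection (join_rows @^-1` B) x)| = 0.
  rewrite -[RHS]B0 borel_joined//.
  by apply: eq_integral => x _; rewrite gee0_abs//; exact: measure_ge0.
move/ae_eq_integral_abs => /(_ measurableT).
have /[swap]/[apply] := measurable_fun_xsection (@borel_lebesgue_mx R q n) mB'.
apply: filterS => x /(_ I) /= Bx0.
exists (xsection (join_rows @^-1` B) x); split.
- exact: measurable_leb.
- by rewrite lebesgue_mx_borel.
- by move=> y /= /NB ?; rewrite /xsection /= inE.
Qed.

End row_split.
Arguments join_rows {R p q n}.

Section lebesgue_sets.
Local Open Scope ereal_scope.
Context {R : realType} (m n : nat).
Local Notation mu := (@lebesgue_mx R m n).

(** The outer approximation needs finite measure, so it is applied inside each unit box with error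
    [k.+1%:R^-1]; intersecting over [k] and uniting over the boxes leaves a null excess. *)
Lemma lebesgue_borel_hull (A : set (leb_mxType R m n)) : measurable A ->
  exists B : set 'M[R]_(m, n),
    [/\ measurable B, A `<=` B & mu.-negligible (B `\` A)].
Proof.
move=> mA.
have mU N : measurable (unit_box N : set (leb_mxType R m n)).
  by apply: measurable_leb; exact: measurable_mx_box.
have AU N : mu (A `&` unit_box N) < +oo.
  have Uoo : mu (unit_box N) < +oo.
    have mb := measurable_mx_box (const_mx (- N%:R)%R : 'M[R]_(m, n)) (const_mx N%:R).
    by have := borel_box_lty (const_mx (- N%:R)%R : 'M[R]_(m, n)) (const_mx N%:R);
      rewrite -(lebesgue_mx_borel mb).
  apply: le_lt_trans Uoo.
  by apply: le_measure; rewrite ?inE//; exact: measurableI.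
have /choice[B BP] : forall Nk : nat * nat, exists B : set 'M[R]_(m, n),
    [/\ measurable B, A `&` unit_box Nk.1 `<=` B &
      mu B <= mu (A `&` unit_box Nk.1) + (Nk.2.+1%:R^-1)%:E].
  by move=> Nk; apply: outer_borel_approx => //; rewrite invr_gt0.
pose C N := \bigcap_k B (N, k).
have mC N : measurable (C N) by apply: bigcapT_measurable => k; case: (BP (N, k)).
exists (\bigcup_N C N); split; first exact: bigcupT_measurable.
  move=> x Ax; have : (\bigcup_N unit_box N) x by rewrite bigcup_unit_box.
  move=> [N _ xN]; exists N => // k _.
  by have [_ + _] := BP (N, k); apply; split.
rewrite setD_bigcupl.
have CA N : mu.-negligible (C N `\` (A `&` unit_box N)).
  have mD : measurable (C N `\` (A `&` unit_box N) : set (leb_mxType R m n)).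
    by apply: measurableD; [exact: measurable_leb|exact: measurableI].
  apply/negligibleP => //; apply/eqP; rewrite eq_le measure_ge0 andbT.
  apply/lee_addgt0Pr => e e0; rewrite add0e.
  pose k := Num.truncn e^-1.
  have ke : (k.+1%:R^-1 <= e)%R.
    by rewrite invf_ple ?posrE ?ltr0n// ltW// truncnS_gt// ltW// invr_gt0.
  have [mBk ABk Bk] := BP (N, k).
  apply: le_trans (_ : mu (B (N, k) `\` (A `&` unit_box N)) <= _).
    apply: le_measure; rewrite ?inE//.
      by apply: measurableD; [exact: measurable_leb|exact: measurableI].
    by apply: setSD; exact: bigcap_inf.
  have mBk' : measurable (B (N, k) : set (leb_mxType R m n)) by exact: measurable_leb.
  have mAU : measurable (A `&` unit_box N : set (leb_mxType R m n)) by exact: measurableI.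
  have Boo : mu (B (N, k)) < +oo.
    by apply: le_lt_trans Bk _; rewrite lte_add_pinfty ?AU ?ltry.
  rewrite (measureD mBk' mAU Boo).
  have Afin : mu (A `&` unit_box N) \is a fin_num by rewrite ge0_fin_numE ?AU.
  rewrite setIidr// leeBlDl//.
  by apply: le_trans Bk _; rewrite leeD2l// lee_fin.
apply: negligibleS (negligible_bigcup CA).
apply: subset_bigcup => N _ x [Cx nA]; split => // -[]//.
Qed.

End lebesgue_sets.

Lemma measurable_bigcup_countable d (T : measurableType d) (I : countType)
    (X : set I) (F : I -> set T) :
  (forall i, X i -> measurable (F i)) -> measurable (\bigcup_(i in X) F i).
Proof.
move=> mF; rewrite bigcup_mkcond; apply: countable_bigcupT_measurable => // i.
by case: ifPn => // /set_mem; exact: mF.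
Qed.

Lemma ae_imply d (T : measurableType d) (R : realType)
    (mu : {measure set T -> \bar R}) (P Q : T -> Prop) :
  (forall x, P x -> Q x) -> {ae mu, forall x, P x} -> {ae mu, forall x, Q x}.
Proof. by move=> PQ; apply: negligibleS => x /= nQ /PQ. Qed.

Lemma ae_and d (T : measurableType d) (R : realType)
    (mu : {measure set T -> \bar R}) (P Q : T -> Prop) :
  {ae mu, forall x, P x} -> {ae mu, forall x, Q x} ->
  {ae mu, forall x, P x /\ Q x}.
Proof.
move=> aP aQ; apply: negligibleS (negligibleU aP aQ) => x /= nPQ.
by have [Px|] := pselect (P x); [right => Qx; exact: nPQ|left].
Qed.

Lemma ae_forall_countable d (T : measurableType d) (R : realType)
    (mu : {measure set T -> \bar R}) (I : countType) (P : I -> T -> Prop) :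
  (forall i, {ae mu, forall x, P i x}) -> {ae mu, forall x, forall i, P i x}.
Proof.
move=> aeP; pose P' k x := if unpickle k is Some i then P i x else True.
have : {ae mu, forall x, forall k, P' k x}.
  apply: ae_foralln => k; rewrite /P'; case: unpickle => [i|]; first exact: aeP.
  exact: aeW.
by apply: ae_imply => x Px i; have := Px (pickle i); rewrite /P' pickleK.
Qed.

Section row_split_lebesgue.
Local Open Scope ereal_scope.
Context {R : realType} (p q n : nat).

(* A Lebesgue measurable function of [(x, y)] need not be measurable for the
   product of the two Lebesgue sigma-algebras, so its sections are reached
   through Borel hulls. *)
Lemma ae_section_measurable (F : 'M[R]_(p + q, n) -> R) :
  lebesgue_measurable F ->
  {ae @lebesgue_mx R p n, forall x,
     lebesgue_measurable (fun y : 'M[R]_(q, n) => F (col_mx x y))}.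
Proof.
move=> mF.
pose A (r : rat) : set (leb_mxType R (p + q) n) := [set z | (ratr r < F z)%R].
have mA r : measurable (A r).
  rewrite (_ : A r = F @^-1` `]ratr r, +oo[).
    by rewrite -[X in measurable X]setTI; exact: mF.
  by apply/seteqP; split=> z /=; rewrite in_itv/= andbT.
have /choice[B BP] : forall r, exists B : set 'M[R]_(p + q, n),
    [/\ measurable B, A r `<=` B & (lebesgue_mx (p + q) n).-negligible (B `\` A r)].
  by move=> r; apply: lebesgue_borel_hull.
have : {ae @lebesgue_mx R p n, forall x, forall r : rat,
    (lebesgue_mx q n).-negligible [set y | (B r `\` A r) (col_mx x y)]}.
  by apply: ae_forall_countable => r; apply: negligible_section; case: (BP r).
apply: ae_imply => x xN.
apply: (measurability (RGenOInfty.G (R := R))); first exact: RGenOInfty.measurableE.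
move=> _ [_ [a ->] <-]; rewrite setTI.
(* A section of [A r] is the section of its Borel hull minus a null set, measurable by completeness;
   the rational levels above [a] exhaust the ray. *)
rewrite (_ : _ @^-1` _ = \bigcup_(r in [set r : rat | (a < ratr r)%R])
    ([set y | B r (col_mx x y)] `\` [set y | (B r `\` A r) (col_mx x y)])).
  apply: measurable_bigcup_countable => r _; apply: measurableD; last first.
    exact: lebesgue_mx_complete.
  have [mB _ _] := BP r; apply: measurable_leb.
  have mJ : measurable (join_rows @^-1` B r).
    by rewrite -[X in measurable X]setTI; exact: measurable_join_rows.
  rewrite (_ : [set y | _] = xsection (join_rows @^-1` B r) x).
    exact: measurable_xsection.
  by apply/seteqP; split=> y; rewrite /xsection /= inE.
apply/seteqP; split => y /=; rewrite in_itv/= andbT.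
  move=> /rat_in_itvoo[r]; rewrite in_itv/= => /andP[ar rF].
  exists r => //=; have [_ AB _] := BP r.
  by split; [exact: AB|case=> _; exact].
move=> [r /= ar [By nA]]; apply: lt_trans ar _.
by apply/negP => /negP nF; apply: nA; split => //; exact/negP.
Qed.

Definition split_rows (z : leb_mxType R (p + q) n) :
  leb_mxType R p n * leb_mxType R q n := (usubmx z, dsubmx z).

Lemma lebesgue_rectangle_borel (A : set 'M[R]_(p, n)) (B : set 'M[R]_(q, n)) :
  measurable A -> measurable B ->
  lebesgue_mx (p + q) n (split_rows @^-1` (A `*` B)) =
    lebesgue_mx p n A * lebesgue_mx q n B /\
  measurable (split_rows @^-1` (A `*` B)).
Proof.
move=> mA mB.
have E : join_rows @^-1` (split_rows @^-1` (A `*` B)) = A `*` B.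
  by apply/seteqP; split=> -[x y]; rewrite /= /join_rows/= col_mxKu col_mxKd.
have mu_ : measurable_fun setT (fun z : 'M[R]_(p + q, n) => usubmx z).
  apply: measurable_fun_mx => i j; under eq_fun do rewrite mxE.
  exact: measurable_coord.
have md_ : measurable_fun setT (fun z : 'M[R]_(p + q, n) => dsubmx z).
  apply: measurable_fun_mx => i j; under eq_fun do rewrite mxE.
  exact: measurable_coord.
have mAB : measurable (split_rows @^-1` (A `*` B) : set 'M[R]_(p + q, n)).
  rewrite (_ : _ @^-1` _ = (@usubmx _ p q n) @^-1` A `&` (@dsubmx _ p q n) @^-1` B)//.
  by apply: measurableI; rewrite -[X in measurable X]setTI; [exact: mu_|exact: md_].
split; last exact: measurable_leb.
rewrite !lebesgue_mx_borel// borel_joined//.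
rewrite -[LHS]/((@borel_lebesgue_mx R p n \x @borel_lebesgue_mx R q n)
  (join_rows @^-1` (split_rows @^-1` (A `*` B)))) E.
by rewrite (product_measure1E _ _ mA mB).
Qed.

(** Replacing the sides by Borel hulls changes the rectangle only inside the strips over the null
    sets [NA] and [NB]; these strips are null even when the other factor has infinite measure,
    because zero times infinity is zero. *)
Lemma lebesgue_rectangle (A : set (leb_mxType R p n)) (B : set (leb_mxType R q n)) :
  measurable A -> measurable B ->
  lebesgue_mx (p + q) n (split_rows @^-1` (A `*` B)) =
    lebesgue_mx p n A * lebesgue_mx q n B /\
  measurable (split_rows @^-1` (A `*` B)).
Proof.
move=> mA mB.
have [A' [mA' AA' nA]] := lebesgue_borel_hull mA.
have [B' [mB' BB' nB]] := lebesgue_borel_hull mB.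
have [eAB mAB] := lebesgue_rectangle_borel mA' mB'.
have [NA [mNA NAA NA0]] := negligible_borel nA.
have [NB [mNB NBB NB0]] := negligible_borel nB.
have [eN1 mN1] := lebesgue_rectangle_borel mNA (measurableT : measurable [set: 'M[R]_(q, n)]).
have [eN2 mN2] := lebesgue_rectangle_borel (measurableT : measurable [set: 'M[R]_(p, n)]) mNB.
set X := split_rows @^-1` (A `*` B).
set X' := split_rows @^-1` (A' `*` B') in eAB mAB.
have nX : (lebesgue_mx (p + q) n).-negligible (X' `\` X).
  have n1 : (lebesgue_mx (p + q) n).-negligible (split_rows @^-1` (NA `*` setT)).
    by apply/negligibleP => //; apply: (etrans eN1); rewrite lebesgue_mx_borel// NA0 mul0e.
  have n2 : (lebesgue_mx (p + q) n).-negligible (split_rows @^-1` (setT `*` NB)).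
    by apply/negligibleP => //; apply: (etrans eN2); rewrite [X in _ * X]lebesgue_mx_borel// NB0 mule0.
  apply: negligibleS (negligibleU n1 n2) => z [[/= A'z B'z] nX].
  have [Az|nAz] := pselect (A (usubmx z)).
    right; split => //=; apply: NBB; split => // Bz; exact: nX.
  by left; split => //=; apply: NAA; split.
have XX' : X `<=` X' by move=> z [? ?]; split; [exact: AA'|exact: BB'].
have XE : X = X' `\` (X' `\` X) by rewrite setDD setIidr.
have mX : measurable X.
  by rewrite XE; apply: measurableD => //; exact: lebesgue_mx_complete.
have hull m (Y Y' : set (leb_mxType R m n)) : measurable Y -> measurable Y' ->
    Y `<=` Y' -> (lebesgue_mx m n).-negligible (Y' `\` Y) ->
    lebesgue_mx m n Y = lebesgue_mx m n Y'.
  move=> mY mY' YY' nY.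
  have mD : measurable (Y' `\` Y) by exact: measurableD.
  rewrite -[in RHS](setDUK YY') measureU//; last by rewrite setDIK.
  by rewrite (measure_negligible mD nY) adde0.
by split => //; rewrite (hull _ X X')// (hull _ A A')// ?(hull _ B B')//; exact: measurable_leb.
Qed.

Lemma measurable_split_rows : measurable_fun setT split_rows.
Proof.
apply: (measurability [set A `*` B | A in measurable & B in measurable]).
  exact: measurable_prod_measurableType.
move=> _ [_ [A mA [B mB <-]] <-]; rewrite setTI.
by have [] := lebesgue_rectangle mA mB.
Qed.
Local Hint Resolve measurable_split_rows : core.

(** The measure is transported along [split_rows], which is measurable between the completed
    sigma-algebras; its inverse need not be, as the completion on all rows can contain more than the
    product of the two completions. *)
Definition split_measure : set (leb_mxType R p n * leb_mxType R q n) -> \bar R :=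
  pushforward (@lebesgue_mx R (p + q) n) split_rows.

Let split_measure0 : split_measure set0 = 0.
Proof. exact: measure0. Qed.

Let split_measure_ge0 A : 0 <= split_measure A.
Proof. exact: measure_ge0. Qed.

Let split_measure_sigma_additive : semi_sigma_additive split_measure.
Proof. exact: measure_semi_sigma_additive. Qed.

HB.instance Definition _ := isMeasure.Build _ _ _ split_measure
  split_measure0 split_measure_ge0 split_measure_sigma_additive.

Lemma integral_split_rows (g : leb_mxType R p n -> \bar R)
    (h : leb_mxType R q n -> \bar R) :
  measurable_fun setT g -> measurable_fun setT h ->
  (forall x, 0 <= g x) -> (forall y, 0 <= h y) ->
  \int[lebesgue_mx (p + q) n]_z (g (usubmx z) * h (dsubmx z)) =
  \int[lebesgue_mx p n]_x g x * \int[lebesgue_mx q n]_y h y.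
Proof.
move=> mg mh g0 h0.
pose G (z : leb_mxType R p n * leb_mxType R q n) := g z.1 * h z.2.
have mG : measurable_fun setT G.
  by apply: emeasurable_funM; apply: measurableT_comp.
have G0 z : 0 <= G z by rewrite mule_ge0.
transitivity (\int[split_measure]_z G z).
  by rewrite ge0_integral_pushforward.
transitivity (\int[(lebesgue_mx p n \x lebesgue_mx q n)%E]_z G z).
  apply: eq_measure_integral => A mA _; apply/esym; apply: product_measure_unique => //.
  by move=> B C mB mC; have [] := lebesgue_rectangle mB mC.
rewrite fubini_tonelli1//.
under eq_integral => x _ do rewrite /fubini_F /G /= ge0_integralZl//.
rewrite ge0_integralZr//; exact: integral_ge0.
Qed.

End row_split_lebesgue.

(** * Tensor products *)

Section tensor_integral.
Context {R : realType} (n : nat).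

Lemma lebesgue_mx0 : lebesgue_mx 0 n [set: 'M[R]_(0, n)] = 1%E.
Proof.
have := @lebesgue_mx_box R 0 n 0 0 (fun i j => lexx _); rewrite big_ord0 => <-.
by congr (lebesgue_mx _ _ _); apply/seteqP; split=> x // _ [].
Qed.

Lemma tensor_recl m (f : 'I_m.+1 -> 'rV[R]_n -> R) (z : 'M[R]_(1 + m, n)) :
  tensor f z = f ord0 (usubmx z) * tensor (f \o lift ord0) (dsubmx z).
Proof.
rewrite /tensor big_ord_recl; congr (_ * _).
  by congr (f _ _); apply/rowP => j; rewrite !mxE; congr (z _ _); exact: val_inj.
apply: eq_bigr => i _ /=; congr (f _ _); apply/rowP => j; rewrite !mxE.
by congr (z _ _); exact: val_inj.
Qed.

Lemma measurable_tensor m (f : 'I_m -> 'rV[R]_n -> R) :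
  (forall i, lebesgue_measurable (f i)) -> lebesgue_measurable (tensor f).
Proof.
elim: m f => [|m IH] f mf.
  rewrite (_ : tensor f = cst 1); first exact: measurable_cst.
  by apply/funext => y; rewrite /tensor big_ord0.
rewrite (_ : tensor f = (fun z : leb_mxType R (1 + m) n =>
  f ord0 (usubmx z) * tensor (f \o lift ord0) (dsubmx z))); last first.
  by apply/funext => z; exact: tensor_recl.
have ms := @measurable_split_rows R 1 m n.
have m1 : measurable_fun setT (fun z : leb_mxType R (1 + m) n => f ord0 (usubmx z)).
  exact: measurableT_comp (mf ord0) (measurableT_comp measurable_fst ms).
have /IH mt : forall i, lebesgue_measurable ((f \o lift ord0) i) by move=> i; exact: mf.
have m2 : measurable_fun setT (fun z : leb_mxType R (1 + m) n =>
    tensor (f \o lift ord0) (dsubmx z)).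
  exact: measurableT_comp mt (measurableT_comp measurable_snd ms).
exact: measurable_funM m1 m2.
Qed.

Lemma integral_tensor m (f : 'I_m -> 'rV[R]_n -> R) :
  (forall i, lebesgue_measurable (f i)) ->
  (\int[lebesgue_mx m n]_y `|tensor f y|%:E =
   \prod_(i < m) \int[lebesgue_mx 1 n]_x `|f i x|%:E)%E.
Proof.
elim: m f => [|m IH] f mf.
  rewrite big_ord0; under eq_integral do rewrite /tensor big_ord0 normr1.
  by rewrite integral_cst// mul1e; exact: lebesgue_mx0.
rewrite big_ord_recl -(IH (f \o lift ord0)) => [|i]; last exact: mf.
rewrite -integral_split_rows.
- by apply: eq_integral => z _; rewrite tensor_recl normrM EFinM.
- by apply/measurable_EFinP; apply: measurableT_comp => //; exact: mf.
- apply/measurable_EFinP; apply: measurableT_comp => //.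
  by apply: measurable_tensor => i; exact: mf.
- by move=> x; rewrite lee_fin.
- by move=> x; rewrite lee_fin.
Qed.

Lemma L1_normE m (f : 'M[R]_(m, n) -> R) : in_L1 f ->
  (\int[lebesgue_mx m n]_x `|f x|%:E)%E = (L1_norm f)%:E.
Proof.
move=> /integrableP[mf foo]; rewrite /L1_norm /Rintegral fineK//.
rewrite ge0_fin_numE//; by apply: integral_ge0 => x _; rewrite lee_fin.
Qed.

Lemma L1_norm_ge0 m (f : 'M[R]_(m, n) -> R) : 0 <= L1_norm f.
Proof. by apply: fine_ge0; apply: integral_ge0 => x _; rewrite lee_fin. Qed.

Lemma tensor_L1 m (f : 'I_m -> 'rV[R]_n -> R) : (forall i, in_L1 (f i)) ->
  in_L1 (tensor f) /\ L1_norm (tensor f) = \prod_(i < m) L1_norm (f i).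
Proof.
move=> f1.
have mf i : lebesgue_measurable (f i).
  by have /measurable_int/measurable_EFinP := f1 i.
have I : (\int[lebesgue_mx m n]_y `|tensor f y|%:E =
    (\prod_(i < m) L1_norm (f i))%:E)%E.
  rewrite integral_tensor// -prodEFin.
  by apply: eq_bigr => i _; exact: L1_normE.
have tf : in_L1 (tensor f).
  apply/integrableP; split; first by apply/measurable_EFinP; exact: measurable_tensor.
  have : ((\prod_(i < m) L1_norm (f i))%:E < +oo)%E by rewrite ltry.
  by rewrite -I.
by split => //; apply: EFin_inj; rewrite -L1_normE.
Qed.

End tensor_integral.

(** * Dyadic grids *)

Section cube_geometry.
Context {R : realType} {n : nat}.
Implicit Types (P Q : cube R n).

Lemma cube_eq P Q : corner P = corner Q -> side P = side Q -> P = Q.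
Proof.
case: P Q => [c l l0] [c' l' l0'] /= cc ll.
by rewrite cc; move: l0 l0'; rewrite ll => l0 l0'; rewrite (bool_irrelevance l0 l0').
Qed.

Lemma child_subset Q J : cube_set (child Q J) `<=` cube_set Q.
Proof.
move=> x xQ j; have := xQ j; rewrite /child /= !mxE.
have := side_gt0 Q; case: ifP => _ s0 /andP[h1 h2]; apply/andP; split; lra.
Qed.

Lemma dyadic_subcubes_subset Q P : dyadic_subcubes Q P -> cube_set P `<=` cube_set Q.
Proof. by elim=> // P' J _ IH; apply: subset_trans IH; exact: child_subset. Qed.

Lemma dyadic_subcubes_child Q J P :
  dyadic_subcubes (child Q J) P -> dyadic_subcubes Q P.
Proof.
elim=> [|P' J' _ IH]; last exact: dyadic_child.
by apply: dyadic_child; exact: dyadic_self.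
Qed.

Lemma corner_in_cube Q : cube_set Q (corner Q).
Proof. by move=> j; rewrite lexx/= ltrDl side_gt0. Qed.

Lemma triple_side_gt0 Q : 0 < 3 * side Q.
Proof. by rewrite mulr_gt0// side_gt0. Qed.

Definition triple Q : cube R n :=
  Cube (corner Q - const_mx (side Q)) (triple_side_gt0 Q).

Lemma cube_subset_triple Q : cube_set Q `<=` cube_set (triple Q).
Proof.
move=> x xQ j; have := xQ j; have := side_gt0 Q; rewrite /= !mxE => ? /andP[? ?].
by apply/andP; split; lra.
Qed.

Lemma triple_inj P Q : triple P = triple Q -> P = Q.
Proof.
move=> e; have es : side P = side Q.
  by have := congr1 (@side R n) e => /= /mulfI; apply.
apply: cube_eq => //; have := congr1 (@corner R n) e => /=.
by rewrite es => /addIr.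
Qed.

End cube_geometry.

Section lattice.
Context {R : realType} {n : nat} (lam : R) (s : int -> 'rV[R]_n).
Hypothesis lam0 : 0 < lam.

Definition scale (k : int) : R := lam * 2 ^ k.

Lemma scale_gt0 k : 0 < scale k.
Proof. by rewrite mulr_gt0// exprz_gt0. Qed.

Lemma scaleS k : scale (k + 1) = 2 * scale k.
Proof. by rewrite /scale expfzDr ?pnatr_eq0// (mulrC _ (2 ^ 1)) mulrCA. Qed.

Lemma scale_le k k' : k <= k' -> scale k <= scale k'.
Proof.
by move=> kk'; rewrite ler_pM2l//; apply: ler_weXz2l => //; rewrite ler1n.
Qed.

Lemma scale_large r : exists K : int, forall k, K <= k -> r < scale k.
Proof.
pose N := Num.truncn (r / lam); exists N.+1%:Z => k Nk.
apply: lt_le_trans (scale_le Nk); rewrite /scale -exprnP mulrC -ltr_pdivrMr//.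
apply: lt_trans (truncnS_gt _) _; rewrite -/N -natrX ltr_nat.
exact: ltn_expl.
Qed.

Lemma scale_small r : 0 < r -> exists K : int, forall k, k <= K -> scale k < r.
Proof.
move=> r0; pose N := Num.truncn (lam / r); exists (- N.+1%:Z) => k Nk.
apply: le_lt_trans (scale_le Nk) _.
rewrite /scale -exprnN ltr_pdivrMr ?exprn_gt0// mulrC -ltr_pdivrMr//.
apply: lt_trans (truncnS_gt _) _; rewrite -/N -natrX ltr_nat.
exact: ltn_expl.
Qed.

Definition lcube (i : int * 'rV[int]_n) : cube R n :=
  Cube (s i.1 + scale i.1 *: map_mx intr i.2) (scale_gt0 i.1).

(** Points are located by their integer index in generation [k], so that membership and nesting of
    cubes become equations between integer vectors. *)
Definition lidx (k : int) (x : 'rV[R]_n) : int * 'rV[int]_n :=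
  (k, \row_j Num.floor ((x 0 j - s k 0 j) / scale k)).

Lemma lcubeP i x : cube_set (lcube i) x <-> lidx i.1 x = i.
Proof.
case: i => k w /=; have c0 := scale_gt0 k; split=> [xi|[] <-].
  congr (_, _); apply/rowP => j; rewrite !mxE; apply: floor_def.
  have := xi j; rewrite /= !mxE => /andP[h1 h2].
  rewrite ler_pdivlMr// ltr_pdivrMr// intrD; apply/andP; split; lra.
move=> j; rewrite /= !mxE.
have /andP[] := floor_itv ((x 0 j - s k 0 j) / scale k).
rewrite ler_pdivlMr// ltr_pdivrMr// intrD => h1 h2; apply/andP; split; lra.
Qed.

(* The generation [k] cubes are translated by [s k]; [refine] says that the
   generations are nested. *)
Hypothesis refine : forall k j, exists b : int,
  s (k + 1) 0 j = s k 0 j + scale k * b%:~R.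

Lemma lidx_next k x y : lidx k x = lidx k y -> lidx (k + 1) x = lidx (k + 1) y.
Proof.
move=> [] /rowP e; congr (_, _); apply/rowP => j; have := e j; rewrite !mxE.
have [b ->] := refine k j; rewrite scaleS; have c0 := scale_gt0 k.
(* The index in the next generation is the integer half of the shifted index, so it depends on the
   point only through the index in generation [k]. *)
suff H (u : R) : Num.floor ((u - (s k 0 j + scale k * b%:~R)) / (2 * scale k)) =
    ((Num.floor ((u - s k 0 j) / scale k) - b)%R %/ 2)%Z by rewrite !H => ->.
set N := Num.floor ((u - s k 0 j) / scale k).
have /andP[] := floor_itv ((u - s k 0 j) / scale k); rewrite -/N.
rewrite ler_pdivlMr// ltr_pdivrMr// intrD => h1 h2.
apply: floor_def; set q := (_ %/ 2)%Z; set r := ((N - b) %% 2)%Z.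
have Nq : N = q * 2 + r + b by apply/eqP; rewrite -subr_eq; apply/eqP; exact: (divz_eq (N - b) 2).
have [r0 r1] : (0 <= r /\ r <= 1)%R.
  have := modz_ge0 (N - b) (isT : 2 != 0 :> int).
  have := ltz_pmod (N - b) (isT : 0 < 2 :> int); rewrite -/r; lia.
have r0' : 0 <= r%:~R :> R by rewrite ler0z.
have r1' : r%:~R <= 1 :> R by rewrite -[1]/(1%:~R) ler_int.
clearbody q r; move: h1 h2; rewrite Nq !intrD !intrM -[2%:~R]/(2 : R) -[1%:~R]/(1 : R) => h1 h2.
have c2 : 0 < 2 * scale k by rewrite mulr_gt0.
rewrite ler_pdivlMr// ltr_pdivrMr//.
have t0 := mulr_ge0 (ltW c0) r0'.
have t1 : scale k * r%:~R <= scale k by rewrite ler_piMr// ltW.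
by apply/andP; split; lra.
Qed.

Lemma lidx_le k k' x y : k <= k' -> lidx k x = lidx k y -> lidx k' x = lidx k' y.
Proof.
move=> kk' e; have -> : k' = k + `|k' - k|%N%:Z by lia.
elim: `|k' - k|%N => [|l IH]; first by rewrite addr0.
by rewrite intS [1 + _]addrC addrA; exact: lidx_next.
Qed.

Lemma lcube_subset i i' x : cube_set (lcube i) x -> cube_set (lcube i') x ->
  i.1 <= i'.1 -> cube_set (lcube i) `<=` cube_set (lcube i').
Proof.
move=> /lcubeP xi /lcubeP xi' ii' y /lcubeP yi; apply/lcubeP.
by rewrite -[RHS]xi'; apply: (lidx_le ii'); rewrite xi yi.
Qed.

Lemma lcube_nested i i' :
  [\/ cube_set (lcube i) `<=` cube_set (lcube i'),
      cube_set (lcube i') `<=` cube_set (lcube i)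
    | cube_set (lcube i) `&` cube_set (lcube i') = set0].
Proof.
have [[x [xi xi']]|no] := pselect (exists x, cube_set (lcube i) x /\ cube_set (lcube i') x).
  have [ii'|/ltW ii'] := lerP i.1 i'.1.
    by apply: Or31; exact: lcube_subset xi xi' ii'.
  by apply: Or32; exact: lcube_subset xi' xi ii'.
apply: Or33; apply/seteqP; split => // x [xi xi']; exact: no (ex_intro _ x (conj xi xi')).
Qed.

Lemma lcube_child i J : exists i', child (lcube i) J = lcube i'.
Proof.
case: i => k w; have ke : k = (k - 1) + 1 by rewrite subrK.
have /choice[b bE] := refine (k - 1); rewrite -ke in bE.
exists (k - 1, \row_j (2 * w 0 j + b j + (j \in J))).
have sk : scale k = 2 * scale (k - 1) by rewrite -scaleS -ke.
apply: cube_eq => /=; last by rewrite sk; field.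
apply/rowP => j; rewrite !mxE bE sk !intrD intrM.
case: (j \in J); first by rewrite -[true%:~R]/(1 : R); field.
by rewrite -[false%:~R]/(0 : R); field.
Qed.

(** Euclidean division of the shifted index by 2: the quotient is the index of the parent, and the
    remainder tells which half of each edge is occupied. *)
Lemma lcube_parent i : exists i' J, lcube i = child (lcube i') J /\ i'.1 = i.1 + 1.
Proof.
case: i => k w; have /choice[b bE] := refine k.
pose v j := (w 0 j - b j)%R.
exists (k + 1, \row_j (v j %/ 2)%Z), (finset (fun j => (v j %% 2)%Z == 1)); split => //.
apply: cube_eq => /=; last by rewrite scaleS; field.
apply/rowP => j; rewrite !mxE bE scaleS inE.
have vj : w 0 j = (v j %/ 2)%Z * 2 + (v j %% 2)%Z + b j.
  by apply/eqP; rewrite -subr_eq; apply/eqP; exact: (divz_eq (v j) 2).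
have : (v j %% 2)%Z = 0 \/ (v j %% 2)%Z = 1.
  have := modz_ge0 (v j) (isT : 2 != 0 :> int).
  have := ltz_pmod (v j) (isT : 0 < 2 :> int); lia.
move: vj; move: (v j %/ 2)%Z (v j %% 2)%Z => q r -> rE.
rewrite !intrD intrM -[2%:~R]/(2 : R).
by case: rE => ->; rewrite -?[0%:~R]/(0 : R) -?[1%:~R]/(1 : R) ?eqxx /=; field.
Qed.

Lemma lcube_ancestor i (l : nat) : exists i',
  i'.1 = i.1 + l%:Z /\ dyadic_subcubes (lcube i') (lcube i).
Proof.
elim: l => [|l [i' [i'l di']]]; first by exists i; rewrite addr0; split => //; exact: dyadic_self.
have [i'' [J [eJ i''1]]] := lcube_parent i'; exists i''; split.
  by rewrite i''1 i'l intS -addrA [l%:Z + 1]addrC.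
by apply: (@dyadic_subcubes_child _ _ _ J); rewrite -eJ.
Qed.

(* The origin stays at relative distance at least 1/9 from the boundary of the
   generation [k] cube that contains it, so these cubes exhaust the space. *)
Hypothesis central : forall k j, exists q : int,
  scale k * (q%:~R + 9^-1) <= - s k 0 j <= scale k * (q%:~R + 8 / 9).

Lemma lidx_central k (x : 'rV[R]_n) : (forall j, `|x 0 j| < scale k / 9) -> lidx k x = lidx k 0.
Proof.
move=> xk; congr (_, _); apply/rowP => j; rewrite !mxE sub0r.
have c0 := scale_gt0 k; have [q /andP[h1 h2]] := central k j.
rewrite [RHS](@floor_def _ _ q); last first.
  by rewrite ler_pdivlMr// ltr_pdivrMr// intrD; apply/andP; split; lra.
apply: floor_def; rewrite ler_pdivlMr// ltr_pdivrMr// intrD.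
by move: (xk j); rewrite ltr_norml => /andP[h3 h4]; apply/andP; split; lra.
Qed.

Lemma lidx_bounded r : exists K : int, forall k (x : 'rV[R]_n), K <= k ->
  (forall j, `|x 0 j| <= r) -> lidx k x = lidx k 0.
Proof.
have [K rK] := scale_large (r * 9); exists K => k x /rK rk xr.
apply: lidx_central => j; apply: le_lt_trans (xr j) _.
by rewrite ltr_pdivlMr.
Qed.

Lemma row_bounded (x : 'rV[R]_n) : exists r, forall j, `|x 0 j| <= r.
Proof.
exists (\sum_j `|x 0 j|) => j; rewrite (bigD1 j)//= lerDl.
exact: sumr_ge0.
Qed.

Lemma compact_coord_bounded (K : set 'rV[R]_n) : compact K ->
  exists r, forall x, K x -> forall j, `|x 0 j| <= r.
Proof.
move=> /compact_bounded [M [_ MK]]; exists (M + 1) => x Kx j.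
have : `|x| <= M + 1 by apply: (MK _ _ x Kx); rewrite ltrDl.
apply: le_trans; rewrite [leRHS]/Num.norm /= mx_normrE; apply/bigmax_geP.
by right => /=; exists (0, j).
Qed.

Lemma dyadic_lattice_lcube : dyadic_lattice (range lcube).
Proof.
split.
- move=> Q J [i _ <-]; have [i' ->] := lcube_child i J; by exists i'.
- move=> _ _ [i1 _ <-] [i2 _ <-].
  have [r1 hr1] := row_bounded (corner (lcube i1)).
  have [r2 hr2] := row_bounded (corner (lcube i2)).
  have [K1 hK1] := lidx_bounded r1; have [K2 hK2] := lidx_bounded r2.
  pose k := Num.max (Num.max K1 K2) (Num.max i1.1 i2.1).
  have kK1 : K1 <= k by rewrite !le_max lexx.
  have kK2 : K2 <= k by rewrite !le_max lexx !orbT.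
  have ki1 : i1.1 <= k by rewrite !le_max lexx !orbT.
  have ki2 : i2.1 <= k by rewrite !le_max lexx !orbT.
  (* In any later generation where the corner of [lcube i] shares the cell of the origin, that cell
     is the ancestor of [lcube i]; the two given cubes meet there. *)
  clearbody k; have up i (ik : i.1 <= k) r (hr : forall j, `|corner (lcube i) 0 j| <= r)
      (hk : forall x : 'rV[R]_n, (forall j, `|x 0 j| <= r) -> lidx k x = lidx k 0) :
      dyadic_subcubes (lcube (lidx k 0)) (lcube i).
    have [i' [i'k di']] := lcube_ancestor i `|k - i.1|%N.
    rewrite -(hk _ hr) (_ : lidx k _ = i')//.
    have -> : k = i'.1 by rewrite i'k gez0_abs ?subr_ge0// addrCA subrr addr0.
    apply/lcubeP; apply: (dyadic_subcubes_subset di'); exact: corner_in_cube.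
  exists (lcube (lidx k 0)); split; first by exists (lidx k 0).
    by apply: (up _ ki1 r1) => // x; exact: hK1.
  by apply: (up _ ki2 r2) => // x; exact: hK2.
- move=> K /compact_coord_bounded[r hr]; have [k hk] := lidx_bounded r.
  exists (lcube (lidx k 0)); split; first by exists (lidx k 0).
  by move=> x Kx; apply/lcubeP; apply: hk => //; exact: hr.
Qed.

End lattice.

(** * The base grid and the lattices of triples *)

Section shifted_grids.
Context {R : realType} {n : nat}.

Lemma exprz_opp2 (k : int) : exists e : int,
  (e = 1 \/ e = -1) /\ (- 2 : R) ^ k = 2 ^ k * e%:~R.
Proof.
have e0 : (-1 : R) ^ k = 1 \/ (-1 : R) ^ k = -1.
  case: k => k; rewrite ?NegzE -?exprnP -?exprnN -signr_odd;
    by case: odd; rewrite ?invrN ?invr1; [right|left].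
have -> : (- 2 : R) ^ k = (-1) ^ k * 2 ^ k.
  by rewrite -exprzMl ?mulN1r// unitfE ?oppr_eq0.
case: e0 => ->.
  by exists 1; rewrite mulrC; split => //; left.
by exists (-1); rewrite mulrC; split => //; right.
Qed.

Lemma exprz_opp2S (k : int) : (- 2 : R) ^ (k + 1) = - 2 * (- 2) ^ k.
Proof. by rewrite expfzDr ?oppr_eq0// mulrC. Qed.

(* The one-third trick: in each coordinate the grid point nearest to the origin
   is at relative distance 1/3 in every generation. *)
Definition base_shift (k : int) : 'rV[R]_n := const_mx ((- 2) ^ k / 3).

Lemma base_refine k j : exists b : int,
  base_shift (k + 1) 0 j = base_shift k 0 j + scale 1 k * b%:~R.
Proof.
have [e [_ eE]] := exprz_opp2 k; exists (- e).
by rewrite !mxE exprz_opp2S eE /scale rmorphN /=; field.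
Qed.

Lemma base_central k j : exists q : int,
  scale 1 k * (q%:~R + 9^-1) <= - base_shift k 0 j <= scale 1 k * (q%:~R + 8 / 9).
Proof.
have [e [e1 eE]] := exprz_opp2 k; rewrite mxE eE /scale mul1r.
have t0 : 0 < 2 ^ k :> R by rewrite exprz_gt0.
case: e1 => ->.
  by exists (-1); rewrite rmorphN /= -[1%:~R]/(1 : R); apply/andP; split; lra.
by exists 0; rewrite rmorphN /= -[1%:~R]/(1 : R) -[0%:~R]/(0 : R); apply/andP; split; lra.
Qed.

(* The triple of the grid cube of index [z] has lower corner
   [2 ^ k * (z - 1) + (-2) ^ k / 3] in each coordinate; these corners split into
   three cosets of [3 * 2 ^ k * int], and the coset of [(-2) ^ k * (g + k + 1/3)]
   at generation [k] refines to the one with the same [g] at generation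
   [k - 1]. *)
Definition triple_shift (g : {ffun 'I_n -> 'I_3}) (k : int) : 'rV[R]_n :=
  \row_j ((- 2) ^ k * ((g j)%:R + k%:~R + 3^-1)).

Lemma triple_refine g k j : exists b : int,
  triple_shift g (k + 1) 0 j = triple_shift g k 0 j + scale 3 k * b%:~R.
Proof.
have [e [_ eE]] := exprz_opp2 k; exists (- e * ((g j)%:Z + k + 1)).
rewrite !mxE exprz_opp2S eE /scale intrM rmorphN /= !intrD -[1%:~R]/(1 : R).
by rewrite -pmulrn; field.
Qed.

(** In units of the side [3 * 2 ^ k] the origin sits at 1/9, 4/9 or 7/9 of its cell, or at the
    mirror images 8/9, 5/9, 2/9 when [(- 2) ^ k] is positive. This is the origin of the margin
    1/9. *)
Lemma triple_central g k j : exists q : int,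
  scale 3 k * (q%:~R + 9^-1) <= - triple_shift g k 0 j <=
  scale 3 k * (q%:~R + 8 / 9).
Proof.
have [e [e1 eE]] := exprz_opp2 k; rewrite mxE eE /scale.
have t0 : 0 < 2 ^ k :> R by rewrite exprz_gt0.
have -> : (g j)%:R + k%:~R = ((g j)%:Z + k)%:~R :> R by rewrite intrD -pmulrn.
move: ((g j)%:Z + k) => N; rewrite (divz_eq N 3).
have : (N %% 3)%Z = 0 \/ (N %% 3)%Z = 1 \/ (N %% 3)%Z = 2.
  have := modz_ge0 N (isT : 3 != 0 :> int).
  have := ltz_pmod N (isT : 0 < 3 :> int); lia.
move: (N %/ 3)%Z (N %% 3)%Z => a r rE.
have : r%:~R = 0 :> R \/ r%:~R = 1 :> R \/ r%:~R = 2 :> R.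
  by case: rE => [->|[->|->]]; [left|right; left|right; right].
rewrite intrD intrM -[3%:~R]/(3 : R) => {}rE.
case: e1 => ->.
  exists (- a - 1); rewrite !rmorphB !rmorphN /= -[1%:~R]/(1 : R).
  by case: rE => [->|[->|->]]; apply/andP; split; lra.
exists a; rewrite !rmorphN /= -[1%:~R]/(1 : R).
by case: rE => [->|[->|->]]; apply/andP; split; lra.
Qed.

Definition grid_cube : int * 'rV[int]_n -> cube R n := lcube base_shift ltr01.

Definition triple_cube g : int * 'rV[int]_n -> cube R n :=
  lcube (triple_shift g) (ltr0n R 3).

Lemma triple_grid_cube i :
  exists g i', triple (grid_cube i) = triple_cube g i'.
Proof.
case: i => k z; have [e [e1 eE]] := exprz_opp2 k.
(* Comparing corners asks for [z - 1 = e * (3 * a + r + k)]: the remainder [r] of [v j] modulo 3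
   selects the coset, and the quotient [a] gives, up to the sign [e], the position in it. *)
pose v j := e * (z 0 j - 1) - k.
have v3 j : (`|(v j %% 3)%Z| < 3)%N.
  have := modz_ge0 (v j) (isT : 3 != 0 :> int).
  have := ltz_pmod (v j) (isT : 0 < 3 :> int); lia.
exists [ffun j => Ordinal (v3 j)], (k, \row_j (e * (v j %/ 3)%Z)).
have ee : e * e = 1 by case: e1 => ->.
apply: cube_eq; last by rewrite /= /scale mul1r.
apply/rowP => j; rewrite !mxE ffunE /= eE /scale.
have -> : z 0 j = e * ((v j %/ 3)%Z * 3 + (v j %% 3)%Z + k) + 1.
  by rewrite -divz_eq subrK mulrA ee mul1r subrK.
have -> : `|(v j %% 3)%Z|%:R = (v j %% 3)%Z%:~R :> R.
  by rewrite pmulrn gez0_abs// modz_ge0.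
move: (v j %/ 3)%Z (v j %% 3)%Z => a r.
rewrite intrD intrM 2!intrD intrM -[3%:~R]/(3 : R) -[1%:~R]/(1 : R) intrM.
by field.
Qed.

Lemma dyadic_lattice_triple g : dyadic_lattice (range (triple_cube g)).
Proof. exact: (dyadic_lattice_lcube _ (triple_refine g) (triple_central g)). Qed.

Lemma side_grid_cube i : side (grid_cube i) = 2 ^ i.1.
Proof. by rewrite /= /scale mul1r. Qed.

Lemma grid_code : exists G : 'I_(3 ^ n) -> {ffun 'I_n -> 'I_3},
  forall g, exists j, G j = g.
Proof.
have c : #|{ffun 'I_n -> 'I_3}| = (3 ^ n)%N by rewrite card_ffun !card_ord.
exists (fun j => enum_val (cast_ord (esym c) j)) => g.
by exists (cast_ord c (enum_rank g)); rewrite cast_ordK enum_rankK.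
Qed.

Definition gidx : int -> 'rV[R]_n -> int * 'rV[int]_n := lidx 1 base_shift.

End shifted_grids.

Lemma measure_small_tail d (T : measurableType d) (R : realType)
    (mu : {measure set T -> \bar R}) (F : (set T)^nat) (e : R) :
  (mu (F 0%N) < +oo)%E -> (forall i, measurable (F i)) -> nonincreasing_seq F ->
  \bigcap_k F k = set0 -> 0 < e -> exists N, (mu (F N) <= e%:E)%E.
Proof.
move=> F0 mF niF F00 e0; apply: contrapT => no.
have cv : mu \o F @ \oo --> mu (\bigcap_k F k).
  by apply: nonincreasing_cvg_mu => //; rewrite F00.
have : (e%:E <= mu (\bigcap_k F k))%E.
  apply: (cvge_to_ge cv); apply: nearW => k /=.
  by rewrite leNgt; apply/negP => /ltW ke; apply: no; exists k.
by rewrite F00 measure0 lee_fin leNgt e0.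
Qed.

(** * Outer regularity by grid cubes *)

Section grid_regularity.
Context {R : realType} {n : nat}.
Local Notation mu := (@lebesgue_mx R 1 n).
Local Notation "''G_' i" := (cube_set (@grid_cube R n i)) (at level 8, i at level 2, format "''G_' i").
Implicit Types (i : int * 'rV[int]_n) (x y : 'rV[R]_n) (A B : set 'rV[R]_n).

Lemma cube_set_box (Q : cube R n) :
  cube_set Q = mx_box (corner Q) (corner Q + const_mx (side Q)).
Proof.
apply/seteqP; split=> x xQ.
  by move=> k j; rewrite (ord1 k) !mxE; exact: xQ.
by move=> j; have := xQ 0 j; rewrite !mxE.
Qed.

Lemma measurable_cube_borel (Q : cube R n) : measurable (cube_set Q).
Proof. by rewrite cube_set_box; exact: measurable_mx_box. Qed.

Lemma measurable_cube (Q : cube R n) :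
  measurable (cube_set Q : set (leb_mxType R 1 n)).
Proof. by apply: measurable_leb; exact: measurable_cube_borel. Qed.

Lemma volumeE (Q : cube R n) : volume Q = (side Q ^+ n)%:E.
Proof.
rewrite /volume cube_set_box lebesgue_mx_box; last first.
  by move=> i j; rewrite !mxE lerDl ltW// side_gt0.
rewrite big_ord1; congr (_%:E).
under eq_bigr do rewrite !mxE [_ + side Q]addrC addrK.
by rewrite prodr_const card_ord.
Qed.

Lemma cube_lty (Q : cube R n) : (mu (cube_set Q) < +oo)%E.
Proof. by have := volumeE Q; rewrite /volume => ->; rewrite ltry. Qed.

Lemma gridP i x : 'G_i x <-> gidx i.1 x = i.
Proof. exact: lcubeP. Qed.

Lemma gidx_in k x : 'G_(gidx k x) x.
Proof. exact/gridP. Qed.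

Lemma gidx_le k k' x y : k <= k' -> gidx k x = gidx k y ->
  gidx k' x = gidx k' y.
Proof. exact: (lidx_le ltr01 base_refine). Qed.

Lemma grid_subset i i' x : 'G_i x -> 'G_i' x -> i.1 <= i'.1 -> 'G_i `<=` 'G_i'.
Proof. exact: (lcube_subset base_refine). Qed.

(** Open sets of the topology whose basis consists of the half-open grid cells: every point comes
    with a whole cell, which is the form in which the stopping argument uses openness. *)
Definition grid_open (A : set 'rV[R]_n) :=
  forall x, A x -> exists k, 'G_(gidx k x) `<=` A.

Lemma grid_openI A B : grid_open A -> grid_open B -> grid_open (A `&` B).
Proof.
move=> oA oB x [/oA[k kA] /oB[l lB]].
have [kl|/ltW lk] := lerP k l.
  exists k => y yk; split; first exact: kA.
  by apply: lB; apply: (grid_subset (gidx_in k x) (gidx_in l x)).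
exists l => y yl; split; last exact: lB.
by apply: kA; apply: (grid_subset (gidx_in l x) (gidx_in k x)).
Qed.

Lemma grid_open_bigcup I (D : set I) (F : I -> set 'rV[R]_n) :
  (forall t, D t -> grid_open (F t)) -> grid_open (\bigcup_(t in D) F t).
Proof.
move=> oF x [t Dt /(oF t Dt)[k kF]]; exists k.
by apply: subset_trans kF _; exact: bigcup_sup.
Qed.

Lemma grid_openT : grid_open setT.
Proof. by move=> x _; exists 0. Qed.

Lemma grid_open_bigcap_ltn (F : nat -> set 'rV[R]_n) N :
  (forall k, grid_open (F k)) -> grid_open [set x | forall k, (k < N)%N -> F k x].
Proof.
move=> oF; elim: N => [|N IH].
  by rewrite (_ : [set _ | _] = setT)//; [exact: grid_openT|exact/seteqP].
rewrite (_ : [set _ | _] = [set x | forall k, (k < N)%N -> F k x] `&` F N).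
  exact: grid_openI.
apply/seteqP; split=> x /=.
  by move=> H; split=> [k kN|]; [apply: H; exact: ltnW|exact: H].
by move=> [H FN] k; rewrite ltnS leq_eqVlt => /orP[/eqP->//|]; exact: H.
Qed.

Lemma measurable_grid_open A : grid_open A -> measurable A.
Proof.
move=> oA; rewrite (_ : A = \bigcup_(i in [set i | 'G_i `<=` A]) 'G_i).
  by apply: measurable_bigcup_countable => i _; exact: measurable_cube_borel.
apply/seteqP; split=> x.
  by move=> /oA[k kA]; exists (gidx k x) => //; exact: gidx_in.
by move=> [i /= iA]; exact: iA.
Qed.

Lemma small_cell x (e : R) : 0 < e ->
  exists k, forall y, 'G_(gidx k x) y -> forall j, `|y 0 j - x 0 j| < e.
Proof.
move=> /(@scale_small R 1 ltr01)[k /(_ k (lexx k)) ke]; exists k => y yk j.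
move: (yk j) (gidx_in k x j); rewrite /= !mxE => /andP[h1 h2] /andP[h3 h4].
by rewrite ltr_norml; apply/andP; split; lra.
Qed.

Lemma grid_open_ltray j (a : R) : grid_open [set x | x 0 j < a].
Proof.
move=> x /= xa; have [k kx] := @small_cell x (a - x 0 j) (etrans (subr_gt0 _ _) xa).
by exists k => y /kx /(_ j); rewrite ltr_norml => /andP[_]; rewrite ltrD2r.
Qed.

Lemma grid_open_gtray j (a : R) : grid_open [set x | a < x 0 j].
Proof.
move=> x /= xa; have [k kx] := @small_cell x (x 0 j - a) (etrans (subr_gt0 _ _) xa).
exists k => y /kx /(_ j); rewrite ltr_norml => /andP[h _] /=; lra.
Qed.

Section inside_cube.
Variable P : cube R n.
Local Notation CP := (cube_set P).

(* The condition is symmetric in [B] and its complement, which makes the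
   regular sets a sigma-algebra. *)
Definition grid_regular (B : set 'rV[R]_n) := forall e : R, 0 < e ->
  exists U V, [/\ grid_open U, grid_open V, B `<=` U, ~` B `<=` V &
    (mu (U `&` V `&` CP) <= e%:E)%E].

Let mI (A : set 'rV[R]_n) : measurable A ->
  measurable (A `&` CP : set (leb_mxType R 1 n)).
Proof.
by move=> mA; apply: measurable_leb; apply: measurableI => //; exact: measurable_cube_borel.
Qed.

Let mI_lty (A : set 'rV[R]_n) : measurable A -> (mu (A `&` CP) < +oo)%E.
Proof.
move=> mA; apply: le_lt_trans (cube_lty P); apply: le_measure; rewrite ?inE.
- exact: mI.
- exact: measurable_cube.
- exact: subIsetr.
Qed.

Lemma grid_regular_ray j (a : R) : grid_regular [set x | a <= x 0 j].
Proof.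
move=> e e0.
(* The overlap of the two open sets is a slab below the hyperplane; the slabs decrease to the empty
   set inside a cube of finite measure, so one of them is small. *)
pose F (k : nat) := [set x : 'rV[R]_n | a - k.+1%:R^-1 < x 0 j] `&` [set x : 'rV[R]_n | x 0 j < a] `&` CP.
have mF k : measurable (F k : set (leb_mxType R 1 n)).
  apply: mI; apply: measurable_grid_open; apply: grid_openI.
    exact: grid_open_gtray.
  exact: grid_open_ltray.
have [N FN] : exists N, (mu (F N) <= e%:E)%E.
  apply: measure_small_tail => //.
  - apply: mI_lty; apply: measurable_grid_open; apply: grid_openI.
      exact: grid_open_gtray.
    exact: grid_open_ltray.
  - move=> k l kl; apply/subsetPset => x [[/= h1 h2] h3]; split => //; split => //=.
    apply: le_lt_trans h1; rewrite lerD2l lerN2 lef_pV2 ?posrE ?ltr0n//.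
    by rewrite ler_nat ltnS.
  - apply/seteqP; split => // x Fx.
    have xa : 0 < a - x 0 j by have [[/= _ ?] _] := Fx 0%N I; rewrite subr_gt0.
    pose k := Num.truncn (a - x 0 j)^-1.
    have [[/= h _] _] := Fx k I.
    have : (a - x 0 j)^-1 < k.+1%:R by exact: truncnS_gt.
    rewrite -[ltRHS]invrK ltf_pV2 ?posrE ?invr_gt0// => hk.
    by move: h; rewrite ltrBlDr -ltrBlDl => /(lt_trans hk); rewrite ltxx.
exists [set x | a - N.+1%:R^-1 < x 0 j], [set x | x 0 j < a]; split => //.
- exact: grid_open_gtray.
- exact: grid_open_ltray.
- by move=> x /= ax; apply: lt_le_trans ax; rewrite gtrDl oppr_lt0 invr_gt0.
- by move=> x /= /negP; rewrite -ltNge.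
Qed.

Lemma grid_regular_setC B : grid_regular B -> grid_regular (~` B).
Proof.
move=> rB e /rB[U [V [oU oV BU BV le_e]]]; exists V, U; split => //.
  by rewrite setCK.
by rewrite [V `&` U]setIC.
Qed.

Lemma grid_regular_set0 : grid_regular set0.
Proof.
move=> e e0; exists set0, setT; split => //; last by rewrite !set0I measure0 lee_fin ltW.
exact: grid_openT.
Qed.

(** The complement of the union lies in the intersection of all [V k], which need not be open, so
    only the first [N] are kept. The overlaps with budgets [e / 2 ^+ k.+2] cost less than [e / 2],
    and [N] is taken so large that the part of the union missed by the first [N] sets costs the
    other half. *)
Lemma grid_regular_bigcup (B : (set 'rV[R]_n)^nat) :
  (forall k, grid_regular (B k)) -> grid_regular (\bigcup_k B k).
Proof.
move=> rB e e0.
have /choice[U /choice[V UV]] k := rB k _ (divr_gt0 e0 (exprn_gt0 k.+2 (ltr0n R 2))).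
pose UU := \bigcup_k U k.
have oUU : grid_open UU by apply: grid_open_bigcup => k _; have [] := UV k.
pose VV N := [set x | forall k, (k < N)%N -> V k x].
have oVV N : grid_open (VV N) by apply: grid_open_bigcap_ltn => k; have [] := UV k.
pose W k := U k `&` V k `&` CP.
pose F N := (UU `\` \bigcup_(k in [set k | (k < N)%N]) U k) `&` CP.
have mU k : measurable (U k) by apply: measurable_grid_open; have [] := UV k.
have mV k : measurable (V k) by apply: measurable_grid_open; have [] := UV k.
have mUD N : measurable (UU `\` \bigcup_(k in [set k | (k < N)%N]) U k).
  by apply: measurableD; [exact: measurable_grid_open|exact: bigcup_measurable].
have [N FN] : exists N, (mu (F N) <= (e / 2)%:E)%E.
  apply: measure_small_tail => //; last by rewrite divr_gt0.
  - exact: mI_lty.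
  - by move=> N; exact: mI.
  - move=> N M NM; apply/subsetPset => x [[Ux nU] Px]; split => //; split => //.
    by move=> [k /= kN Ukx]; apply: nU; exists k => //=; exact: leq_trans NM.
  - apply/seteqP; split => // x Fx; have [[[k _ Ukx] _] _] := Fx 0%N I.
    by have [[_ +] _] := Fx k.+1 I; apply; exists k => /=.
exists UU, (VV N); split => //.
- by apply: subset_bigcup => k _; have [] := UV k.
- move=> x nB k _; have [_ _ _ + _] := UV k; apply => Bk.
  by apply: nB; exists k.
apply: (@le_trans _ _ (mu (\big[setU/set0]_(k < N) W k `|` F N))).
  apply: le_measure; rewrite ?inE.
  - by apply: mI; apply: measurableI; exact: measurable_grid_open.
  - apply: measurableU; last exact: mI.
    by apply: bigsetU_measurable => k _; apply: mI; exact: measurableI.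
  - move=> x [[UUx VVx] Px].
    have [[k kN Ukx]|no] := pselect ((\bigcup_(k in [set k | (k < N)%N]) U k) x).
      left; rewrite -bigcup_mkord; exists k => //; split => //; split => //.
      exact: VVx.
    by right; split.
have mW k : measurable (W k : set (leb_mxType R 1 n)).
  by apply: mI; exact: measurableI.
have mbW M : measurable (\big[setU/set0]_(k < M) W k : set (leb_mxType R 1 n)).
  exact: bigsetU_measurable.
apply: le_trans (measureU2 _ _ _) _ => //; first exact: mI.
rewrite [in leRHS](splitr e) EFinD; apply: leeD => //.
have bW M : (mu (\big[setU/set0]_(k < M) W k) <= (e / 2 - e / 2 ^+ M.+1)%:E)%E.
  elim: M => [|M IH]; first by rewrite big_ord0 measure0 expr1 subrr.
  rewrite big_ord_recr; apply: le_trans (measureU2 _ _ _) _ => //.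
  have [_ _ _ _ eW] := UV M.
  apply: le_trans (leeD IH eW) _; rewrite -EFinD lee_fin le_eqVlt; apply/orP; left.
  by apply/eqP; rewrite !exprS; field; rewrite expf_neq0.
apply: le_trans (bW N) _.
by rewrite lee_fin gerBl divr_ge0 ?exprn_ge0// ltW.
Qed.

Lemma grid_regular_borel B : measurable B -> grid_regular B.
Proof.
rewrite measurable_mx_rays; move: B; apply: smallest_sub.
  split; [exact: grid_regular_set0|move=> A rA; rewrite setTD|].
    exact: grid_regular_setC.
  exact: grid_regular_bigcup.
move=> _ [i [j [a ->]]]; rewrite (ord1 i); exact: grid_regular_ray.
Qed.

Lemma grid_outer_regular (E : set (leb_mxType R 1 n)) (e : R) :
  measurable E -> E `<=` CP -> 0 < e ->
  exists U, [/\ grid_open U, E `<=` U & (mu (U `&` CP) <= mu E + e%:E)%E].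
Proof.
(* One half of [e] pays for the Borel set around [E], the other for the part of [U] outside that
   Borel set, which lies in [U] and [V]. *)
move=> mE EP e0; have e20 : 0 < e / 2 by rewrite divr_gt0.
have Eoo : (mu E < +oo)%E.
  apply: le_lt_trans (cube_lty P); apply: le_measure; rewrite ?inE//.
  exact: measurable_cube.
have [B [mB EB BE]] := outer_borel_approx e20 Eoo.
have [U [V [oU oV BU BV UVe]]] := grid_regular_borel mB e20.
exists U; split => //; first exact: subset_trans BU.
have mU := measurable_grid_open oU; have mV := measurable_grid_open oV.
apply: (@le_trans _ _ (mu (B `|` (U `&` V `&` CP)))).
  apply: le_measure; rewrite ?inE; first exact: mI.
    apply: measurableU; first exact: measurable_leb.
    by apply: mI; exact: measurableI.
  move=> x [Ux Px]; have [Bx|nBx] := pselect (B x); [by left|right].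
  by split => //; split => //; exact: BV.
apply: le_trans (measureU2 _ _ _) _.
- exact: measurable_leb.
- by apply: mI; exact: measurableI.
by rewrite [in leRHS](splitr e) EFinD addeA; exact: leeD.
Qed.

End inside_cube.
End grid_regularity.

(** * Kernel estimates *)

Section localization.
Context {R : realType} {m n : nat}.

Definition localize (A : set 'M[R]_(m, n)) (f : 'M[R]_(m, n) -> R) :=
  fun y => f y * \1_A y.

Lemma localizeE A f y : localize A f y = (f \_ A) y.
Proof. by rewrite /localize indicE patchE; case: (y \in A); rewrite ?mulr1 ?mulr0. Qed.

Lemma localize_subset A B f : A `<=` B -> localize A (localize B f) = localize A f.
Proof.
move=> AB; apply/funext => y; rewrite /localize -mulrA; congr (_ * _).
rewrite !indicE; case: (boolP (y \in A)) => yA; last by rewrite mulr0.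
by rewrite mulr1 mem_set//; apply: AB; exact: set_mem yA.
Qed.

Lemma localize_L1 (A : set (leb_mxType R m n)) f :
  measurable A -> in_L1 f -> in_L1 (localize A f).
Proof.
move=> mA fi; have mf : lebesgue_measurable f by have /measurable_int/measurable_EFinP := fi.
apply: le_integrable fi => //.
  by apply/measurable_EFinP; apply: measurable_funM => //; exact: measurable_indic.
move=> y _ /=; rewrite lee_fin normrM ler_piMr// indicE.
by case: (y \in A); rewrite ?normr1 ?normr0.
Qed.

Lemma L1_norm_le (f g : 'M[R]_(m, n) -> R) : in_L1 f -> in_L1 g ->
  (forall x, `|f x| <= `|g x|) -> L1_norm f <= L1_norm g.
Proof.
move=> fi gi fg; rewrite -lee_fin -!L1_normE//; apply: ge0_le_integral => //.
- by apply/measurable_EFinP; apply: measurableT_comp => //; have /measurable_int/measurable_EFinP := fi.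
- by apply/measurable_EFinP; apply: measurableT_comp => //; have /measurable_int/measurable_EFinP := gi.
- by move=> x _; rewrite lee_fin.
Qed.

Lemma localize_norm_le (A B : set (leb_mxType R m n)) f :
  measurable A -> measurable B -> A `<=` B -> in_L1 f ->
  L1_norm (localize A f) <= L1_norm (localize B f).
Proof.
move=> mA mB AB fi; apply: L1_norm_le; try exact: localize_L1.
move=> x; rewrite -(localize_subset f AB) /localize normrM ler_piMr// indicE.
by case: (x \in A); rewrite ?normr1 ?normr0.
Qed.

Lemma L1_norm_localize (A : set (leb_mxType R m n)) f :
  L1_norm (localize A f) = \int[lebesgue_mx m n]_(x in A) `|f x|.
Proof.
rewrite Rintegral_mkcond /L1_norm; apply: eq_Rintegral => x _.
by rewrite localizeE !patchE; case: ifP; rewrite ?normr0.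
Qed.

End localization.

Section bounded_kernel.
Context {R : realType} {m n : nat}.

Lemma L1_scale p (c : R) (f : 'M[R]_(p, n) -> R) : in_L1 f -> in_L1 (fun y => c * f y).
Proof.
move=> fi; rewrite /in_L1 (_ : EFin \o _ = (fun y => c%:E * (EFin \o f) y)%E)//.
exact: integrableZl.
Qed.

(** The bound on [F] is asked only where the tensor does not vanish, because the kernel is
    controlled only away from the diagonal. *)
Lemma bounded_tensor (F : 'M[R]_(m, n) -> R) (g : 'I_m -> 'rV[R]_n -> R) (B : R) :
  (forall j, in_L1 (g j)) -> lebesgue_measurable F -> 0 <= B ->
  (forall y, tensor g y != 0 -> `|F y| <= B) ->
  in_L1 (fun y => F y * tensor g y) /\
  `|\int[lebesgue_mx m n]_y (F y * tensor g y)| <= B * \prod_(j < m) L1_norm (g j).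
Proof.
move=> gi mF B0 FB; have [ti tE] := tensor_L1 gi.
have mt : lebesgue_measurable (tensor g) by have /measurable_int/measurable_EFinP := ti.
have le y : `|F y * tensor g y| <= `|B * tensor g y|.
  rewrite !normrM (ger0_norm B0); have [->|/FB FyB] := eqVneq (tensor g y) 0.
    by rewrite normr0 !mulr0.
  by rewrite ler_wpM2r.
have Bi : in_L1 (fun y => B * tensor g y) by exact: L1_scale.
have Fi : in_L1 (fun y => F y * tensor g y).
  apply: le_integrable Bi => //.
    by apply/measurable_EFinP; exact: measurable_funM.
  by move=> y _ /=; rewrite lee_fin.
split => //; apply: le_trans (le_normr_Rintegral _ _) _ => //.
rewrite -tE -/(L1_norm (fun y => F y * tensor g y)).
apply: le_trans (L1_norm_le Fi Bi le) _.
rewrite /L1_norm le_eqVlt; apply/orP; left; apply/eqP; rewrite -RintegralZl//.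
  by apply: eq_Rintegral => y _; rewrite normrM (ger0_norm B0).
exact: integrable_norm.
Qed.

Lemma Linfty0_L1 (f : 'rV[R]_n -> R) : in_Linfty0 f -> in_L1 f.
Proof.
move=> [mf [M fM] /compact_coord_bounded[r fr]].
pose P := mx_box (const_mx (- r - 1)) (const_mx (r + 1)) : set (leb_mxType R 1 n).
have mP : measurable P by apply: measurable_leb; exact: measurable_mx_box.
have Plt : (lebesgue_mx 1 n P < +oo)%E.
  by rewrite lebesgue_mx_borel ?borel_box_lty//; exact: measurable_mx_box.
have fP : f = localize P f.
  apply/funext => x; rewrite /localize indicE; have [->|fx] := eqVneq (f x) 0.
    by rewrite mul0r.
  rewrite mem_set ?mulr1// => i j; rewrite (ord1 i) !mxE.
  have := fr x (@subset_closure _ [set x | f x != 0] x fx) j; rewrite ler_norml => /andP[h1 h2].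
  by apply/andP; split; lra.
have Pi : in_L1 (fun x : 'rV[R]_n => \1_P x : R).
  apply/integrableP; split; first by apply/measurable_EFinP; exact: measurable_indic.
  under eq_integral do rewrite /= ger0_norm//.
  rewrite integral_indic// setIT; exact: Plt.
have MPi : in_L1 (fun x => `|M| * \1_P x) by exact: L1_scale.
apply: le_integrable MPi => //; first exact/measurable_EFinP.
move=> x _ /=; rewrite lee_fin fP /localize !normrM normr_id ler_wpM2r//.
exact: le_trans (fM x) (ler_norm M).
Qed.

End bounded_kernel.

Lemma sum_ord_telescope (V : zmodType) m (a : nat -> V) :
  \sum_(i < m) (a i - a i.+1) = a 0%N - a m.
Proof.
elim: m => [|m IH]; first by rewrite big_ord0 subrr.
by rewrite big_ord_recr /= IH addrA subrK.
Qed.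

(** * Differences of localized values through the kernel *)

Section telescoping.
Context {R : realType} {n m : nat}.
Variables (T : ('I_m -> 'rV[R]_n -> R) -> 'rV[R]_n -> \bar R).
Variable (K : 'rV[R]_n -> 'M[R]_(m, n) -> R).
Hypothesis T_meas : forall f, (forall i, in_L1 (f i)) ->
  measurable_fun [set: leb_mxType R 1 n] (T f) /\
  {ae (@lebesgue_mx R 1 n), forall x, T f x \is a fin_num}.
Hypothesis T_lin : multilinear T.
Hypothesis K_assoc : associated_kernel K T.
Hypothesis K_meas : kernel_measurable K.
Variable f : 'I_m -> 'rV[R]_n -> R.
Hypothesis f_L1 : forall i, in_L1 (f i).

Definition localized (A : set 'rV[R]_n) (j : 'I_m) := localize A (f j).

(** A path from all arguments on [B], at [k = 0], to all arguments on [A], at [k = m]; each step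
    changes one argument, so multilinearity applies to it. *)
Definition interpolated (A B : set 'rV[R]_n) (k : nat) (j : 'I_m) :=
  localize (if (j < k)%N then A else B) (f j).

(* Argument [i] lives on [B] outside [A], so that the kernel is nonsingular when
   [x] is well inside [A]. *)
Definition hybrid (A B : set 'rV[R]_n) (i j : 'I_m) :=
  localize (if (j < i)%N then A else if j == i then B `\` A else B) (f j).

Lemma ae_kernel_measurable :
  {ae @lebesgue_mx R 1 n, forall x, lebesgue_measurable (K x)}.
Proof.
have := ae_section_measurable K_meas; apply: ae_imply => x.
by congr lebesgue_measurable; apply/funext => y; rewrite col_mxKu col_mxKd.
Qed.

Lemma interpolated_subst (A B : set (leb_mxType R 1 n)) (i : 'I_m) :
  subst_arg (interpolated A B i) i (localize A (f i)) = interpolated A B i.+1 /\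
  subst_arg (interpolated A B i) i (localize B (f i)) = interpolated A B i.
Proof.
split; apply/funext => j; rewrite /subst_arg /interpolated; case: eqVneq => [->|ji].
- by rewrite ltnSn.
- have ji' : (j == i :> nat) = false by exact: negbTE.
  by rewrite [in RHS]ltnS [in RHS]leq_eqVlt ji'.
- by rewrite ltnn.
- by [].
Qed.

Lemma hybrid_subst (A B : set (leb_mxType R 1 n)) (i : 'I_m) : A `<=` B ->
  subst_arg (interpolated A B i) i
    (fun y => -1 * localize A (f i) y + localize B (f i) y) = hybrid A B i.
Proof.
move=> AB; apply/funext => j; rewrite /subst_arg /interpolated /hybrid.
case: eqVneq => [->|ji //]; rewrite ltnn; apply/funext => y.
rewrite /localize !indicE in_setD; case: (boolP (y \in A)) => yA.
  by rewrite mem_set ?andbF; [rewrite mulr1 mulr0; lra|apply: AB; exact: set_mem].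
by rewrite andbT mulr0 mulr0 add0r.
Qed.

Lemma interpolated_L1 (A B : set (leb_mxType R 1 n)) k j :
  measurable A -> measurable B -> in_L1 (interpolated A B k j).
Proof. by move=> mA mB; apply: localize_L1 => //; case: ifP. Qed.

Lemma hybrid_L1 (A B : set (leb_mxType R 1 n)) i j :
  measurable A -> measurable B -> in_L1 (hybrid A B i j).
Proof.
move=> mA mB; apply: localize_L1 => //; case: ifP => // _; case: ifP => // _.
exact: measurableD.
Qed.

Lemma telescoping_step (A B : set (leb_mxType R 1 n)) (i : 'I_m) :
  measurable A -> measurable B -> A `<=` B ->
  {ae @lebesgue_mx R 1 n, forall x,
    in_L1 (fun y => K x y * tensor (hybrid A B i) y) ->
    fine (T (interpolated A B i) x) - fine (T (interpolated A B i.+1) x) =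
    \int[lebesgue_mx m n]_y (K x y * tensor (hybrid A B i) y)}.
Proof.
move=> mA mB AB.
have lA : in_L1 (localize A (f i)) by exact: localize_L1.
have lB : in_L1 (localize B (f i)) by exact: localize_L1.
have fin k : {ae @lebesgue_mx R 1 n, forall x, T (interpolated A B k) x \is a fin_num}.
  by have [] := T_meas (fun j => interpolated_L1 k j mA mB).
have as_ := K_assoc (fun j => hybrid_L1 i j mA mB).
have lin := T_lin i (-1) (fun j => interpolated_L1 i j mA mB) lA lB.
apply: ae_imply (ae_and (ae_and (fin i) (fin i.+1)) (ae_and as_ lin)).
move=> x [[fi fi1] [asx linx]] /asx; move: linx.
rewrite hybrid_subst// (interpolated_subst A B i).1 (interpolated_subst A B i).2.
move=> -> /(congr1 fine) /= <-.
by move: fi fi1; case: (T _ x) => // a _; case: (T _ x) => // b _ /=; lra.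
Qed.

(** The convergence of the integrals stays a premise at each point: the kernel formula says nothing
    without it, and it is later supplied only for [x] in the smaller cube. *)
Lemma telescoping (A B : set (leb_mxType R 1 n)) :
  measurable A -> measurable B -> A `<=` B ->
  {ae @lebesgue_mx R 1 n, forall x,
    (forall i, in_L1 (fun y => K x y * tensor (hybrid A B i) y)) ->
    fine (T (localized B) x) - fine (T (localized A) x) =
    \sum_(i < m) \int[lebesgue_mx m n]_y (K x y * tensor (hybrid A B i) y)}.
Proof.
move=> mA mB AB.
have := ae_forall_countable (fun i => telescoping_step i mA mB AB).
apply: ae_imply => x step int.
have -> : localized B = interpolated A B 0 by apply/funext.
have -> : localized A = interpolated A B m.
  by apply/funext => j; rewrite /interpolated ltn_ord.
rewrite -(sum_ord_telescope m (fun k => fine (T (interpolated A B k) x))).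
by apply: eq_bigr => i _; exact: step.
Qed.

End telescoping.

Section cube_inclusions.
Context {R : realType} {n : nat}.
Implicit Types (P Q : cube R n) (x y : 'rV[R]_n).

Lemma cube_subset_bounds Q P : cube_set Q `<=` cube_set P -> forall j,
  corner P 0 j <= corner Q 0 j /\ corner Q 0 j + side Q <= corner P 0 j + side P.
Proof.
move=> QP j; have := QP _ (corner_in_cube Q) j => /andP[h1 h2]; split => //.
rewrite leNgt; apply/negP => h3.
(* If [Q] stuck out of [P] in coordinate [j], this point of [Q] would lie on or beyond the excluded
   upper face of [P]. *)
pose x := \row_l (if l == j then Num.max (corner Q 0 j) (corner P 0 j + side P)
  else corner Q 0 l).
have Qx : cube_set Q x.
  move=> l; rewrite mxE; case: eqP => [->|_].
    by rewrite le_max lexx/= gt_max h3 ltrDl side_gt0.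
  by rewrite lexx ltrDl side_gt0.
by have := QP x Qx j; rewrite mxE eqxx le_max => /andP[_]; rewrite gt_max ltxx andbF.
Qed.

Lemma triple_subset Q P :
  cube_set Q `<=` cube_set P -> cube_set (triple Q) `<=` cube_set (triple P).
Proof.
move=> /cube_subset_bounds QP x xQ j; have := xQ j; have [h1 h2] := QP j.
by rewrite /= !mxE => /andP[h3 h4]; apply/andP; split; lra.
Qed.

(** In each coordinate the dilate reaches at most [t * side Q0 / 2 <= side Q] from the center of
    [Q0], which lies in [Q]. *)
Lemma dilate_subset_triple Q0 Q t : cube_set Q0 `<=` cube_set Q -> 0 <= t ->
  t * side Q0 <= 2 * side Q -> dilate Q0 t `<=` cube_set (triple Q).
Proof.
move=> /cube_subset_bounds Q0Q t0 tQ _ [x xQ <-] j.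
have [h1 h2] := Q0Q j; have := xQ j; have := side_gt0 Q0.
rewrite /Defs.center /= !mxE => s0 /andP[h3 h4].
have h5 : 0 <= t * (x 0 j - corner Q0 0 j) by rewrite mulr_ge0// subr_ge0.
have [->|tn0] := eqVneq t 0; first by apply/andP; split; lra.
have tp : 0 < t by rewrite lt_neqAle eq_sym tn0.
have h6 : t * (x 0 j - corner Q0 0 j) < t * side Q0 by rewrite ltr_pM2l// ltrBlDl.
by apply/andP; split; lra.
Qed.

Lemma coord_le_norm x j : `|x 0 j| <= euclidean_norm x.
Proof.
rewrite /euclidean_norm -sqrtr_sqr; apply: ler_wsqrtr.
by rewrite (bigD1 j)//= lerDl sumr_ge0// => k _; exact: sqr_ge0.
Qed.

Lemma dist_triple Q x y : cube_set Q x -> ~ cube_set (triple Q) y ->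
  side Q <= euclidean_norm (x - y).
Proof.
move=> xQ /existsNP[j]; have := xQ j; rewrite /= !mxE => /andP[h1 h2] /negP h3.
apply: le_trans (coord_le_norm _ j); rewrite !mxE ler_normr.
by move: h3; rewrite negb_and -!ltNge -leNgt => /orP[h|h]; apply/orP; [left|right]; lra.
Qed.

End cube_inclusions.

Section kernel_estimates.
Context {R : realType} {n m : nat}.
Variables (rho : R -> R) (CK : R) (K : 'rV[R]_n -> 'M[R]_(m, n) -> R).
Hypothesis rho_ge0 : forall t, 0 <= t -> 0 <= rho t.
Hypothesis K_size : kernel_size CK K.
Hypothesis K_smooth : kernel_smoothness rho CK K.
Variable f : 'I_m -> 'rV[R]_n -> R.
Hypothesis f_L1 : forall i, in_L1 (f i).
Implicit Types (P Q : cube R n) (x : 'rV[R]_n).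
Local Notation TS Q := (cube_set (triple Q)).
Local Notation mass P := (\prod_(j < m) L1_norm (localize (TS P) (f j))).
Local Notation term Q P x i :=
  (fun y : 'M[R]_(m, n) => K x y * tensor (hybrid f (TS Q) (TS P) i) y).

Lemma hybrid_tensor_neq0 (A B : set 'rV[R]_n) i y :
  tensor (hybrid f A B i) y != 0 -> ~ A (row i y).
Proof.
move=> t0 Ai; move: t0; rewrite /tensor (bigD1 i)//= /hybrid ltnn eqxx.
rewrite {1}/localize indicE memNset ?mulr0 ?mul0r ?eqxx//.
by case.
Qed.

Lemma hybrid_mass Q P i : cube_set Q `<=` cube_set P ->
  \prod_(j < m) L1_norm (hybrid f (TS Q) (TS P) i j) <= mass P.
Proof.
move=> QP; apply: ler_prod => j _; rewrite L1_norm_ge0/=.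
have mQ := measurable_cube (triple Q); have mP := measurable_cube (triple P).
apply: localize_norm_le => //.
  by case: ifP => // _; case: ifP => // _; exact: measurableD.
case: ifP => [_|_]; first exact: triple_subset.
by case: ifP => _; [exact: subDsetl|exact: subset_refl].
Qed.

Lemma kernel_size_bound Q x y i : cube_set Q x -> ~ TS Q (row i y) ->
  `|K x y| <= `|CK| / side Q ^+ (n * m).
Proof.
move=> xQ yQ; have s0 := side_gt0 Q.
have yx : exists i, row i y != x.
  by exists i; apply/eqP => yx; apply: yQ; rewrite yx; exact: cube_subset_triple.
have d : side Q <= max_dist x y.
  by apply: le_trans (dist_triple xQ yQ) _; apply: le_bigmax.
have d0 : 0 < max_dist x y by exact: lt_le_trans d.
apply: le_trans (K_size yx) _.
apply: (@le_trans _ _ (`|CK| / max_dist x y ^+ (n * m))).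
  by rewrite ler_wpM2r ?invr_ge0 ?exprn_ge0 ?(ltW d0)// ler_norm.
rewrite ler_wpM2l// lef_pV2 ?posrE ?exprn_gt0//.
by apply: lerXn2r => //; rewrite nnegrE ltW.
Qed.

Lemma hybrid_term Q P x i : cube_set Q `<=` cube_set P -> cube_set Q x ->
  lebesgue_measurable (K x) ->
  in_L1 (term Q P x i) /\
  `|\int[lebesgue_mx m n]_y term Q P x i y| <=
    `|CK| / side Q ^+ (n * m) * mass P.
Proof.
move=> QP Qx mKx.
have mQ := measurable_cube (triple Q); have mP := measurable_cube (triple P).
have C0 : 0 <= `|CK| / side Q ^+ (n * m).
  by rewrite divr_ge0// exprn_ge0// ltW// side_gt0.
have [Li Le] := bounded_tensor (fun j => hybrid_L1 f_L1 i j mQ mP) mKx C0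
  (fun y ty => kernel_size_bound Qx (hybrid_tensor_neq0 ty)).
split => //; apply: le_trans Le _; rewrite ler_wpM2l//; exact: hybrid_mass.
Qed.

Lemma sum_bound (F : 'I_m -> R) B : (forall i, `|F i| <= B) ->
  `|\sum_(i < m) F i| <= m%:R * B.
Proof.
move=> FB; apply: le_trans (ler_norm_sum _ _ _) _.
apply: le_trans (ler_sum _ (fun i _ => FB i)) _.
by rewrite sumr_const card_ord mulr_natl.
Qed.

Lemma hybrid_sum Q P x : cube_set Q `<=` cube_set P -> cube_set Q x ->
  lebesgue_measurable (K x) ->
  `|\sum_(i < m) \int[lebesgue_mx m n]_y term Q P x i y| <=
    m%:R * (`|CK| / side Q ^+ (n * m) * mass P).
Proof.
by move=> QP Qx mKx; apply: sum_bound => i; have [] := hybrid_term i QP Qx mKx.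
Qed.

(** Argument [i] lives outside the triple of [Q], hence outside the dilate of the possibly much
    smaller [Q0] by [t]. Smoothness therefore gains [rho t^-1], with [t] as large as twice the ratio
    of the sides. *)
Lemma hybrid_sum_diff Q0 Q P x x' t : cube_set Q0 `<=` cube_set Q ->
  cube_set Q `<=` cube_set P -> cube_set Q0 x -> cube_set Q0 x' ->
  lebesgue_measurable (K x) -> lebesgue_measurable (K x') ->
  2 <= t -> t * side Q0 <= 2 * side Q ->
  `|\sum_(i < m) \int[lebesgue_mx m n]_y term Q P x i y -
    \sum_(i < m) \int[lebesgue_mx m n]_y term Q P x' i y| <=
    m%:R * (`|CK| / (t * side Q0) ^+ (m * n) * rho t^-1 * mass P).
Proof.
move=> Q0Q QP Qx Qx' mKx mKx' t2 tQ; rewrite -sumrB; apply: sum_bound => i.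
have mQ := measurable_cube (triple Q); have mP := measurable_cube (triple P).
have [Lx _] := hybrid_term i QP (Q0Q _ Qx) mKx.
have [Lx' _] := hybrid_term i QP (Q0Q _ Qx') mKx'.
have t0 : 0 <= t by apply: le_trans t2.
have C0 : 0 <= `|CK| / (t * side Q0) ^+ (m * n) * rho t^-1.
  rewrite mulr_ge0 ?rho_ge0 ?invr_ge0//.
  by rewrite divr_ge0// exprn_ge0// mulr_ge0// ltW// side_gt0.
have mD : lebesgue_measurable (fun y => K x y - K x' y) by exact: measurable_funB.
have small y : tensor (hybrid f (TS Q) (TS P) i) y != 0 ->
    `|K x y - K x' y| <= `|CK| / (t * side Q0) ^+ (m * n) * rho t^-1.
  move=> /hybrid_tensor_neq0 yQ.
  apply: le_trans (K_smooth Qx Qx' t2 _) _.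
    by exists i => yd; apply: yQ; exact: (dilate_subset_triple Q0Q t0 tQ).
  rewrite ler_wpM2r ?rho_ge0 ?invr_ge0// ler_wpM2r ?ler_norm//.
  by rewrite invr_ge0 exprn_ge0// mulr_ge0// ltW// side_gt0.
have [Li Le] := bounded_tensor (fun j => hybrid_L1 f_L1 i j mQ mP) mD C0 small.
rewrite -RintegralB//.
under eq_Rintegral do rewrite -mulrBl.
by apply: le_trans Le _; rewrite ler_wpM2l//; exact: hybrid_mass.
Qed.

End kernel_estimates.

Definition cell_weight (R : realType) (n m : nat)
    (avg : int * 'rV[int]_n -> 'I_m -> R) (i : int * 'rV[int]_n) : R :=
  \prod_(j < m) avg i j.

(** * Oscillation of the localized values along the grid *)

Section grid_oscillation.
Context {R : realType} {n m : nat}.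
Variables (rho : R -> R) (CK CW : R).
Variables (T : ('I_m -> 'rV[R]_n -> R) -> 'rV[R]_n -> \bar R).
Variable (K : 'rV[R]_n -> 'M[R]_(m, n) -> R).
Hypothesis m_gt0 : (0 < m)%N.
Hypothesis rho_ge0 : forall t, 0 <= t -> 0 <= rho t.
Hypothesis T_meas : forall f, (forall i, in_L1 (f i)) ->
  measurable_fun [set: leb_mxType R 1 n] (T f) /\
  {ae (@lebesgue_mx R 1 n), forall x, T f x \is a fin_num}.
Hypothesis T_lin : multilinear T.
Hypothesis T_weak : weak_type CW T.
Hypothesis K_assoc : associated_kernel K T.
Hypothesis K_meas : kernel_measurable K.
Hypothesis K_size : kernel_size CK K.
Hypothesis K_smooth : kernel_smoothness rho CK K.
Variable f : 'I_m -> 'rV[R]_n -> R.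
Hypothesis f_L1 : forall i, in_L1 (f i).
Local Notation mu := (@lebesgue_mx R 1 n).
Local Notation cell := (int * 'rV[int]_n)%type.
Local Notation "''G_' i" := (cube_set (@grid_cube R n i)) (at level 8, i at level 2, format "''G_' i").
Local Notation TG i := (cube_set (triple (@grid_cube R n i))).
Implicit Types (i : cell) (x : 'rV[R]_n).

Definition local_T i := T (localized f (TG i)).

Definition cell_avg i (j : 'I_m) : R :=
  L1_norm (localize (TG i) (f j)) / (3 * 2 ^ i.1) ^+ n.

Local Notation weight := (cell_weight cell_avg).

Lemma cell_side_gt0 i : 0 < 3 * 2 ^ i.1 :> R.
Proof. by rewrite mulr_gt0// exprz_gt0. Qed.

Lemma cell_avg_ge0 i j : 0 <= cell_avg i j.
Proof. by rewrite divr_ge0 ?L1_norm_ge0// exprn_ge0// ltW// cell_side_gt0. Qed.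

Lemma weight_ge0 i : 0 <= weight i.
Proof. by apply: prodr_ge0 => j _; exact: cell_avg_ge0. Qed.

Lemma massE i : \prod_(j < m) L1_norm (localize (TG i) (f j)) =
  weight i * (3 * 2 ^ i.1) ^+ (n * m).
Proof.
rewrite /cell_weight big_split/= prodr_const card_ord exprM -mulrA exprVn mulVf ?mulr1//.
by rewrite !expf_neq0// gt_eqF// cell_side_gt0.
Qed.

(** Gathers the null sets of all pairs of cells. At a point of the smaller cell the premise of
    convergence follows from the size of the kernel. *)
Definition good x := lebesgue_measurable (K x) /\
  forall i i', TG i `<=` TG i' ->
   (forall k : 'I_m, in_L1 (fun y => K x y * tensor (hybrid f (TG i) (TG i') k) y)) ->
    fine (local_T i' x) - fine (local_T i x) =
    \sum_(k < m) \int[lebesgue_mx m n]_y (K x y * tensor (hybrid f (TG i) (TG i') k) y).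

Lemma ae_good : {ae mu, forall x, good x}.
Proof.
apply: ae_and; first exact: ae_kernel_measurable.
have H (ii : cell * cell) : {ae mu, forall x, TG ii.1 `<=` TG ii.2 ->
   (forall k : 'I_m, in_L1 (fun y => K x y * tensor (hybrid f (TG ii.1) (TG ii.2) k) y)) ->
    fine (local_T ii.2 x) - fine (local_T ii.1 x) =
    \sum_(k < m) \int[lebesgue_mx m n]_y
      (K x y * tensor (hybrid f (TG ii.1) (TG ii.2) k) y)}.
  have [sub|nsub] := pselect (TG ii.1 `<=` TG ii.2); last first.
    by apply: aeW => x /nsub.
  have := telescoping T_meas T_lin K_assoc f_L1 (measurable_cube (triple (grid_cube ii.1)))
    (measurable_cube (triple (grid_cube ii.2))) sub.
  by apply: ae_imply => x.
by apply: ae_imply (ae_forall_countable H) => x Hx i i'; exact: (Hx (i, i')).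
Qed.

Lemma grid_ancestor_subset i x k : 'G_i x -> i.1 <= k -> 'G_i `<=` 'G_(gidx k x).
Proof. by move=> ix ik; exact: grid_subset ix (gidx_in k x) ik. Qed.

Lemma good_difference x i k : good x -> 'G_i x -> i.1 <= k ->
  fine (local_T (gidx k x) x) - fine (local_T i x) =
    \sum_(j < m) \int[lebesgue_mx m n]_y
      (K x y * tensor (hybrid f (TG i) (TG (gidx k x)) j) y).
Proof.
move=> [mKx Tx] ix ik; have sub := grid_ancestor_subset ix ik.
apply: Tx; first exact: triple_subset.
by move=> j; have [] := hybrid_term K_size f_L1 j sub ix mKx.
Qed.

(** Off the triple of the cell the kernel is at most [CK] over the side to the power [n * m], and
    the triple of the parent has six times the side of the cell: hence [6 ^+ (n * m)]. *)
Lemma local_T_parent i x : good x -> 'G_i x ->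
  `|fine (local_T (gidx (i.1 + 1) x) x) - fine (local_T i x)| <=
    m%:R * `|CK| * 6 ^+ (n * m) * weight (gidx (i.1 + 1) x).
Proof.
move=> gx ix; have ik : i.1 <= i.1 + 1 by rewrite lerDl.
rewrite good_difference//; have sub := grid_ancestor_subset ix ik.
apply: le_trans (hybrid_sum K_size f_L1 sub ix gx.1) _.
rewrite massE side_grid_cube /= expfzDr// -[2 ^ 1]/(2 : R).
have s0 : (2 ^ i.1 : R) ^+ (n * m) != 0 by rewrite expf_neq0// gt_eqF// exprz_gt0.
have -> : 3 * (2 ^ i.1 * 2) = 6 * 2 ^ i.1 :> R by ring.
rewrite exprMn le_eqVlt; apply/orP; left; apply/eqP.
by field.
Qed.

(** The increment from generation [k + l] to [k + l + 1] compares two points of one cell of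
    generation [k], so smoothness applies with [t = 2 ^+ l.+1]. The kernel scale [2 ^ (k + l + 1)]
    is a third of the side of the triple that carries the mass, which leaves [3 ^+ (n * m)]. *)
Lemma local_T_oscillation k x x' N : good x -> good x' -> gidx k x = gidx k x' ->
  `|(fine (local_T (gidx (k + N%:Z) x) x) - fine (local_T (gidx k x) x)) -
    (fine (local_T (gidx (k + N%:Z) x) x') - fine (local_T (gidx k x) x'))| <=
  \sum_(l < N) m%:R * `|CK| * 3 ^+ (n * m) * rho (2 ^+ l.+1)^-1 *
    weight (gidx (k + l.+1%:Z) x).
Proof.
move=> gx gx' xx'; elim: N => [|N IH].
  by rewrite big_ord0 addr0 !subrr normr0.
have eqk l : gidx (k + l%:Z) x = gidx (k + l%:Z) x'.
  by apply: gidx_le xx'; rewrite lerDl.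
rewrite big_ord_recr /=.
set F := fine (local_T (gidx (k + N%:Z) x) x).
set F' := fine (local_T (gidx (k + N%:Z) x) x').
set H := fine (local_T (gidx (k + N.+1%:Z) x) x).
set H' := fine (local_T (gidx (k + N.+1%:Z) x) x').
set a := fine _; set a' := fine _.
have -> : H - a - (H' - a') = (F - a - (F' - a')) + ((H - F) - (H' - F')) by ring.
apply: le_trans (ler_normD _ _) _; apply: lerD; first exact: IH.
have iS : (gidx (k + N%:Z) x).1 <= k + N.+1%:Z by rewrite /= lerD2l lez_nat.
have x'N : 'G_(gidx (k + N%:Z) x) x' by rewrite eqk; exact: gidx_in.
rewrite /H /F (good_difference gx (gidx_in _ _) iS).
rewrite /H' /F' (eqk N.+1) (good_difference gx' x'N iS) -(eqk N.+1).
have x'0 : 'G_(gidx k x) x' by rewrite xx'; exact: gidx_in.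
have sub0 : 'G_(gidx k x) `<=` 'G_(gidx (k + N%:Z) x).
  by apply: grid_ancestor_subset (gidx_in _ _) _; rewrite /= lerDl.
have subN := grid_ancestor_subset (gidx_in (k + N%:Z) x) iS.
have t2 : 2 <= 2 ^+ N.+1 :> R by rewrite exprS ler_pMr// exprn_ege1// ler1n.
have tQ : 2 ^+ N.+1 * side (@grid_cube R n (gidx k x)) <=
    2 * side (@grid_cube R n (gidx (k + N%:Z) x)).
  by rewrite !side_grid_cube /= expfzDr// exprS -exprnP -mulrA ler_pM2l// mulrC.
have := hybrid_sum_diff rho_ge0 K_size K_smooth f_L1 sub0 subN (gidx_in _ _) x'0
  gx.1 gx'.1 t2 tQ.
move/le_trans; apply; rewrite massE side_grid_cube /= expfzDr// -exprnP.
have s0 : (2 ^ k : R) ^+ (n * m) != 0 by rewrite expf_neq0// gt_eqF// exprz_gt0.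
have s1 : ((2 : R) ^+ N.+1) ^+ (n * m) != 0 by rewrite !expf_neq0.
rewrite (mulnC m n) !exprMn le_eqVlt; apply/orP; left; apply/eqP.
move: (rho _) (weight _) s0 s1 => r w; move: (_ ^+ (n * m)) (_ ^+ (n * m)) (_ ^+ (n * m)) => c2 c3 c1 s0 s1.
by field; rewrite s0.
Qed.

Lemma measurable_local_T i : measurable_fun [set: leb_mxType R 1 n] (local_T i).
Proof.
by have [] := T_meas (fun j => localize_L1 (measurable_cube (triple (grid_cube i))) (f_L1 j)).
Qed.

Definition exceptional lam i : set (leb_mxType R 1 n) :=
  [set x | ((lam * weight i)%:E < `|local_T i x|)%E].

Lemma measurable_superlevel i (a : R) :
  measurable [set x : leb_mxType R 1 n | (a%:E < `|local_T i x|)%E].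
Proof.
rewrite (_ : [set _ | _] = (abse \o local_T i) @^-1` `]a%:E, +oo%E]).
  rewrite -[X in measurable X]setTI.
  by apply: measurableT_comp => //; [exact: measurable_local_T|exact: emeasurable_itv].
by apply/seteqP; split=> x /=; rewrite in_itv/= leey andbT.
Qed.

Lemma local_T_weak i (a : R) : 0 < a ->
  (mu [set x | (a%:E < `|local_T i x|)%E] <=
   (CW * (a^-1 * (weight i * (3 * 2 ^ i.1) ^+ (n * m))) `^ (m%:R^-1))%:E)%E.
Proof.
move=> a0; rewrite -massE; apply: T_weak => // j.
exact: (localize_L1 (measurable_cube (triple (grid_cube i)))).
Qed.

(* For this level the weak type bound [CW * 3 ^ n * lam ^ (-1 / m)] is at most
   [e]; the summand 1 keeps it positive. *)
Definition weak_level (e : R) : R := (`|CW| * 3 ^+ n / e + 1) ^+ m.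

Lemma exceptional_small (e : R) : 0 < e ->
  forall i, (mu (exceptional (weak_level e) i) <= (e * (2 ^ i.1) ^+ n)%:E)%E.
Proof.
move=> e0 i; rewrite /weak_level; set b := `|CW| * 3 ^+ n / e + 1.
have b0 : 0 < b by rewrite ltr_wpDl// divr_ge0 ?mulr_ge0 ?exprn_ge0// ltW.
have s0 : 0 < 2 ^ i.1 :> R by rewrite exprz_gt0.
have m0 : (m%:R : R)^-1 != 0 by rewrite invr_eq0 pnatr_eq0 -lt0n.
(* With weight 0 the level is 0, where the weak type bound is silent; the set is then a union of
   superlevel sets at the levels [k.+1%:R^-1], each of them null because the bound carries the
   factor 0 to the positive power [1 / m]. *)
have [w0|w0] := eqVneq (weight i) 0.
  have -> : exceptional (b ^+ m) i = \bigcup_(k : nat) [set x | ((k.+1%:R^-1)%:E < `|local_T i x|)%E].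
    apply/seteqP; split => x; rewrite /exceptional /= w0 mulr0.
      case E : (`|local_T i x|)%E => [r| |//]; last by exists 0%N => //=; rewrite E ltry.
      rewrite lte_fin => r0; exists (Num.truncn r^-1) => //=; rewrite E lte_fin.
      by rewrite invf_plt ?posrE ?ltr0n// truncnS_gt.
    by move=> [k _ /=]; apply: le_lt_trans; rewrite lee_fin.
  have -> : mu (\bigcup_(k : nat) [set x | ((k.+1%:R^-1)%:E < `|local_T i x|)%E]) = 0%E.
    apply: measure_negligible; first by apply: bigcupT_measurable => k; exact: measurable_superlevel.
    apply: negligible_bigcup => k; apply/negligibleP; first exact: measurable_superlevel.
    apply/eqP; rewrite eq_le measure_ge0 andbT.
    have := @local_T_weak i (k.+1%:R^-1); rewrite invr_gt0 ltr0n => /(_ isT).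
    by rewrite w0 mul0r mulr0 powR0// mulr0.
  by rewrite lee_fin mulr_ge0 ?exprn_ge0// ltW.
have wp : 0 < weight i by rewrite lt_neqAle eq_sym w0 weight_ge0.
apply: le_trans (local_T_weak _ _) _; first by rewrite mulr_gt0// exprn_gt0.
rewrite lee_fin.
have -> : (b ^+ m * weight i)^-1 * (weight i * (3 * 2 ^ i.1) ^+ (n * m)) =
    ((3 * 2 ^ i.1) ^+ n / b) ^+ m.
  rewrite exprM expr_div_n; move: ((3 * 2 ^ i.1) ^+ n) => c.
  have bm0 : b ^+ m != 0 by rewrite expf_neq0// gt_eqF.
  by field; rewrite w0 bm0.
have q0 : 0 <= (3 * 2 ^ i.1) ^+ n / b by rewrite divr_ge0 ?exprn_ge0 ?ltW// cell_side_gt0.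
rewrite -powR_mulrn// -powRrM divff ?pnatr_eq0 -?lt0n// powRr1//.
apply: (@le_trans _ _ (`|CW| * ((3 * 2 ^ i.1) ^+ n / b))).
  by rewrite ler_wpM2r// ler_norm.
rewrite exprMn.
have -> : `|CW| * (3 ^+ n * (2 ^ i.1) ^+ n / b) = `|CW| * 3 ^+ n / b * (2 ^ i.1) ^+ n by ring.
have S0 : 0 <= (2 ^ i.1 : R) ^+ n by rewrite exprn_ge0// ltW.
apply: ler_wpM2r => //; rewrite ler_pdivrMr// /b mulrDr mulr1.
by rewrite [e * _]mulrC divfK ?gt_eqF// lerDl ltW.
Qed.

End grid_oscillation.

(** * Finite families of sets *)

Section finite_families.
Context d (U : measurableType d) (R : realType) (mu : {measure set U -> \bar R}).
Local Open Scope ereal_scope.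

Lemma measure_big_union_le (I : Type) (s : seq I) (S : I -> set U) :
  (forall i, measurable (S i)) ->
  mu (\big[setU/set0]_(i <- s) S i) <= \sum_(i <- s) mu (S i).
Proof.
move=> mS; elim: s => [|i s IH]; first by rewrite !big_nil measure0.
rewrite !big_cons; apply: le_trans (measureU2 _ _ _) _ => //.
  exact: bigsetU_measurable.
exact: leeD.
Qed.

Lemma measure_big_union_disjoint (I : choiceType) (s : seq I) (S : I -> set U) :
  (forall i, measurable (S i)) -> uniq s ->
  (forall i j, i \in s -> j \in s -> i != j -> S i `&` S j = set0) ->
  mu (\big[setU/set0]_(i <- s) S i) = \sum_(i <- s) mu (S i).
Proof.
move=> mS; elim: s => [|i s IH] us dis; first by rewrite !big_nil measure0.
move: us => /= /andP[iNs us]; rewrite !big_cons measureU//=.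
- congr (_ + _); apply: IH => // j k js ks; apply: dis; by rewrite inE ?js ?ks orbT.
- exact: bigsetU_measurable.
- rewrite -subset0 => x [Six]; rewrite -bigcup_seq => -[j /= js Sjx].
  have ij : i != j by apply: contraNneq iNs => ->.
  have e : S i `&` S j = set0 by apply: dis => //; rewrite inE ?eqxx ?js ?orbT.
  by have : (S i `&` S j) x := conj Six Sjx; rewrite e.
Qed.

(** Continuity from below along the enumeration of [I]; it lets every packing estimate be proved for
    finite lists only. *)
Lemma measure_bigcup_le (I : countType) (X : set I) (S : I -> set U) (c : R) :
  (forall i, measurable (S i)) ->
  (forall s : seq I, uniq s -> (forall i, i \in s -> X i) ->
    \sum_(i <- s) mu (S i) <= c%:E) ->
  mu (\bigcup_(i in X) S i) <= c%:E.
Proof.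
move=> mS bound.
pose V N := \bigcup_(i in [set i | X i /\ (pickle i < N)%N]) S i.
have mV N : measurable (V N) by exact: measurable_bigcup_countable.
have VX : \bigcup_(i in X) S i = \bigcup_N V N.
  apply/seteqP; split=> x.
    by move=> [i Xi Six]; exists (pickle i).+1 => //; exists i.
  by move=> [N _ [i [Xi _] Six]]; exists i.
have ndV : nondecreasing_seq V.
  move=> N M NM; apply/subsetPset => x [i [Xi iN] Six]; exists i => //; split => //.
  exact: leq_trans NM.
have cv : mu \o V @ \oo --> mu (\bigcup_N V N).
  by apply: nondecreasing_cvg_mu => //; rewrite -VX; exact: measurable_bigcup_countable.
rewrite VX; apply: (cvge_to_le cv); apply: nearW => N /=.
pose s := undup [seq i <- pmap (@unpickle I) (iota 0 N) | `[< X i >]].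
have sX i : i \in s -> X i by rewrite mem_undup mem_filter => /andP[/asboolP].
apply: le_trans (bound s (undup_uniq _) sX).
apply: le_trans (measure_big_union_le s mS); apply: le_measure; rewrite ?inE//.
  exact: bigsetU_measurable.
move=> x [i [Xi iN] Six]; rewrite -bigcup_seq; exists i => //=.
rewrite mem_undup mem_filter; apply/andP; split; first exact/asboolP.
rewrite mem_pmap; apply/mapP; exists (pickle i); last by rewrite pickleK.
by rewrite mem_iota.
Qed.

End finite_families.

(** A set contained in a chosen one is dropped; otherwise it replaces the chosen sets that it meets,
    all of which it contains. *)
Lemma maximal_subfamily (T : Type) (I : eqType) (S : I -> set T) (s : seq I) :
  (forall i j, i \in s -> j \in s ->
    [\/ S i `<=` S j, S j `<=` S i | S i `&` S j = set0]) ->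
  exists t : seq I, [/\ uniq t, {subset t <= s},
    forall i j, i \in t -> j \in t -> i != j -> S i `&` S j = set0 &
    forall i, i \in s -> exists2 j, j \in t & S i `<=` S j].
Proof.
elim: s => [|i s IH] nest; first by exists [::]; split.
have [|t [ut ts dis cov]] := IH.
  by move=> j k js ks; apply: nest; rewrite inE ?js ?ks orbT.
have [[j jt ij]|nocov] := pselect (exists2 j, j \in t & S i `<=` S j).
  exists t; split => //; first by move=> k /ts kt; rewrite inE kt orbT.
  by move=> k; rewrite inE => /orP[/eqP->|/cov //]; exists j.
pose t' := [seq j <- t | `[< S i `&` S j = set0 >]].
have it' : i \notin t'.
  apply/negP; rewrite mem_filter => /andP[_ it]; apply: nocov; exists i => //.
exists (i :: t'); split.
- by rewrite /= it' filter_uniq.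
- move=> k; rewrite !inE mem_filter => /orP[->//|/andP[_ /ts ->]].
  by rewrite orbT.
- have dit j : j \in t' -> S i `&` S j = set0 by rewrite mem_filter => /andP[/asboolP].
  move=> j k; rewrite !inE => /orP[/eqP->|jt'] /orP[/eqP->|kt'] jk.
  + by rewrite eqxx in jk.
  + exact: dit.
  + by rewrite setIC; exact: dit.
  + by move: jt' kt'; rewrite !mem_filter => /andP[_ jt] /andP[_ kt]; exact: dis.
- move=> k; rewrite inE => /orP[/eqP->|/cov[j jt kj]].
    by exists i; rewrite ?inE ?eqxx.
  have [||sub|ji|ij0] := nest i j.
  + by rewrite inE eqxx.
  + by rewrite inE ts ?orbT.
  + by case: nocov; exists j.
  + by exists i; rewrite ?inE ?eqxx//; exact: subset_trans ji.
  + exists j => //.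
    by rewrite inE mem_filter jt andbT; apply/orP; right; exact/asboolP.
Qed.

Section esum_finite.
Context {R : realType} {I : choiceType}.
Local Open Scope ereal_scope.

Lemma esum_le_seq (X : set I) (a : I -> \bar R) (c : \bar R) :
  (forall s : seq I, uniq s -> (forall i, i \in s -> X i) -> \sum_(i <- s) a i <= c) ->
  \esum_(i in X) a i <= c.
Proof.
move=> bound; apply: ge_ereal_sup => _ [A [finA AX] <-].
rewrite fsbig_finite//=; apply: bound; first exact: finmap.fset_uniq.
by move=> i; rewrite in_fset_set// inE; exact: AX.
Qed.

Lemma esum_ge_seq (X : set I) (a : I -> \bar R) (s : seq I) :
  uniq s -> (forall i, i \in s -> X i) -> (forall i, 0 <= a i) ->
  \sum_(i <- s) a i <= \esum_(i in X) a i.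
Proof.
move=> us sX a0; apply: esum_ge; exists [set` s]; first by split => //; exact: finite_seq.
by rewrite -fsbig_seq.
Qed.

End esum_finite.

(** * Stopping cubes *)

Section stopping_cells.
Context {R : realType} {n m : nat}.
Local Notation mu := (@lebesgue_mx R 1 n).
Local Notation cell := (int * 'rV[int]_n)%type.
Local Notation "''G_' i" := (cube_set (@grid_cube R n i)) (at level 8, i at level 2, format "''G_' i").
Local Notation TG i := (cube_set (triple (@grid_cube R n i))).
Implicit Types (i P Q : cell) (x : 'rV[R]_n).

Definition cell_vol i : R := (2 ^ i.1) ^+ n.

Lemma cell_vol_gt0 i : 0 < cell_vol i.
Proof. by rewrite exprn_gt0// exprz_gt0. Qed.

Lemma measurable_cell i : measurable ('G_i : set (leb_mxType R 1 n)).
Proof. exact: measurable_cube. Qed.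

Lemma measurable_triple_cell i : measurable (TG i : set (leb_mxType R 1 n)).
Proof. exact: measurable_cube. Qed.

Lemma measure_cell i : mu 'G_i = (cell_vol i)%:E.
Proof. by have := volumeE (@grid_cube R n i); rewrite side_grid_cube. Qed.

Lemma measure_triple_cell i : mu (TG i) = (3 ^+ n * cell_vol i)%:E.
Proof.
have := volumeE (triple (@grid_cube R n i)).
rewrite -[side (triple _)]/(3 * side (@grid_cube R n i)) side_grid_cube exprMn.
exact.
Qed.

Lemma subset_cell_level P Q x : 'G_Q x -> 'G_P x -> Q.1 <= P.1 -> 'G_Q `<=` 'G_P.
Proof. exact: grid_subset. Qed.

Lemma cell_nested P Q : P.1 = Q.1 -> forall x, 'G_P x -> 'G_Q x -> P = Q.
Proof. by move=> PQ x /gridP <- /gridP <-; rewrite PQ. Qed.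

Variables (avg : cell -> 'I_m -> R) (U : cell -> set 'rV[R]_n).
Hypothesis m_gt0 : (0 < m)%N.
Hypothesis avg_ge0 : forall i j, 0 <= avg i j.
(** [avg i j * (3 ^+ n * cell_vol i)] stands for the mass of the [j]-th function over the triple of
    [i], so this expresses additivity and monotonicity of mass. *)
Hypothesis avg_super : forall P j (s : seq cell), uniq s ->
  (forall i, i \in s -> TG i `<=` TG P) ->
  (forall i i', i \in s -> i' \in s -> i != i' -> TG i `&` TG i' = set0) ->
  \sum_(i <- s) avg i j * (3 ^+ n * cell_vol i) <= avg P j * (3 ^+ n * cell_vol P).
Hypothesis U_open : forall P, grid_open (U P).
Hypothesis U_small : forall P,
  (mu (U P `&` 'G_P) <= (16^-1 * cell_vol P)%:E)%E.

(* Chosen so that the cubes with a large average of one of the [m] functions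
   fill at most [m * 9 ^ n / growth = 1 / 4] of the stopping cube: one factor
   [3 ^ n] is the number of lattices of triples, the other the volume of a
   triple. *)
Definition growth : R := 4 * m%:R * 9 ^+ n.

Lemma growth_ge1 : 1 <= growth.
Proof.
rewrite /growth; have h1 : 1 <= m%:R :> R by rewrite ler1n.
have h2 : 1 <= 9 ^+ n :> R by rewrite exprn_ege1// ler1n.
have h3 : m%:R <= m%:R * 9 ^+ n :> R by rewrite ler_peMr// ler0n.
by rewrite -mulrA; lra.
Qed.

Definition stopped P Q := ((4^-1 * cell_vol Q)%:E < mu (U P `&` 'G_Q))%E \/
  exists j, growth * avg P j < avg Q j.

Definition stopping_child P Q := [/\ Q.1 < P.1, 'G_Q `<=` 'G_P, stopped P Q &
  forall Q', Q.1 < Q'.1 -> Q'.1 < P.1 -> 'G_Q `<=` 'G_Q' -> ~ stopped P Q'].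

Lemma stopping_child_disjoint P Q Q' x : stopping_child P Q -> stopping_child P Q' ->
  'G_Q x -> 'G_Q' x -> Q = Q'.
Proof.
move=> [QP _ sQ maxQ] [Q'P _ sQ' maxQ'] Qx Q'x.
have [lt|lt|eq] := ltgtP Q.1 Q'.1.
- by case: (maxQ Q' lt Q'P _ sQ'); exact: subset_cell_level Qx Q'x (ltW lt).
- by case: (maxQ' Q lt QP _ sQ); exact: subset_cell_level Q'x Qx (ltW lt).
- exact: cell_nested eq _ Qx Q'x.
Qed.

Lemma measurable_UI P (A : set (leb_mxType R 1 n)) : measurable A ->
  measurable (U P `&` A : set (leb_mxType R 1 n)).
Proof.
by move=> mA; apply: measurableI => //; apply: measurable_leb; exact: measurable_grid_open.
Qed.

Lemma sum_vol_meas (s : seq cell) : uniq s ->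
  (forall i i', i \in s -> i' \in s -> i != i' -> 'G_i `&` 'G_i' = set0) ->
  (\sum_(i <- s) cell_vol i)%:E = mu (\big[setU/set0]_(i <- s) 'G_i).
Proof.
move=> us dis; rewrite measure_big_union_disjoint//; last exact: measurable_cell.
by rewrite -sumEFin; apply: eq_bigr => i _; exact/esym/measure_cell.
Qed.

Lemma dense_cells_sum P (s : seq cell) : uniq s ->
  (forall i i', i \in s -> i' \in s -> i != i' -> 'G_i `&` 'G_i' = set0) ->
  (forall Q, Q \in s -> 'G_Q `<=` 'G_P /\
    ((4^-1 * cell_vol Q)%:E < mu (U P `&` 'G_Q))%E) ->
  \sum_(Q <- s) cell_vol Q <= 4^-1 * cell_vol P.
Proof.
move=> us dis dense.
have mUG i := measurable_UI P (measurable_cell i).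
have le1 : ((4^-1 * \sum_(Q <- s) cell_vol Q)%:E <= (16^-1 * cell_vol P)%:E)%E.
  rewrite mulr_sumr; apply: le_trans (U_small P).
  apply: (@le_trans _ _ (mu (\big[setU/set0]_(Q <- s) (U P `&` 'G_Q)))).
    rewrite measure_big_union_disjoint//; last first.
      by move=> i j iS jS ij; rewrite setIACA dis// setI0.
    rewrite -sumEFin big_seq [leRHS]big_seq; apply: lee_sum => Q Qs.
    by apply: ltW; have [] := dense Q Qs.
  apply: le_measure; rewrite ?inE//; first exact: bigsetU_measurable.
  move=> x; rewrite -bigcup_seq => -[Q /= Qs [Ux Qx]]; split => //.
  by have [sub _] := dense Q Qs; exact: sub.
by move: le1; rewrite lee_fin => le1; lra.
Qed.

(** Triples of disjoint cells overlap, but within one lattice they are nested or disjoint. The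
    maximal ones are disjoint, so their masses add up, and they still cover all the cells. *)
Lemma big_average_sum_class P j (g : {ffun 'I_n -> 'I_3}) (s : seq cell) : uniq s ->
  (forall i i', i \in s -> i' \in s -> i != i' -> 'G_i `&` 'G_i' = set0) ->
  (forall Q, Q \in s -> 'G_Q `<=` 'G_P /\ growth * avg P j < avg Q j) ->
  (forall Q, Q \in s -> exists i', triple (@grid_cube R n Q) = triple_cube g i') ->
  growth * \sum_(Q <- s) cell_vol Q <= 3 ^+ n * cell_vol P.
Proof.
move=> us dis dense cls.
have TQP Q : Q \in s -> TG Q `<=` TG P.
  by move=> /dense[sub _]; exact: triple_subset.
have v3 Q : 0 < 3 ^+ n * cell_vol Q :> R by rewrite mulr_gt0 ?cell_vol_gt0// exprn_gt0.
have g0 : 0 < growth by exact: lt_le_trans growth_ge1.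
have nest Q Q' : Q \in s -> Q' \in s ->
    [\/ TG Q `<=` TG Q', TG Q' `<=` TG Q | TG Q `&` TG Q' = set0].
  by move=> /cls[i ->] /cls[i' ->]; apply: lcube_nested; exact: triple_refine.
have [t [ut ts dist cov]] := maximal_subfamily nest.
have [s0|[Q0 Q0s]] : s = [::] \/ exists Q0, Q0 \in s.
- by case: (s) => [|a l]; [left|right; exists a; rewrite inE eqxx].
- by rewrite s0 big_nil mulr0 ltW.
(* The selection inequality is about to be divided by this average; it is positive because the
   strict inequality makes the average on [Q0] positive. *)
have avgP0 : 0 < avg P j.
  have aQ0 : 0 < avg Q0 j.
    by have [_] := dense _ Q0s; apply: le_lt_trans; rewrite mulr_ge0// ltW.
  have := @avg_super P j [:: Q0] isT; rewrite big_seq1.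
  move=> /(_ _ _) H; have {}H : avg Q0 j * (3 ^+ n * cell_vol Q0) <= avg P j * (3 ^+ n * cell_vol P).
    apply: H; first by move=> i; rewrite inE => /eqP->; exact: TQP.
    by move=> i i'; rewrite !inE => /eqP-> /eqP->; rewrite eqxx.
  have := lt_le_trans (mulr_gt0 aQ0 (v3 Q0)) H.
  by rewrite pmulr_lgt0.
have sumt : growth * \sum_(Q <- t) (3 ^+ n * cell_vol Q) <= 3 ^+ n * cell_vol P.
  rewrite -(ler_pM2l avgP0); apply: le_trans (@avg_super P j t ut _ dist); last first.
    by move=> i /ts; exact: TQP.
  rewrite !mulr_sumr big_seq [leRHS]big_seq; apply: ler_sum => Q /ts/dense[_ dQ].
  by rewrite [avg P j * (growth * _)]mulrA ler_wpM2r ?(ltW (v3 Q))// mulrC ltW.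
apply: le_trans sumt; rewrite ler_pM2l// -lee_fin sum_vol_meas//.
have -> : (\sum_(Q <- t) (3 ^+ n * cell_vol Q))%:E = (\sum_(Q <- t) mu (TG Q))%E.
  by rewrite -sumEFin; apply: eq_bigr => Q _; exact/esym/measure_triple_cell.
apply: le_trans (measure_big_union_le _ _ _); last exact: measurable_triple_cell.
apply: le_measure; rewrite ?inE.
- by apply: bigsetU_measurable => i _; exact: measurable_cell.
- by apply: bigsetU_measurable => i _; exact: measurable_triple_cell.
move=> x; rewrite -!bigcup_seq => -[Q /= Qs Qx]; have [Q' Q't sub] := cov Q Qs.
by exists Q' => //; apply: sub; exact: cube_subset_triple.
Qed.

Lemma big_average_sum P j (s : seq cell) : uniq s ->
  (forall i i', i \in s -> i' \in s -> i != i' -> 'G_i `&` 'G_i' = set0) ->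
  (forall Q, Q \in s -> 'G_Q `<=` 'G_P /\ growth * avg P j < avg Q j) ->
  growth * \sum_(Q <- s) cell_vol Q <= 9 ^+ n * cell_vol P.
Proof.
move=> us dis dense.
pose c Q g := `[< exists i', triple (@grid_cube R n Q) = triple_cube g i' >].
have cP Q : exists g, c Q g.
  by have [g [i' e]] := @triple_grid_cube R n Q; exists g; apply/asboolP; exists i'.
have g0 : 0 <= growth by apply: le_trans growth_ge1.
apply: (@le_trans _ _ (\sum_(g : {ffun 'I_n -> 'I_3})
    growth * \sum_(Q <- [seq Q <- s | c Q g]) cell_vol Q)).
  rewrite -mulr_sumr ler_wpM2l//.
  under [leRHS]eq_bigr do rewrite big_filter big_mkcond.
  rewrite exchange_big /=; apply: ler_sum => Q _; have [g gQ] := cP Q.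
  rewrite (bigD1 g)//= gQ lerDl sumr_ge0// => h _; case: ifP => // _.
  exact/ltW/cell_vol_gt0.
apply: (@le_trans _ _ (\sum_(g : {ffun 'I_n -> 'I_3}) 3 ^+ n * cell_vol P)).
  apply: ler_sum => g _; apply: (@big_average_sum_class P j g).
  - by rewrite filter_uniq.
  - by move=> i i'; rewrite !mem_filter => /andP[_ ?] /andP[_ ?]; exact: dis.
  - by move=> Q; rewrite mem_filter => /andP[_ ?]; exact: dense.
  - by move=> Q; rewrite mem_filter => /andP[/asboolP].
rewrite sumr_const card_ffun !card_ord -[leLHS]mulr_natl mulrA natrX -exprMn.
by rewrite le_eqVlt; apply/orP; left; apply/eqP; congr (_ ^+ _ * _); ring.
Qed.

Lemma stopping_children_sum P (s : seq cell) : uniq s ->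
  (forall Q, Q \in s -> stopping_child P Q) ->
  \sum_(Q <- s) cell_vol Q <= 2^-1 * cell_vol P.
Proof.
move=> us ch.
have dis i i' : i \in s -> i' \in s -> i != i' -> 'G_i `&` 'G_i' = set0.
  move=> /ch ci /ch ci' ii'; apply/seteqP; split => // x [ix i'x].
  by move: ii'; rewrite (stopping_child_disjoint ci ci' ix i'x) eqxx.
pose a Q := `[< ((4^-1 * cell_vol Q)%:E < mu (U P `&` 'G_Q))%E >].
pose b j Q := growth * avg P j < avg Q j.
have v0 Q : 0 <= cell_vol Q by exact/ltW/cell_vol_gt0.
have filt (p : pred cell) : (forall Q, p Q -> Q \in s -> True) ->
  [/\ uniq [seq Q <- s | p Q] & forall i i', i \in [seq Q <- s | p Q] ->
    i' \in [seq Q <- s | p Q] -> i != i' -> 'G_i `&` 'G_i' = set0].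
  move=> _; split; first exact: filter_uniq.
  by move=> i i'; rewrite !mem_filter => /andP[_ ?] /andP[_ ?]; exact: dis.
apply: (@le_trans _ _ (\sum_(Q <- [seq Q <- s | a Q]) cell_vol Q +
    \sum_(j < m) \sum_(Q <- [seq Q <- s | b j Q]) cell_vol Q)).
  under [X in _ + X]eq_bigr do rewrite big_filter big_mkcond.
  rewrite big_filter exchange_big /= [X in X + _]big_mkcond -big_split /=.
  rewrite big_seq [leRHS]big_seq; apply: ler_sum => Q Qs.
  have p0 j : 0 <= if b j Q then cell_vol Q else 0 by case: ifP.
  have [_ _ [dQ|[j bj]] _] := ch Q Qs.
    by rewrite /a asboolT// lerDl sumr_ge0.
  have bjT : b j Q = true := bj.
  rewrite (bigD1 j)//= bjT addrCA lerDl addr_ge0 ?sumr_ge0//.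
  by case: ifP.
have g0 : 0 < growth by exact: lt_le_trans growth_ge1.
have ha : \sum_(Q <- [seq Q <- s | a Q]) cell_vol Q <= 4^-1 * cell_vol P.
  have [uf df] := filt a (fun _ _ _ => I); apply: dense_cells_sum => // Q.
  by rewrite mem_filter => /andP[/asboolP ? /ch[]].
have hb : \sum_(j < m) \sum_(Q <- [seq Q <- s | b j Q]) cell_vol Q <= 4^-1 * cell_vol P.
  apply: (@le_trans _ _ (\sum_(j < m) 9 ^+ n * cell_vol P / growth)).
    apply: ler_sum => j _; rewrite ler_pdivlMr// mulrC.
    have [uf df] := filt (b j) (fun _ _ _ => I); apply: (@big_average_sum P j) => // Q.
    by rewrite mem_filter => /andP[? /ch[]].
  rewrite sumr_const card_ord -[leLHS]mulr_natl /growth le_eqVlt; apply/orP; left; apply/eqP.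
  by field; rewrite expf_neq0// pnatr_eq0 -lt0n m_gt0.
by apply: le_trans (lerD ha hb) _; lra.
Qed.

End stopping_cells.

(** * The sparse family *)

Section sparse_family.
Context {R : realType} {n m : nat}.
Local Notation mu := (@lebesgue_mx R 1 n).
Local Notation cell := (int * 'rV[int]_n)%type.
Local Notation "''G_' i" := (cube_set (@grid_cube R n i)) (at level 8, i at level 2, format "''G_' i").
Local Notation TG i := (cube_set (triple (@grid_cube R n i))).
Local Notation vol := (@cell_vol R n).
Implicit Types (i P Q : cell) (x : 'rV[R]_n).

Variables (avg : cell -> 'I_m -> R) (U : cell -> set 'rV[R]_n).
Hypothesis m_gt0 : (0 < m)%N.
Hypothesis avg_ge0 : forall i j, 0 <= avg i j.
Hypothesis avg_super : forall P j (s : seq cell), uniq s ->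
  (forall i, i \in s -> TG i `<=` TG P) ->
  (forall i i', i \in s -> i' \in s -> i != i' -> TG i `&` TG i' = set0) ->
  \sum_(i <- s) avg i j * (3 ^+ n * vol i) <= avg P j * (3 ^+ n * vol P).
Hypothesis U_open : forall P, grid_open (U P).
Hypothesis U_small : forall P,
  (mu (U P `&` 'G_P) <= (16^-1 * vol P)%:E)%E.

Local Notation growth := (@growth R n m).
Local Notation stopped := (stopped avg U).
Local Notation child := (stopping_child avg U).

Let v0 i : 0 < vol i := cell_vol_gt0 i.

Lemma stopping_children_measure P :
  (mu (\bigcup_(Q in child P) 'G_Q) <= (2^-1 * vol P)%:E)%E.
Proof.
apply: measure_bigcup_le => [i|s us sch]; first exact: measurable_cell.
rewrite (eq_bigr (fun Q => (vol Q)%:E)) => [|Q _]; last exact: measure_cell.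
by rewrite sumEFin lee_fin; exact: (stopping_children_sum m_gt0 avg_ge0 avg_super U_open U_small).
Qed.

Fixpoint generation (N : nat) P : set cell :=
  if N is N'.+1 then [set Q | exists2 P', child P P' & generation N' P' Q]
  else [set P].

Lemma generation_subset N P Q : generation N P Q -> 'G_Q `<=` 'G_P /\ Q.1 <= P.1.
Proof.
elim: N P => [|N IH] P /=; first by move=> ->; split.
move=> [P' [P'P sub _ _] /IH[sub' le]]; split; first exact: subset_trans sub.
exact: le_trans le (ltW P'P).
Qed.

Lemma generation_measure N P :
  (mu (\bigcup_(Q in generation N P) 'G_Q) <= (vol P / 2 ^+ N)%:E)%E.
Proof.
elim: N P => [|N IH] P; first by rewrite /= bigcup_set1 expr0 divr1 measure_cell lexx.
rewrite (_ : \bigcup_(Q in _) _ =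
    \bigcup_(P' in child P) \bigcup_(Q in generation N P') 'G_Q); last first.
  apply/seteqP; split=> x.
    by move=> [Q [P' PP' P'Q] Qx]; exists P' => //; exists Q.
  by move=> [P' PP' [Q P'Q Qx]]; exists Q => //; exists P'.
apply: measure_bigcup_le => [i|s us sch].
  by apply: measurable_bigcup_countable => ? _; exact: measurable_cell.
apply: (@le_trans _ _ (\sum_(Q <- s) (vol Q / 2 ^+ N)%:E)%E).
  by apply: lee_sum => Q _; exact: IH.
rewrite sumEFin lee_fin -mulr_suml exprS invfM mulrA ler_wpM2r ?invr_ge0 ?exprn_ge0//.
rewrite mulrC; exact: (stopping_children_sum m_gt0 avg_ge0 avg_super U_open U_small).
Qed.

Lemma generation_limit P : mu.-negligible
  (\bigcap_N \bigcup_(Q in generation N P) 'G_Q).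
Proof.
have mg N : measurable (\bigcup_(Q in generation N P) 'G_Q : set (leb_mxType R 1 n)).
  by apply: measurable_bigcup_countable => ? _; exact: measurable_cell.
have mI : measurable (\bigcap_N \bigcup_(Q in generation N P) 'G_Q : set (leb_mxType R 1 n)).
  exact: bigcapT_measurable.
apply/negligibleP => //; apply/eqP; rewrite eq_le measure_ge0 andbT.
apply/lee_addgt0Pr => e e0; rewrite add0e.
pose N := Num.truncn (vol P / e).
apply: (@le_trans _ _ (mu (\bigcup_(Q in generation N P) 'G_Q))).
  by apply: le_measure; rewrite ?inE//; exact: bigcap_inf.
apply: le_trans (generation_measure _ _) _; rewrite lee_fin.
rewrite ler_pdivrMr ?exprn_gt0// mulrC -ler_pdivrMr//.
apply: ltW; apply: lt_le_trans (truncnS_gt _) _.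
by rewrite -/N -natrX ler_nat ltn_expl.
Qed.

(** Stopping children of one cell are disjoint, so the two lines of descent through [x] coincide
    until one of the cells is reached; the other then descends through a stopping child of it. *)
Lemma generation_separated a b P Q Q' x : generation a P Q -> generation b P Q' ->
  'G_Q x -> 'G_Q' x -> Q != Q' ->
  (\bigcup_(Z in child Q) 'G_Z) x \/ (\bigcup_(Z in child Q') 'G_Z) x.
Proof.
elim: a P b => [|a IH] P [|b] /=.
- by move=> -> ->; rewrite eqxx.
- move=> -> [P' cP' /generation_subset[sub _]] _ Q'x _.
  by left; exists P' => //; exact: sub.
- move=> [P' cP' /generation_subset[sub _]] -> Qx _ _.
  by right; exists P' => //; exact: sub.
- move=> [P1 c1 g1] [P2 c2 g2] Qx Q'x.
  have P1x := (generation_subset g1).1 _ Qx.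
  have P2x := (generation_subset g2).1 _ Q'x.
  have e := stopping_child_disjoint c1 c2 P1x P2x.
  by rewrite -e in g2; exact: IH g1 g2 Qx Q'x.
Qed.

Variable root : set cell.
Hypothesis root_disjoint : forall P P' x, root P -> root P' ->
  'G_P x -> 'G_P' x -> P = P'.

Definition family : set cell := [set Q | exists2 P, root P & exists N, generation N P Q].

(** The major subset of [Q] that witnesses sparseness: it keeps half of the measure of [Q], and the
    cores of distinct members are disjoint. *)
Definition core Q : set (leb_mxType R 1 n) := 'G_Q `\` \bigcup_(Z in child Q) 'G_Z.

Lemma measurable_core Q : measurable (core Q).
Proof.
apply: measurableD; first exact: measurable_cell.
by apply: measurable_bigcup_countable => ? _; exact: measurable_cell.
Qed.

Lemma core_measure Q : ((2^-1 * vol Q)%:E <= mu (core Q))%E.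
Proof.
have mB : measurable (\bigcup_(Z in child Q) 'G_Z : set (leb_mxType R 1 n)).
  by apply: measurable_bigcup_countable => ? _; exact: measurable_cell.
have le : ((vol Q)%:E <= mu (core Q) + (2^-1 * vol Q)%:E)%E.
  rewrite -measure_cell; apply: (@le_trans _ _ (mu (core Q `|` \bigcup_(Z in child Q) 'G_Z))).
    apply: le_measure; rewrite ?inE.
    - exact: measurable_cell.
    - by apply: measurableU => //; exact: measurable_core.
    - by move=> x Qx; have [|] := pselect ((\bigcup_(Z in child Q) 'G_Z) x); [right|left].
  apply: le_trans (measureU2 _ (measurable_core Q) mB) _.
  by apply: leeD => //; exact: stopping_children_measure.
move: le; rewrite -leeBlDr// -EFinB; apply: le_trans.
by rewrite lee_fin; lra.
Qed.

Lemma core_disjoint Q Q' : family Q -> family Q' -> Q != Q' ->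
  core Q `&` core Q' = set0.
Proof.
move=> [P rP [a ga]] [P' rP' [b gb]] QQ'; apply/seteqP; split => // x [[Qx nQ] [Q'x nQ']].
have PP' : P = P'.
  apply: (root_disjoint rP rP' (x := x)).
    exact: (generation_subset ga).1.
  exact: (generation_subset gb).1.
rewrite -PP' in gb.
by case: (generation_separated ga gb Qx Q'x QQ').
Qed.

(** The constant is the inverse of the proportion 1/2 kept by the cores. [A] is any measurable set,
    since it will be a cube of a lattice of triples and not a grid cell. *)
Lemma family_carleson (A : set (leb_mxType R 1 n)) (s : seq cell) : measurable A ->
  uniq s -> (forall i, i \in s -> family i /\ 'G_i `<=` A) ->
  ((\sum_(i <- s) vol i)%:E <= 2%:E * mu A)%E.
Proof.
move=> mA us sF.
have le : ((2^-1)%:E * (\sum_(i <- s) vol i)%:E <= mu A)%E.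
  rewrite -EFinM mulr_sumr.
  apply: (@le_trans _ _ (mu (\big[setU/set0]_(i <- s) core i))).
    rewrite measure_big_union_disjoint//; last 2 first.
    - exact: measurable_core.
    - by move=> i j /sF[? _] /sF[? _]; exact: core_disjoint.
    by rewrite -sumEFin; apply: lee_sum => i _; exact: core_measure.
  apply: le_measure; rewrite ?inE//.
    by apply: bigsetU_measurable => i _; exact: measurable_core.
  move=> x; rewrite -bigcup_seq => -[i /= iS [Gi _]].
  by have [_] := sF i iS; exact.
have := lee_wpmul2l (_ : (0 <= 2%:E)%E) le; rewrite -!EFinM mulrA divff// mul1r.
by apply; rewrite lee_fin.
Qed.

(** [F i] stands for [T] applied to the functions restricted to the triple of [i], [exc i] for the
    set where this exceeds [lam] times the weight, and [c l] for the coefficient of the oscillation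
    [l + 1] generations up. *)
Variables (F : cell -> 'rV[R]_n -> R) (good : 'rV[R]_n -> Prop).
Variables (exc : cell -> set (leb_mxType R 1 n)) (lam sg c6 : R) (c : nat -> R).
Hypothesis good_ae : {ae mu, forall x, good x}.
Hypothesis exc_meas : forall i, measurable (exc i).
Hypothesis exc_small : forall i, (mu (exc i) <= (32^-1 * vol i)%:E)%E.
Hypothesis exc_U : forall P x, 'G_P x -> exc P x -> U P x.
Hypothesis F_small : forall i x, ~ exc i x -> `|F i x| <= lam * cell_weight avg i.
Hypothesis F_parent : forall i x, good x -> 'G_i x ->
  `|F (gidx (i.1 + 1) x) x - F i x| <= c6 * cell_weight avg (gidx (i.1 + 1) x).
Hypothesis F_osc : forall k x x' N, good x -> good x' -> gidx k x = gidx k x' ->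
  `|(F (gidx (k + N%:Z) x) x - F (gidx k x) x) -
    (F (gidx (k + N%:Z) x) x' - F (gidx k x) x')| <=
  \sum_(l < N) c l * cell_weight avg (gidx (k + l.+1%:Z) x).
Hypothesis c_ge0 : forall l, 0 <= c l.
Hypothesis c_sum : forall N, \sum_(l < N) c l <= sg.
Hypothesis lam_ge0 : 0 <= lam.
Hypothesis c6_ge0 : 0 <= c6.

Let w0 i : 0 <= cell_weight avg i.
Proof. by apply: prodr_ge0 => j _; exact: avg_ge0. Qed.

Definition near_top P Q := (mu (U P `&` 'G_Q) <= (4^-1 * vol Q)%:E)%E /\
  forall j, avg Q j <= growth * avg P j.

Lemma unstopped_near P Q : ~ stopped P Q -> near_top P Q.
Proof.
move=> /not_orP[h1 h2]; split; first by rewrite leNgt; exact/negP.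
by move=> j; rewrite leNgt; apply/negP => h; apply: h2; exists j.
Qed.

Lemma near_top_refl P : near_top P P.
Proof.
split; first by apply: le_trans (U_small P) _; rewrite lee_fin; have := v0 P; lra.
by move=> j; rewrite ler_peMl// growth_ge1.
Qed.

Lemma near_weight P Q : near_top P Q -> cell_weight avg Q <= growth ^+ m * cell_weight avg P.
Proof.
move=> [_ le]; apply: (@le_trans _ _ (\prod_(j < m) (growth * avg P j))).
  by apply: ler_prod => j _; rewrite avg_ge0 le.
by rewrite big_split/= prodr_const card_ord.
Qed.

(** The hull fills at most 1/4 of [Q], the exceptional set 1/32, and the bad points are null:
    together they cannot cover [Q]. *)
Lemma good_point_exists P Q : near_top P Q ->
  exists x, [/\ good x, 'G_Q x, ~ U P x & ~ exc Q x].
Proof.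
move=> [le _]; apply: contrapT => no.
have [N [mN N0 gN]] := good_ae.
have N0' : (mu N <= 0)%E by rewrite N0.
have mUG : measurable (U P `&` 'G_Q : set (leb_mxType R 1 n)).
  apply: (@measurable_UI _ _ U U_open P 'G_Q); exact: measurable_cell.
have : ((vol Q)%:E <= (4^-1 * vol Q)%:E + ((32^-1 * vol Q)%:E + 0))%E.
  rewrite -measure_cell; apply: (@le_trans _ _ (mu ((U P `&` 'G_Q) `|` (exc Q `|` N)))).
    apply: le_measure; rewrite ?inE.
    - exact: measurable_cell.
    - by apply: measurableU => //; exact: measurableU.
    move=> x Qx; have [Ux|nU] := pselect (U P x); first by left.
    right; have [ex|ne] := pselect (exc Q x); [by left|right].
    by apply: gN => gx; apply: no; exists x.
  apply: le_trans (measureU2 _ _ _) _ => //; first exact: measurableU.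
  apply: leeD => //; apply: le_trans (measureU2 _ _ _) _ => //.
  by apply: leeD; [exact: exc_small|exact: N0'].
by rewrite adde0 -EFinD lee_fin; have := v0 Q; lra.
Qed.

(* [F P - F Q] is controlled at the good point [x'], hence at [x] by the
   oscillation bound. *)
Lemma near_estimate P x k : good x -> 'G_P x -> k <= P.1 ->
  (forall l, k <= l <= P.1 -> near_top P (gidx l x)) ->
  `|F P x - F (gidx k x) x| <= (lam + (lam + sg) * growth ^+ m) * cell_weight avg P.
Proof.
move=> gx Px kP near.
have nk : near_top P (gidx k x) by apply: near; rewrite lexx.
have [x' [gx' Qx' nU' ne']] := good_point_exists nk.
have kx : gidx k x = gidx k x' by apply/esym; move/gridP: Qx'.
pose N := `|P.1 - k|%N; have NE : k + N%:Z = P.1.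
  by rewrite /N gez0_abs ?subr_ge0// addrCA subrr addr0.
have PE : gidx P.1 x = P by exact/gridP.
have Px' : 'G_P x'.
  apply/gridP; rewrite -[RHS]PE; apply/esym; exact: gidx_le kP kx.
have := F_osc N gx gx' kx; rewrite NE PE => osc.
have g0 : 0 <= growth ^+ m by rewrite exprn_ge0// (le_trans ler01)// growth_ge1.
have wP := w0 P.
have sum : \sum_(l < N) c l * cell_weight avg (gidx (k + l.+1%:Z) x) <=
    sg * (growth ^+ m * cell_weight avg P).
  apply: (@le_trans _ _ (\sum_(l < N) c l * (growth ^+ m * cell_weight avg P))).
    apply: ler_sum => l _; rewrite ler_wpM2l//; apply: near_weight; apply: near.
    by rewrite lerDl/= -NE lerD2l lez_nat ltn_ord.
  by rewrite -mulr_suml ler_wpM2r// mulr_ge0.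
have h1 : `|F P x'| <= lam * cell_weight avg P.
  by apply: F_small => eP; apply: nU'; exact: exc_U eP.
have h2 : `|F (gidx k x) x'| <= lam * (growth ^+ m * cell_weight avg P).
  by apply: le_trans (F_small ne') _; rewrite ler_wpM2l// near_weight.
have := le_trans osc sum; move: h1 h2.
rewrite !ler_norml => /andP[? ?] /andP[? ?] /andP[? ?].
by apply/andP; split; lra.
Qed.

Definition local_constant : R :=
  lam + (lam + sg) * growth ^+ m + c6 * growth ^+ m.

Let sg_ge0 : 0 <= sg.
Proof. by have := c_sum 0; rewrite big_ord0. Qed.

Let g0 : 0 <= growth ^+ m.
Proof. by rewrite exprn_ge0// (le_trans ler01)// growth_ge1. Qed.

(** [near_estimate] reaches only the parent of [Q], since the averages on the stopped cell [Q] are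
    out of control; the last step down involves the weight of the parent alone. *)
Lemma child_estimate P Q x : good x -> child P Q -> 'G_Q x ->
  `|F P x| <= local_constant * cell_weight avg P + `|F Q x|.
Proof.
move=> gx [QP sub _ maxQ] Qx; have Px := sub _ Qx.
have QE : gidx Q.1 x = Q by exact/gridP.
have near l : Q.1 + 1 <= l <= P.1 -> near_top P (gidx l x).
  move=> /andP[Ql]; rewrite le_eqVlt => /orP[/eqP->|lP].
    by rewrite (_ : gidx _ _ = P); [exact: near_top_refl|exact/gridP].
  have Ql' : Q.1 < l by rewrite -lezD1.
  apply: unstopped_near; apply: maxQ => //.
  by apply: subset_cell_level Qx (gidx_in _ _) _; exact: ltW.
have kP : Q.1 + 1 <= P.1 by rewrite lezD1.
have e1 := near_estimate gx Px kP near.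
have e2 := F_parent gx Qx.
have wn : cell_weight avg (gidx (Q.1 + 1) x) <= growth ^+ m * cell_weight avg P.
  by apply: near_weight; apply: near; rewrite lexx.
have e3 : c6 * cell_weight avg (gidx (Q.1 + 1) x) <= c6 * (growth ^+ m * cell_weight avg P).
  by rewrite ler_wpM2l.
have tri : `|F P x| <= `|F P x - F (gidx (Q.1 + 1) x) x| +
    `|F (gidx (Q.1 + 1) x) x - F Q x| + `|F Q x|.
  set y := F (gidx _ _) _.
  have e : F P x = (F P x - y + (y - F Q x)) + F Q x by ring.
  rewrite {1}e; apply: le_trans (ler_normD _ _) _; rewrite lerD2r.
  exact: ler_normD.
by rewrite /local_constant; lra.
Qed.

(** No cell below [P] around [x] is stopped, as the largest such cell would be a stopping child.
    Hence [x] is outside [U P], and the weak type level bounds [F P x] directly. *)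
Lemma leaf_estimate P x : 'G_P x -> ~ (\bigcup_(Q in child P) 'G_Q) x ->
  `|F P x| <= local_constant * cell_weight avg P.
Proof.
move=> Px nch; have PE : gidx P.1 x = P by exact/gridP.
have unst l : l < P.1 -> ~ stopped P (gidx l x).
  move=> lP st; apply: nch.
  (* [d] counts generations downwards from [P.1 - 1], so the least [d] gives the largest stopped
     cell. *)
  pose B d := `[< stopped P (gidx (P.1 - 1 - d%:Z) x) >].
  have exB : exists d, B d.
    exists (absz (P.1 - 1 - l)%R); apply/asboolP; rewrite gez0_abs; last by lia.
    by rewrite (_ : _ - _ = l)//; lia.
  have [d /asboolP Bd mind] := ex_minnP exB.
  exists (gidx (P.1 - 1 - d%:Z) x); last exact: gidx_in.
  split => //=; first by lia.
    by apply: subset_cell_level (gidx_in _ _) Px _ => /=; lia.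
  move=> Q' dQ' Q'P sub; have Q'x := sub _ (gidx_in _ x).
  have <- : gidx Q'.1 x = Q' by exact/gridP.
  move=> sQ'; have : B (absz (P.1 - 1 - Q'.1)%R).
    apply/asboolP; rewrite gez0_abs; last by lia.
    by rewrite (_ : _ - _ = Q'.1)//; lia.
  by move/mind; lia.
(* A cell around [x] inside [U P] is filled completely: below [P] it would be stopped, and otherwise
   it contains [P], of which [U P] fills at most 1/16. *)
have nU : ~ U P x.
  move=> /(U_open)[k kU].
  have full i : 'G_i `<=` U P -> mu (U P `&` 'G_i) = (vol i)%:E.
    by move=> sub; rewrite setIidr// measure_cell.
  have [kP|Pk] := ltP k P.1.
    apply: (unst k kP); left; rewrite full// lte_fin.
    by have := v0 (gidx k x); lra.
  have sub : 'G_P `<=` U P.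
    by apply: subset_trans kU; apply: subset_cell_level Px (gidx_in _ _) Pk.
  by have := U_small P; rewrite full// lee_fin; have := v0 P; lra.
have := F_small (fun e : exc P x => nU (exc_U Px e)).
move/le_trans; apply; rewrite ler_wpM2r// /local_constant -addrA lerDl.
by rewrite addr_ge0 ?mulr_ge0// addr_ge0.
Qed.

(** The level bound [i.1 <= P.1] is carried along so that prepending a cell of strictly higher level
    keeps the list free of repetitions. *)
Lemma generation_chain N P x : good x -> 'G_P x ->
  (\bigcup_(Q in generation N P) 'G_Q) x \/
  exists s : seq cell, [/\ uniq s,
    forall i, i \in s -> [/\ exists k, generation k P i, 'G_i x & i.1 <= P.1] &
    `|F P x| <= local_constant * \sum_(i <- s) cell_weight avg i].
Proof.
move=> gx; elim: N P => [|N IH] P Px; first by left; exists P.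
have [[Q cQ Qx]|nch] := pselect ((\bigcup_(Q in child P) 'G_Q) x); last first.
  right; exists [:: P]; split => //; last by rewrite big_seq1; exact: leaf_estimate.
  by move=> i; rewrite inE => /eqP->; split => //; exists 0%N.
have [[Z gZ Zx]|[s [us sP sF]]] := IH Q Qx.
  by left; exists Z => //; exists Q.
have QP : Q.1 < P.1 by have [] := cQ.
right; exists (P :: s); split.
- rewrite /= us andbT; apply/negP => /sP[_ _ PQ].
  by move: (le_lt_trans PQ QP); rewrite ltxx.
- move=> i; rewrite inE => /orP[/eqP->|/sP[[k gk] ix iQ]].
    by split => //; exists 0%N.
  by split => //; [exists k.+1; exists Q|exact: le_trans iQ (ltW QP)].
- rewrite big_cons mulrDr; apply: le_trans (child_estimate gx cQ Qx) _.
  by rewrite lerD2l.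
Qed.

Lemma family_domination : {ae mu, forall x, forall P, root P -> 'G_P x ->
  exists s : seq cell, [/\ uniq s, forall i, i \in s -> family i /\ 'G_i x &
    `|F P x| <= local_constant * \sum_(i <- s) cell_weight avg i]}.
Proof.
have lim : {ae mu, forall x, forall P,
    ~ (\bigcap_N \bigcup_(Q in generation N P) 'G_Q) x}.
  apply: ae_forall_countable => P; apply: negligibleS (generation_limit P).
  by move=> x /= /contrapT.
apply: ae_imply (ae_and good_ae lim) => x [gx nlim] P rP Px.
have [N nN] : exists N, ~ (\bigcup_(Q in generation N P) 'G_Q) x.
  apply: contrapT => no; apply: (nlim P) => N _; apply: contrapT => nN.
  by apply: no; exists N.
have [//|[s [us sP sF]]] := generation_chain N gx Px.
exists s; split => // i /sP[gk ix _]; split => //.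
by exists P.
Qed.

End sparse_family.

(** * From the integral condition to a dyadic sum *)

Section log_dini_sum.
Context {R : realType}.
Variable rho : R -> R.
Hypothesis rho_mod : modulus_of_continuity rho.
Hypothesis rho_dini : log_dini rho.
Local Notation leb := (@lebesgue_measure R).

Let h (t : R) : R := rho t * ln (1 / t) / t.

Let I01 : set (measurableTypeR R) := `]0, 1[%classic.

Let measurable_h : measurable_fun I01 (EFin \o h).
Proof.
have [rho_cont _ _ _ _] := rho_mod.
have mrho : measurable_fun I01 rho.
  apply: (@measurable_funS _ _ _ _ (`[0, +oo[%classic : set (measurableTypeR R))) => //.
    by move=> t; rewrite /I01 /= !in_itv/= andbT => /andP[/ltW].
  exact: subspace_continuous_measurable_fun.
apply/measurable_EFinP.
apply: (eq_measurable_fun (fun t => rho t * (- ln t * expR (- ln t)))).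
  move=> t; rewrite inE /I01 /= in_itv/= => /andP[t0 _].
  by rewrite /h div1r lnV ?posrE// expRN lnK ?posrE// mulrA.
apply: measurable_funM => //; apply: (measurable_funS measurableT) => //.
have mln : measurable_fun setT (fun t : R => - ln t).
  by apply: measurableT_comp => //; exact: measurable_ln.
by apply: measurable_funM => //; apply: measurableT_comp => //; exact: measurable_expR.
Qed.

Lemma log_dini_dyadic_sum : exists sigma, forall N,
  \sum_(l < N) rho (2 ^+ l.+1)^-1 <= sigma.
Proof.
have [_ rho0 rho_mono _ _] := rho_mod.
(* The factor 3/4 keeps [ln (1 / t)] away from 0 on [J l], also for [l = 0]. *)
pose J (l : nat) : set (measurableTypeR R) := `[(2 ^+ l.+1)^-1, (3 / 4) * (2 ^+ l)^-1[%classic.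
have p2 l : 0 < (2 ^+ l)^-1 :> R by rewrite invr_gt0 exprn_gt0.
have pS l : (2 ^+ l.+1)^-1 = (2 ^+ l)^-1 / 2 :> R by rewrite exprSr invfM.
have p1 l : (2 ^+ l)^-1 <= 1 :> R by rewrite invf_le1 ?exprn_gt0// exprn_ege1// ler1n.
have h0 t : I01 t -> (0 <= (EFin \o h) t)%E.
  rewrite /I01 /= in_itv/= => /andP[t0 t1]; rewrite lee_fin /h.
  rewrite !mulr_ge0 ?invr_ge0 ?rho0 ?ln_ge0 ?(ltW t0)//.
  by rewrite ler_pdivlMr// mul1r ltW.
have J01 l : J l `<=` I01.
  move=> t; rewrite /J /I01 /= !in_itv/= => /andP[h1 h2]; apply/andP; split.
    exact: lt_le_trans h1.
  by apply: lt_le_trans h2 _; have := p1 l; lra.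
have mJ l : measurable (J l) by exact: measurable_itv.
have mI : measurable I01 by exact: measurable_itv.
have rp l : 0 <= rho (2 ^+ l.+1)^-1 by rewrite rho0// ltW.
have lnc : 0 < ln (4 / 3 : R) by rewrite ln_gt0//; lra.
(* On [J l], of length [(2 ^+ l)^-1 / 4], the logarithm is at least [ln (4 / 3)] and [1 / t] at
   least [2 ^+ l]; the product of the three is [c]. *)
pose c := ln (4 / 3 : R) / 4; have c0 : 0 < c by rewrite divr_gt0.
have lower l : ((rho (2 ^+ l.+1)^-1 * c)%:E <= \int[leb]_(t in J l) (EFin \o h) t)%E.
  apply: (@le_trans _ _ (\int[leb]_(t in J l)
      (cst (rho (2 ^+ l.+1)^-1 * ln (4 / 3 : R) * 2 ^+ l)%:E) t)%E).
    have lJ : leb (J l) = ((2 ^+ l)^-1 / 4)%:E.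
      rewrite /J lebesgue_measure_itv /= lte_fin ifT; last by rewrite pS; have := p2 l; lra.
      by rewrite -EFinB pS; congr (_%:E); field; rewrite expf_neq0.
    rewrite integral_cst//.
    apply: (@le_trans _ _ ((rho (2 ^+ l.+1)^-1 * ln (4 / 3 : R) * 2 ^+ l)%:E * leb (J l))%E).
      rewrite lJ -EFinM lee_fin le_eqVlt; apply/orP; left; apply/eqP.
      by rewrite /c; field; rewrite expf_neq0.
    exact: lexx.
  apply: ge0_le_integral => //.
  - by move=> t _; rewrite lee_fin !mulr_ge0 ?exprn_ge0 ?rp ?(ltW lnc).
  - exact: (measurable_funS mI (@J01 l) measurable_h).
  move=> t Jt; have := @J01 l t Jt; move: Jt.
  rewrite /J /I01 /= !in_itv/= => /andP[h1 h2] /andP[t0 t1]; rewrite lee_fin /h.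
  have l1 : 2 ^+ l <= t^-1.
    rewrite -[leLHS]invrK lef_pV2 ?posrE//.
    by apply: ltW; apply: lt_le_trans h2 _; have := p2 l; lra.
  have l2 : ln (4 / 3) <= ln (1 / t).
    rewrite ler_ln ?posrE ?divr_gt0// div1r -[leLHS]invrK lef_pV2 ?posrE ?invr_gt0 ?divr_gt0//.
    rewrite invf_div; apply: ltW; apply: lt_le_trans h2 _.
    by have := p1 l; lra.
  have r1 : rho (2 ^+ l.+1)^-1 <= rho t by rewrite rho_mono// ltW.
  apply: ler_pM => //; first by rewrite mulr_ge0// ltW.
  by apply: ler_pM => //; exact: ltW.
have disJ : trivIset setT J.
  have lt k l t : (k < l)%N -> J k t -> J l t -> False.
    move=> kl; rewrite /J /= !in_itv/= => /andP[h1 _] /andP[_ h2].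
    have : (2 ^+ l)^-1 <= (2 ^+ k.+1)^-1 :> R.
      by rewrite lef_pV2 ?posrE ?exprn_gt0// ler_weXn2l// ler1n.
    by have := p2 l; lra.
  move=> k l _ _ [t [Jk Jl]].
  have [/lt H|/lt H|//] := ltngtP k l.
    by case: (H t Jk Jl).
  by case: (H t Jl Jk).
exists (fine (\int[leb]_(t in I01) (EFin \o h) t)%E / c) => N.
rewrite ler_pdivlMr// mulr_suml -lee_fin fineK; last first.
  rewrite ge0_fin_numE; first exact: rho_dini.
  exact: integral_ge0.
rewrite -sumEFin.
have -> : (\sum_(l < N) (rho (2 ^+ l.+1)^-1 * c)%:E =
    \sum_(l <- iota 0 N) (rho (2 ^+ l.+1)^-1 * c)%:E)%E.
  by rewrite -(big_mkord xpredT (fun l => (rho (2 ^+ l.+1)^-1 * c)%:E)) /index_iota subn0.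
apply: (@le_trans _ _ (\sum_(l <- iota 0 N) \int[leb]_(t in J l) (EFin \o h) t)%E).
  by apply: lee_sum => l _; exact: lower.
have UJ : \big[setU/set0]_(l <- iota 0 N) J l `<=` I01.
  by move=> t; rewrite -bigcup_seq => -[l _ /J01].
rewrite -ge0_integral_bigsetU//.
- apply: ge0_subset_integral => //.
  exact: bigsetU_measurable.
- exact: iota_uniq.
- exact: sub_trivIset disJ.
- exact: (measurable_funS mI UJ measurable_h).
- by move=> t /UJ; exact: h0.
Qed.

End log_dini_sum.

(** * Averages over the triples of cells *)

Section localized_averages.
Context {R : realType} {n m : nat}.
Variable f : 'I_m -> 'rV[R]_n -> R.
Hypothesis f_L1 : forall i, in_L1 (f i).
Local Notation cell := (int * 'rV[int]_n)%type.
Local Notation TG i := (cube_set (triple (@grid_cube R n i))).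

Lemma L1_norm_localizeU (A B : set (leb_mxType R 1 n)) (g : 'rV[R]_n -> R) :
  measurable A -> measurable B -> A `&` B = set0 -> in_L1 g ->
  L1_norm (localize (A `|` B) g) = L1_norm (localize A g) + L1_norm (localize B g).
Proof.
move=> mA mB AB gi; rewrite !L1_norm_localize Rintegral_setU//; last exact/eqP.
apply: (integrableS measurableT) => //; first exact: measurableU.
exact: integrable_norm.
Qed.

Lemma L1_norm_localize_sum (I : choiceType) (S : I -> set (leb_mxType R 1 n)) (s : seq I)
    (g : 'rV[R]_n -> R) :
  (forall i, measurable (S i)) -> in_L1 g -> uniq s ->
  (forall i j, i \in s -> j \in s -> i != j -> S i `&` S j = set0) ->
  L1_norm (localize (\big[setU/set0]_(i <- s) S i) g) =
  \sum_(i <- s) L1_norm (localize (S i) g).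
Proof.
move=> mS gi; elim: s => [|i s IH] us dis.
  by rewrite !big_nil L1_norm_localize Rintegral_set0.
move: us => /= /andP[iNs us]; rewrite !big_cons L1_norm_localizeU//.
- by congr (_ + _); apply: IH => // j k js ks; apply: dis; rewrite inE ?js ?ks orbT.
- exact: bigsetU_measurable.
- apply/seteqP; split => // x [Six]; rewrite -bigcup_seq => -[j /= js Sjx].
  have ij : i != j by apply: contraNneq iNs => ->.
  have e : S i `&` S j = set0 by apply: dis => //; rewrite inE ?eqxx ?js ?orbT.
  by have : (S i `&` S j) x := conj Six Sjx; rewrite e.
Qed.

Lemma cell_avg_mass (i : cell) j :
  cell_avg f i j * (3 ^+ n * cell_vol i) = L1_norm (localize (TG i) (f j)).
Proof.
rewrite /cell_avg /cell_vol exprMn divfK// gt_eqF// mulr_gt0// exprn_gt0//.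
exact: exprz_gt0.
Qed.

Lemma cell_avg_super P j (s : seq cell) : uniq s ->
  (forall i, i \in s -> TG i `<=` TG P) ->
  (forall i i', i \in s -> i' \in s -> i != i' -> TG i `&` TG i' = set0) ->
  \sum_(i <- s) cell_avg f i j * (3 ^+ n * cell_vol i) <=
  cell_avg f P j * (3 ^+ n * cell_vol P).
Proof.
move=> us sub dis; rewrite cell_avg_mass.
under eq_bigr do rewrite cell_avg_mass.
have mT i : measurable (TG i : set (leb_mxType R 1 n)) by exact: measurable_cube.
rewrite -(L1_norm_localize_sum mT)//; apply: localize_norm_le => //.
  exact: bigsetU_measurable.
by move=> x; rewrite -bigcup_seq => -[i /= /sub]; exact.
Qed.

Lemma average_cell_avg i j :
  average (fun y => `|f j y|) (triple (@grid_cube R n i)) = cell_avg f i j.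
Proof.
rewrite /average volumeE /cell_avg L1_norm_localize mulrC; congr (_ / _).
by rewrite -[side (triple _)]/(3 * side (@grid_cube R n i)) side_grid_cube.
Qed.

End localized_averages.

(** * Root cubes *)

Section root_cells.
Context {R : realType} {n : nat}.
Local Notation cell := (int * 'rV[int]_n)%type.
Local Notation "''G_' i" := (cube_set (@grid_cube R n i)) (at level 8, i at level 2, format "''G_' i").
Variable K : int.

(* The cubes outside the one of generation [K] around the origin are the siblings
   of the larger cubes around the origin; their triples contain that cube. *)
Definition root_cell : set cell := [set P | [/\ K <= P.1,
  'G_P `<=` 'G_(gidx (P.1 + 1) (0 : 'rV[R]_n)) &
  P.1 = K \/ P <> gidx P.1 (0 : 'rV[R]_n)]].

Lemma root_cell_disjoint P P' (x : 'rV[R]_n) : root_cell P -> root_cell P' ->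
  'G_P x -> 'G_P' x -> P = P'.
Proof.
have H (Q Q' : cell) : root_cell Q -> root_cell Q' -> 'G_Q x -> 'G_Q' x -> Q.1 < Q'.1 -> False.
  move=> [KQ subQ _] [_ _ rQ'] Qx Q'x QQ'.
  have e : gidx (Q.1 + 1) x = gidx (Q.1 + 1) (0 : 'rV[R]_n).
    by have /gridP := subQ _ Qx.
  have e' : gidx Q'.1 x = gidx Q'.1 (0 : 'rV[R]_n) by apply: gidx_le e; rewrite lezD1.
  case: rQ' => [Q'K|]; first by move: (le_lt_trans KQ QQ'); rewrite Q'K ltxx.
  by apply; rewrite -e'; apply/esym/gridP.
move=> rP rP' Px P'x; have [lt|lt|eq] := ltgtP P.1 P'.1.
- by case: (H _ _ rP rP' Px P'x lt).
- by case: (H _ _ rP' rP P'x Px lt).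
- exact: (@cell_nested R n _ _ eq x Px P'x).
Qed.

Lemma root_cell_cover (x : 'rV[R]_n) : exists2 P, root_cell P & 'G_P x.
Proof.
have [r xr] := row_bounded x.
have [L hL] := @lidx_bounded R n 1 base_shift ltr01 base_central r.
(* For the least such [d], the cell of [x] in generation [K + d] lies in a cell of the origin one
   generation up and, unless [d = 0], does not contain the origin itself. *)
pose B d := gidx (K + d%:Z + 1) x == gidx (K + d%:Z + 1) (0 : 'rV[R]_n).
have exB : exists d, B d.
  exists `|Num.max L K - K|%N; apply/eqP/hL => //.
  have LM : L <= Num.max L K by rewrite le_max lexx.
  have KM : K <= Num.max L K by rewrite le_max lexx orbT.
  rewrite gez0_abs ?subr_ge0// addrCA subrr addr0.
  by apply: le_trans LM _; rewrite lerDl.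
have [d /eqP Bd mind] := ex_minnP exB.
exists (gidx (K + d%:Z) x); last exact: gidx_in.
split => /=; first by rewrite lerDl.
  rewrite -Bd; apply: grid_subset (gidx_in _ x) (gidx_in _ x) _ => /=.
  by rewrite lerDl.
case: d Bd mind => [|d] Bd mind; first by left; rewrite addr0.
right => e; have : B d.
  by apply/eqP; move: e; rewrite intS [1 + _]addrC addrA.
by move/mind; rewrite ltnn.
Qed.

(** The cell of the origin one generation above [P] has twice the side and contains both [P] and
    [x]; any such cube lies in the triple of [P]. *)
Lemma root_cell_triple (r : R) P :
  (forall k (x : 'rV[R]_n), K <= k -> (forall j, `|x 0 j| <= r) -> gidx k x = gidx k (0 : 'rV[R]_n)) ->
  root_cell P -> forall x : 'rV[R]_n, (forall j, `|x 0 j| <= r) ->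
  cube_set (triple (@grid_cube R n P)) x.
Proof.
move=> hK [KP sub _] x xr j.
have /cube_subset_bounds/(_ j)[h1 h2] := sub.
have KP1 : K <= P.1 + 1 by apply: le_trans KP _; rewrite lerDl.
have : 'G_(gidx (P.1 + 1) (0 : 'rV[R]_n)) x by rewrite -(hK _ _ KP1 xr); exact: gidx_in.
move=> /(_ j); move: h1 h2; rewrite !side_grid_cube -[(gidx _ _).1]/(P.1 + 1).
have -> : (2 : R) ^ (P.1 + 1) = 2 * 2 ^ P.1 by rewrite expfzDr// mulrC.
rewrite -[side (triple _)]/(3 * side (@grid_cube R n P)).
rewrite -[corner (triple _)]/(corner (@grid_cube R n P) - const_mx (side (@grid_cube R n P))).
rewrite side_grid_cube; move: (corner (grid_cube (gidx _ _))) (corner (grid_cube P)) => c c'.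
have t0 : 0 < 2 ^ P.1 :> R by rewrite exprz_gt0.
by rewrite !mxE => h1 h2 /andP[h3 h4]; apply/andP; split; lra.
Qed.

End root_cells.

Lemma grid_cube_inj {R : realType} {n : nat} : injective (@grid_cube R n).
Proof.
move=> i i' e.
have s : i.1 = i'.1.
  have := congr1 (@side R n) e; rewrite !side_grid_cube.
  by apply: ieexprIz => //; rewrite gt_eqF// ltr1n.
apply: (@cell_nested R n _ _ s (corner (grid_cube i)) (corner_in_cube _)).
by rewrite e; exact: corner_in_cube.
Qed.

(** * Sparse domination *)

Section tripled_family.
Context {R : realType} {n m : nat}.
Local Notation mu := (@lebesgue_mx R 1 n).
Local Notation cell := (int * 'rV[int]_n)%type.
Local Notation "''G_' i" := (cube_set (@grid_cube R n i)) (at level 8, i at level 2, format "''G_' i").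
Local Notation triple_cell := (triple \o @grid_cube R n).
Variable Fam : set cell.

(** Each lattice takes all the triples that belong to it. Distinct cells have distinct triples, so
    sums over triples are sums over cells. *)
Definition tripled (D : set (cube R n)) : set (cube R n) :=
  triple_cell @` [set i | Fam i /\ D (triple_cell i)].

Lemma triple_cell_inj (X : set cell) : set_inj X triple_cell.
Proof. by move=> i i' _ _ /triple_inj/grid_cube_inj. Qed.

(** If the triple lies in [Q], so does the cell: packing of the cells in [Q] with constant 2 and the
    volume factor [3 ^+ n] give [2 * 3 ^ n], below the constant claimed. *)
Lemma tripled_carleson (D : set (cube R n)) :
  (forall (A : set (leb_mxType R 1 n)) (s : seq cell), measurable A -> uniq s ->
    (forall i, i \in s -> Fam i /\ 'G_i `<=` A) ->
    ((\sum_(i <- s) cell_vol i)%:E <= 2%:E * mu A)%E) ->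
  carleson D (14 * 3 ^ n)%:R (tripled D).
Proof.
move=> packed; split.
- rewrite ltr1n; apply: (@leq_trans 14) => //.
  by rewrite leq_pmulr// expn_gt0.
- by move=> _ [i [_ Di] <-].
- move=> Q DQ.
  rewrite (_ : [set P | _] = triple_cell @`
      [set i | (Fam i /\ D (triple_cell i)) /\ cube_set (triple_cell i) `<=` cube_set Q]); last first.
    apply/seteqP; split=> P /=.
      by move=> [[i FDi <-] sub]; exists i.
    by move=> [i [FDi sub] <-]; split => //; exists i.
  rewrite esum_image; last exact: triple_cell_inj.
  apply: esum_le_seq => s us sX.
  have le := packed (cube_set Q) s (measurable_cube Q) us.
  apply: (@le_trans _ _ ((3 ^+ n)%:E * (\sum_(i <- s) cell_vol i)%:E)%E).
    rewrite -EFinM mulr_sumr -sumEFin; apply: lee_sum => i _ /=.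
    by rewrite -measure_triple_cell.
  apply: (@le_trans _ _ ((3 ^+ n)%:E * (2%:E * volume Q))%E).
    rewrite lee_wpmul2l ?lee_fin ?exprn_ge0//; apply: le => i /sX[[Fi _] sub].
    by split => //; apply: subset_trans sub; exact: cube_subset_triple.
  rewrite muleA -EFinM lee_wpmul2r ?measure_ge0// lee_fin natrM natrX mulrC.
  by rewrite ler_wpM2r ?exprn_ge0// ler_nat.
Qed.

Lemma sparse_op_ge (D : set (cube R n)) (f : 'I_m -> 'rV[R]_n -> R) (x : 'rV[R]_n)
    (s : seq cell) : uniq s -> (forall i, i \in s -> Fam i /\ 'G_i x) ->
  (\sum_(i <- s) (if `[< D (triple_cell i) >] then cell_weight (cell_avg f) i else 0)%:E <=
   sparse_op (tripled D) (fun j y => `|f j y|%R) x)%E.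
Proof.
move=> us sF; rewrite /sparse_op /tripled esum_image; last exact: triple_cell_inj.
have avg0 (Q : cube R n) j : 0 <= average (fun y => `|f j y|%R) Q.
  rewrite /average mulr_ge0 ?invr_ge0 ?fine_ge0 ?measure_ge0//.
  by apply: integral_ge0 => y _; rewrite lee_fin.
apply: (@le_trans _ _ (\sum_(i <- [seq i <- s | `[< D (triple_cell i) >]])
   ((\prod_(j < m) average (fun y => `|f j y|%R) (triple_cell i)) *
     \1_(cube_set (triple_cell i)) x)%:E)%E).
  rewrite big_filter [leRHS]big_mkcond big_seq [leRHS]big_seq.
  apply: lee_sum => i /sF[_ Gix]; case: ifP => // _.
  rewrite indicE mem_set; last exact: cube_subset_triple.
  rewrite mulr1 lee_fin le_eqVlt; apply/orP; left; apply/eqP.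
  by apply: eq_bigr => j _; rewrite /= average_cell_avg.
apply: esum_ge_seq.
- exact: filter_uniq.
- by move=> i; rewrite mem_filter => /andP[/asboolP Di /sF[Fi _]].
- by move=> i; rewrite lee_fin mulr_ge0// prodr_ge0.
Qed.

End tripled_family.

Theorem theorem13p2 (R : realType) (n m : nat) (rho : R -> R) (CK CW : R) :
  (0 < n)%N -> (0 < m)%N ->
  modulus_of_continuity rho -> log_dini rho ->
  exists C : R,
    forall T : ('I_m -> 'rV[R]_n -> R) -> 'rV[R]_n -> \bar R,
      CZ_operator rho CK CW T ->
      forall f : 'I_m -> 'rV[R]_n -> R,
        (forall i, in_Linfty0 (f i)) ->
        exists D S : 'I_(3 ^ n) -> set (cube R n),
          [/\ forall j, dyadic_lattice (D j),
              forall j, carleson (D j) (14 * 3 ^ n)%:R (S j)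
            & {ae (@lebesgue_mx R 1 n), forall x,
                (`|T f x| <=
                 C%:E * \sum_(j < 3 ^ n)
                          sparse_op (S j) (fun i y => `|f i y|%R) x)%E}].
Proof.
move=> _ m0 rho_mod rho_dini.
have [sigma sigmaP] := log_dini_dyadic_sum rho_mod rho_dini.
have [_ rho0 _ _ _] := rho_mod.
pose lam := @weak_level R n m CW 32^-1.
pose c l := m%:R * `|CK| * 3 ^+ (n * m) * rho (2 ^+ l.+1)^-1.
pose c6 : R := m%:R * `|CK| * 6 ^+ (n * m).
pose sg := m%:R * `|CK| * 3 ^+ (n * m) * sigma.
have k0 : 0 <= m%:R * `|CK| * 3 ^+ (n * m) by rewrite !mulr_ge0// exprn_ge0.
have c0 l : 0 <= c l by rewrite mulr_ge0// rho0// invr_ge0 exprn_ge0.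
have csum N : \sum_(l < N) c l <= sg by rewrite -mulr_sumr ler_wpM2l.
have c60 : 0 <= c6 by rewrite !mulr_ge0// exprn_ge0.
have lam0 : 0 <= lam.
  by rewrite exprn_ge0// addr_ge0// divr_ge0// ?mulr_ge0// ?exprn_ge0.
(* Fixed before [T] and [f]: it is built from [n], [m], [CK], [CW] and, through [sigma], from
   [rho]. *)
exists (@local_constant R n m lam sg c6) => T [Tm Tl Tw [K [Km Ks Ksm Ka]]] f fL.
have fL1 i : in_L1 (f i) by exact: Linfty0_L1.
pose mu := @lebesgue_mx R 1 n.
pose exc i := exceptional T f lam i.
have mexc i : measurable (exc i) by exact: (measurable_superlevel Tm fL1).
have excs i : (mu (exc i) <= (32^-1 * cell_vol i)%:E)%E.
  by apply: (exceptional_small m0 Tm Tw fL1); rewrite invr_gt0.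
have /choice[U UP] (P : int * 'rV[int]_n) : exists U : set 'rV[R]_n,
    [/\ grid_open U, exc P `&` cube_set (grid_cube P) `<=` U &
      (mu (U `&` cube_set (grid_cube P)) <= (16^-1 * cell_vol P)%:E)%E].
  have mE : measurable (exc P `&` cube_set (grid_cube P) : set (leb_mxType R 1 n)).
    by apply: measurableI => //; exact: measurable_cube.
  have v0 : 0 < 32^-1 * cell_vol P :> R by rewrite mulr_gt0 ?invr_gt0 ?cell_vol_gt0.
  have [U [oU EU Ule]] := grid_outer_regular mE (@subIsetr _ _ _) v0.
  exists U; split => //; apply: le_trans Ule _.
  apply: (@le_trans _ _ ((32^-1 * cell_vol P)%:E + (32^-1 * cell_vol P)%:E)%E).
    rewrite leeD2r//; apply: le_trans (excs P); apply: le_measure; rewrite ?inE.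
    - exact: mE.
    - exact: mexc.
    - exact: subIsetl.
  by rewrite -EFinD lee_fin; lra.
have oU P : grid_open (U P) by have [] := UP P.
have sU P : (mu (U P `&` cube_set (grid_cube P)) <= (16^-1 * cell_vol P)%:E)%E.
  by have [] := UP P.
have excU P x : cube_set (grid_cube P) x -> exc P x -> U P x.
  by move=> Px ex; have [_ + _] := UP P; apply.
have [r fr] : exists r, forall i x, f i x != 0 -> forall j, `|x 0 j| <= r.
  have /choice[r rP] i : exists r, forall x, f i x != 0 -> forall j, `|x 0 j| <= r.
    have [_ _ /compact_coord_bounded[r rP]] := fL i; exists r => x fx.
    by apply: rP; exact: (@subset_closure _ [set x | f i x != 0]).
  exists (\sum_i `|r i|) => i x fx j; apply: le_trans (rP i x fx j) _.
  apply: le_trans (ler_norm _) _; rewrite (bigD1 i)//= lerDl.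
  exact: sumr_ge0.
(* From generation [K0] on, the cell of the origin contains the supports of all the functions; the
   roots start there. *)
have [K0 hK0] := @lidx_bounded R n 1 base_shift ltr01 base_central r.
have [G hG] := @grid_code n.
pose Fam := family (cell_avg f) U (root_cell (R := R) K0).
pose D j := range (@triple_cube R n (G j)).
exists D, (fun j => tripled Fam (D j)); split.
- by move=> j; exact: dyadic_lattice_triple.
- move=> j; apply: tripled_carleson => A s mA us sF.
  apply: (family_carleson m0 (@cell_avg_ge0 _ _ _ _) (cell_avg_super fL1) oU sU _ mA us sF).
  by move=> P P' x; exact: root_cell_disjoint.
have gae := ae_good Tm Tl Ka Km fL1.
have Fsmall i x : ~ exc i x ->
    `|fine (local_T T f i x)| <= lam * cell_weight (cell_avg f) i.
  move=> /negP; rewrite -leNgt -lee_fin.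
  by case: (local_T T f i x) => [a| |] //=.
have dom := family_domination m0 (@cell_avg_ge0 _ _ _ f) (cell_avg_super fL1) oU sU
  (root_cell (R := R) K0) gae mexc excs excU Fsmall
  (local_T_parent Ks fL1)
  (local_T_oscillation rho0 Ks Ksm fL1) c0 csum lam0 c60.
have [_ Tfin] := Tm f fL1.
apply: ae_imply (ae_and dom Tfin) => x [domx Tfx].
have [P rP Px] := root_cell_cover K0 x.
(* The triple of a root contains all the supports, so the restriction changes nothing. *)
have TfE : T f = local_T T f P.
  congr T; apply/funext => i; apply/funext => y.
  rewrite /localized /localize indicE; have [->|fy] := eqVneq (f i y) 0.
    by rewrite mul0r.
  rewrite mem_set ?mulr1//; apply: (root_cell_triple (r := r) _ rP) => //.
  exact: fr fy.
have [s [us sF sw]] := domx P rP Px.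
rewrite -TfE in sw; rewrite -(fineK Tfx).
have C0 : 0 <= @local_constant R n m lam sg c6.
  have sg0 : 0 <= sg by have := csum 0%N; rewrite big_ord0.
  have g0 : 0 <= @growth R n m ^+ m by rewrite exprn_ge0// (le_trans ler01)// growth_ge1.
  by rewrite /local_constant !addr_ge0// mulr_ge0// addr_ge0.
apply: (@le_trans _ _ (@local_constant R n m lam sg c6 *
    \sum_(i <- s) cell_weight (cell_avg f) i)%:E); first by rewrite lee_fin.
rewrite EFinM lee_wpmul2l ?lee_fin//.
(* Every triple belongs to at least one of the lattices, so each weight of the finite list is
   counted at least once on the right. *)
apply: (@le_trans _ _ (\sum_(j < 3 ^ n) \sum_(i <- s)
   (if `[< D j (triple (grid_cube i)) >] then cell_weight (cell_avg f) i else 0)%:E)%E); last first.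
  by apply: lee_sum => j _; exact: sparse_op_ge.
rewrite exchange_big /= -sumEFin; apply: lee_sum => i _.
have [g [i' e]] := @triple_grid_cube R n i; have [j jg] := hG g.
have w0 : 0 <= cell_weight (cell_avg f) i by apply: prodr_ge0 => k _; exact: cell_avg_ge0.
rewrite sumEFin lee_fin (bigD1 j)//= asboolT; last by rewrite /D jg e; exists i'.
by rewrite lerDl sumr_ge0// => k _; case: ifP.
Qed.
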